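(* There is an absolute constant $k_1>0$ such that for every analytic self-map $\phi$ of $\mathbb D$, every $\xi\in\mathbb T$, every $h\in(0,1-|\phi(0)|)$ and every $\varepsilon\in(0,1)$, $$\mu_\phi\big(S(\xi,\varepsilon h)\big)\le k_1\,\varepsilon\,\mu_\phi\big(S(\xi,h)\big).$$
   Context: $S(\xi,h)=\{z\in\overline{\mathbb D}:|z-\xi|<h\}$. $\mu_\phi(E)=m((\phi^* )^{-1}(E))$ for Borel $E\subseteq\overline{\mathbb D}$, where $\phi^*$ are the radial boundary values of $\phi$ and $m$ is normalized Lebesgue measure on $\mathbb T$. *)

(* Defs.v *)
From Stdlib Require Import Reals ClassicalEpsilon.
From Coquelicot Require Import Coquelicot.
From mathcomp Require Import all_boot all_order all_algebra.
From mathcomp Require Import all_classical all_reals.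
From mathcomp Require Import Rstruct Rstruct_topology lebesgue_measure measure ereal.

Open Scope R_scope.

Definition unit_disc (z : C) : Prop := Cmod z < 1.

Definition analytic_self_map (phi : C -> C) : Prop :=
  (forall z : C, unit_disc z -> ex_derive phi z) /\
  (forall z : C, unit_disc z -> unit_disc (phi z)).

Definition radial_limit (phi : C -> C) (zeta l : C) : Prop :=
  filterlim (fun r : R => phi (RtoC r * zeta)%C) (at_left 1) (locally l).

(* radial boundary values phi-star; where the radial limit does not exist
   (a null set by Fatou's theorem) the value is an arbitrary default (0). *)
Definition radial_bv (phi : C -> C) (zeta : C) : C :=
  match excluded_middle_informative (exists l, radial_limit phi zeta l) with
  | left H => proj1_sig (ClassicalEpsilon.constructive_indefinite_description _ H)
  | right _ => 0%C
  end.

Definition circ (t : R) : C := (cos (2 * PI * t), sin (2 * PI * t)).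

Definition circle_measure (A : C -> Prop) : \bar R :=
  (@lebesgue_measure R) (fun t : R => 0 <= t < 1 /\ A (circ t)).

Definition mu_phi (phi : C -> C) (E : C -> Prop) : \bar R :=
  circle_measure (fun zeta => E (radial_bv phi zeta)).

Definition S_box (xi : C) (h : R) (z : C) : Prop :=
  Cmod z <= 1 /\ Cmod (z - xi)%C < h.

(* Main.v *)
(** With v = 1 - conj(xi) phi, a map into the right half-plane, one has |v| = |phi - xi| and
    |v(0)| > h; put A = {|v*| < h}, B = {|v*| < eps h}.  For eps <= 1/2 there is an explicit
    function S on the half-plane, built from Re ((h - w) / (h + w)) and
    Re (eps h / (eps h + w)), which vanishes for |w| >= h, satisfies
    S <= 16 eps 1_{|w| < h} - 1_{|w| < eps h}, and is subharmonic.  Hence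
    0 = S(v(0)) <= mean of S(v(r .)) over the circle for every r < 1, and r -> 1 gives
    0 <= 16 eps m(A) - m(B).

    The passage to the limit needs Fatou's theorem.  A primitive of phi is Lipschitz, so it
    extends to the closed disc with Lipschitz boundary values, which are differentiable almost
    everywhere (Radon-Nikodym and Lebesgue differentiation).  At a point of differentiability
    the maximum principle and Cauchy's estimate yield the radial limit of phi. *)

Require Import Defs.
From Stdlib Require Import Reals Lra Psatz ZArith Lia Classical ClassicalEpsilon.
From Coquelicot Require Import Coquelicot.

Open Scope R_scope.

(** * Complex derivatives *)

(** The test function must be at most 16 eps - 1 on |w| < eps h, a negative number for small eps,
    and still vanish for |w| >= h. The positive part of a harmonic function gives the zero far away
    but would erase the negative values near 0. So the positive part is taken only where |w| > h /
    2. The two pieces glue to a subharmonic function because the harmonic function is strictly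
    positive on |w| = h / 2, and this positivity comes down to 16 eps / 3 > 4 eps: the constant 16
    is chosen for it. The restriction eps <= 1/2 keeps |w| < eps h inside the untouched region; for
    eps > 1/2 one has 16 eps >= 1 and monotonicity of the measure is enough.

    The function theory is built on pairs P, G with P' = G and G merely continuous. Mean values and
    Cauchy's estimate are read off from the primitive P, so the derivative of a holomorphic function
    never has to be differentiated. The sets A and B are compared through outer measure, so that
    they may be changed on the null set where radial limits fail to exist. *)

Notation is_cderive := (@is_derive C_AbsRing C_NormedModule).
Notation ex_cderive := (@ex_derive C_AbsRing C_NormedModule).

Lemma is_cderive_eps (f : C -> C) (z l : C) :
  is_cderive f z l <->
  forall e, 0 < e -> exists d, 0 < d /\ forall w, Cmod (w - z) < d ->
    Cmod (f w - f z - l * (w - z)) <= e * Cmod (w - z).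
Proof.
split.
- intros [_ H] e He.
  destruct (H z (fun P HP => HP) (mkposreal e He)) as [d Hd].
  exists d; split; [apply cond_pos|].
  intros w Hw. specialize (Hd w Hw).
  replace (f w - f z - l * (w - z))%C with (f w - f z - (w - z) * l)%C by ring.
  exact Hd.
- intros H; split; [apply is_linear_scal_l|].
  intros x Hx e.
  assert (x = z) as ->.
  { symmetry. apply (is_filter_lim_locally_unique (V := AbsRing_NormedModule C_AbsRing)). exact Hx. }
  destruct (H e (cond_pos e)) as [d [Hd H']].
  exists (mkposreal d Hd). intros w Hw. specialize (H' w Hw).
  replace (f w - f z - l * (w - z))%C with (f w - f z - (w - z) * l)%C in H' by ring.
  exact H'.
Qed.

(** Phrased with [Cmod], continuity does not depend on which of the uniform structures on the
    complex numbers is meant. *)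
Definition ccont (f : C -> C) (z : C) : Prop :=
  forall e, 0 < e -> exists d, 0 < d /\ forall w, Cmod (w - z) < d -> Cmod (f w - f z) < e.

Lemma is_cderive_ccont (f : C -> C) (z l : C) : is_cderive f z l -> ccont f z.
Proof.
intros H0 e He. assert (H := proj1 (is_cderive_eps f z l) H0).
destruct (H 1 Rlt_0_1) as [d [Hd H']].
set (M := 1 + Cmod l).
assert (0 < M) by (unfold M; generalize (Cmod_ge_0 l); lra).
exists (Rmin d (e / M)); split.
- apply Rmin_glb_lt; [lra|apply Rdiv_lt_0_compat; lra].
- intros w Hw.
  assert (Cmod (w - z) < d) by (eapply Rlt_le_trans; [apply Hw|apply Rmin_l]).
  assert (Hw2 : Cmod (w - z) < e / M) by (eapply Rlt_le_trans; [apply Hw|apply Rmin_r]).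
  replace (f w - f z)%C with ((f w - f z - l * (w - z)) + l * (w - z))%C by ring.
  eapply Rle_lt_trans; [apply Cmod_triangle|].
  rewrite Cmod_mult. specialize (H' w H2).
  apply Rle_lt_trans with (M * Cmod (w - z)); [unfold M; lra|].
  apply Rmult_lt_compat_l with (r := M) in Hw2; [|lra].
  replace (M * (e / M)) with e in Hw2 by (field; lra). lra.
Qed.

Lemma ex_cderive_ccont (f : C -> C) (z : C) : ex_cderive f z -> ccont f z.
Proof. intros [l H]. eapply is_cderive_ccont; exact H. Qed.

Lemma Im_le_Cmod (z : C) : Rabs (Im z) <= Cmod z.
Proof. eapply Rle_trans; [apply Rmax_r|apply Rmax_Cmod]. Qed.

Lemma Cmod_le_abs (z : C) : Cmod z <= Rabs (Re z) + Rabs (Im z).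
Proof.
unfold Cmod. generalize (Rabs_pos (Re z)) (Rabs_pos (Im z)); intros.
apply Rsqr_incr_0_var; [|lra].
rewrite Rsqr_sqrt.
- unfold Rsqr, Re, Im in *. 
  rewrite <- (pow2_abs (fst z)), <- (pow2_abs (snd z)). nra.
- nra.
Qed.

Lemma ccont_curve (f : C -> C) (g : R -> C) (t : R) :
  (forall s, Cmod (g s - g t) <= Rabs (s - t)) -> ccont f (g t) ->
  continuous (fun s => Re (f (g s))) t /\ continuous (fun s => Im (f (g s))) t.
Proof.
intros Hg Hf; split; apply continuity_pt_filterlim; intros e He;
  destruct (Hf e He) as [d [Hd H]]; exists d; (split; [exact Hd|]);
  intros s [_ Hs]; simpl in *; unfold R_dist in *.
- 
  eapply Rle_lt_trans; [apply (re_le_Cmod (f (g s) - f (g t)))|].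
  apply H. eapply Rle_lt_trans; [apply Hg|exact Hs].
- eapply Rle_lt_trans; [apply (Im_le_Cmod (f (g s) - f (g t)))|].
  apply H. eapply Rle_lt_trans; [apply Hg|exact Hs].
Qed.

(** No order between a and b is assumed: the rectangles below have sides of arbitrary sign. *)
Lemma RInt_near_const (f : R -> R) (a b c M : R) :
  ex_RInt f a b -> (forall t, Rmin a b <= t <= Rmax a b -> Rabs (f t - c) <= M) ->
  Rabs (RInt f a b - c * (b - a)) <= M * Rabs (b - a).
Proof.
assert (K : forall a b, a <= b -> ex_RInt f a b ->
  (forall t, Rmin a b <= t <= Rmax a b -> Rabs (f t - c) <= M) ->
  Rabs (RInt f a b - c * (b - a)) <= M * Rabs (b - a)).
{ clear; intros a b Hab Hf H.
  assert (E : is_RInt (fun t => f t - c) a b (RInt f a b - c * (b - a))).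
  { apply (is_RInt_minus (V := R_NormedModule)); [apply (RInt_correct (V := R_CompleteNormedModule)), Hf|].
    rewrite Rmult_comm. apply (is_RInt_const (V := R_NormedModule) a b c). }
  rewrite <- (is_RInt_unique _ _ _ _ E).
  rewrite (Rabs_pos_eq (b - a)) by lra. rewrite Rmult_comm.
  apply abs_RInt_le_const; [lra|eexists; exact E|].
  intros t Ht. apply H. rewrite Rmin_left, Rmax_right; lra. }
intros Hf H. destruct (Rle_dec a b) as [h|h]; [apply K; auto|].
rewrite <- (opp_RInt_swap (V := R_CompleteNormedModule)) by (apply ex_RInt_swap, Hf).
change (opp (RInt f b a)) with (- RInt f b a).
replace (- RInt f b a - c * (b - a)) with (- (RInt f b a - c * (a - b))) by ring.
rewrite Rabs_Ropp, <- (Rabs_Ropp (b - a)).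
replace (- (b - a)) with (a - b) by ring.
apply K; [lra|apply ex_RInt_swap, Hf|].
intros t. rewrite Rmin_comm, Rmax_comm. apply H.
Qed.

(** * Bisection of the unit square; [Bad a b s] speaks of the square with lower left corner (a, b)
    and side s *)

Section Bisection.

Variable Bad : R -> R -> R -> Prop.
Hypothesis Bad_split : forall a b s, 0 <= a -> 0 <= b -> 0 < s -> a + s <= 1 -> b + s <= 1 ->
  Bad a b s -> Bad a b (s / 2) \/ Bad (a + s / 2) b (s / 2) \/
    Bad a (b + s / 2) (s / 2) \/ Bad (a + s / 2) (b + s / 2) (s / 2).

(** The fourth quarter is taken without a test: if the first three are not bad, [Bad_split] makes it
    bad. *)
Definition bisect_next (p : R * R) (s : R) : R * R :=
  let (a, b) := p in
  if excluded_middle_informative (Bad a b (s / 2)) then (a, b)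
  else if excluded_middle_informative (Bad (a + s / 2) b (s / 2)) then (a + s / 2, b)
  else if excluded_middle_informative (Bad a (b + s / 2) (s / 2)) then (a, b + s / 2)
  else (a + s / 2, b + s / 2).

Fixpoint bisect (n : nat) : R * R :=
  match n with
  | O => (0, 0)
  | S n => bisect_next (bisect n) ((/ 2) ^ n)
  end.

Lemma bisect_next_range (p : R * R) (s : R) : 0 < s ->
  let q := bisect_next p s in
  fst p <= fst q /\ fst q + s / 2 <= fst p + s /\ snd p <= snd q /\ snd q + s / 2 <= snd p + s.
Proof.
destruct p as [a b]; simpl; intros Hs; unfold bisect_next.
repeat destruct (excluded_middle_informative _); simpl; repeat split; lra.
Qed.

Lemma bisect_next_bad (p : R * R) (s : R) :
  0 <= fst p -> 0 <= snd p -> 0 < s -> fst p + s <= 1 -> snd p + s <= 1 ->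
  Bad (fst p) (snd p) s ->
  Bad (fst (bisect_next p s)) (snd (bisect_next p s)) (s / 2).
Proof.
destruct p as [a b]; simpl; intros Ha Hb Hs Has Hbs H.
assert (K := Bad_split a b s Ha Hb Hs Has Hbs H).
unfold bisect_next.
repeat destruct (excluded_middle_informative _); simpl; tauto.
Qed.

Lemma bisect_range (n : nat) :
  0 <= fst (bisect n) /\ 0 <= snd (bisect n) /\
  fst (bisect n) + (/ 2) ^ n <= 1 /\ snd (bisect n) + (/ 2) ^ n <= 1.
Proof.
induction n as [|n [H1 [H2 [H3 H4]]]]; [simpl; repeat split; lra|].
destruct (bisect_next_range (bisect n) ((/ 2) ^ n)) as [G1 [G2 [G3 G4]]]; [apply pow_lt; lra|].
simpl bisect. simpl pow. repeat split; lra.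
Qed.

(** Left ends increase and right ends decrease, so the limit of the left ends stays in every
    interval. *)
Lemma nested_limit (u : nat -> R) :
  (forall n, u n <= u (S n)) -> (forall n, u (S n) + (/ 2) ^ (S n) <= u n + (/ 2) ^ n) ->
  exists A, forall n, u n <= A <= u n + (/ 2) ^ n.
Proof.
intros H1 H2.
assert (HD : Un_decreasing (fun n => u n + (/ 2) ^ n)) by (intros n; apply H2).
assert (Hp : forall n, 0 < (/ 2) ^ n) by (intros n; apply pow_lt; lra).
destruct (growing_cv u H1) as [A HA].
{ exists (u 0%nat + 1). intros x [n ->].
  assert (u n + (/2)^n <= u 0%nat + (/2)^0).
  { apply (decreasing_prop _ 0 n HD). apply PeanoNat.Nat.le_0_l. }
  simpl in H. specialize (Hp n). lra. }
exists A. intros n; split.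
- apply (growing_ineq u A H1 HA).
- apply (decreasing_ineq (fun n => u n + (/ 2) ^ n) A HD).
  replace A with (A + 0) by ring. apply CV_plus; [exact HA|].
  intros e He. destruct (pow_lt_1_zero (/ 2)) with (y := e) as [N HN];
    [rewrite Rabs_pos_eq; lra|exact He|].
  exists N. intros k Hk. unfold R_dist. rewrite Rminus_0_r. apply HN, Hk.
Qed.

(** Serves twice: for Goursat's theorem, and as the compactness argument by which a continuous
    function attains its maximum on a closed disc. *)
Lemma bisection : Bad 0 0 1 ->
  exists A B, forall n, exists a b,
    0 <= a /\ 0 <= b /\ a + (/ 2) ^ n <= 1 /\ b + (/ 2) ^ n <= 1 /\
    a <= A <= a + (/ 2) ^ n /\ b <= B <= b + (/ 2) ^ n /\ Bad a b ((/ 2) ^ n).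
Proof.
intros H0.
assert (Hs : forall n, let p := bisect n in let q := bisect (S n) in
  fst p <= fst q /\ fst q + (/ 2) ^ S n <= fst p + (/ 2) ^ n /\
  snd p <= snd q /\ snd q + (/ 2) ^ S n <= snd p + (/ 2) ^ n).
{ intros n. replace ((/ 2) ^ S n) with ((/ 2) ^ n / 2) by (simpl; lra).
  apply (bisect_next_range (bisect n) ((/ 2) ^ n)). apply pow_lt; lra. }
destruct (nested_limit (fun n => fst (bisect n))) as [A HA];
  [intros n; apply Hs|intros n; apply Hs|].
destruct (nested_limit (fun n => snd (bisect n))) as [B HB];
  [intros n; apply Hs|intros n; apply Hs|].
exists A, B. intros n. exists (fst (bisect n)), (snd (bisect n)).
destruct (bisect_range n) as [H1 [H2 [H3 H4]]].
repeat (split; [auto; try apply HA; try apply HB|]).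
clear H1 H2 H3 H4. induction n as [|n IH]; [exact H0|].
destruct (bisect_range n) as [H1 [H2 [H3 H4]]].
replace ((/ 2) ^ S n) with ((/ 2) ^ n / 2) by (simpl; lra).
apply bisect_next_bad; auto. apply pow_lt; lra.
Qed.

End Bisection.

(** With segments parametrized by s in [0, 1], later proofs need not distinguish the sign of the
    side length p. *)
Lemma between_param (x p t : R) : Rmin x (x + p) <= t <= Rmax x (x + p) ->
  exists s, 0 <= s <= 1 /\ t = x + s * p.
Proof.
intros H. destruct (Req_dec p 0) as [->|Hp].
- exists 0. rewrite Rmin_left, Rmax_left in H; lra.
- exists ((t - x) / p). split; [|field; exact Hp].
  destruct (Rle_dec 0 p).
  + rewrite Rmin_left, Rmax_right in H by lra. assert (0 < p) by lra.
    split; [apply Rdiv_le_0_compat; lra|].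
    apply Rmult_le_reg_r with p; [lra|]. unfold Rdiv. rewrite Rmult_assoc, Rinv_l; lra.
  + rewrite Rmin_right, Rmax_left in H by lra. 
    replace ((t - x) / p) with ((x - t) / (- p)) by (field; lra).
    split; [apply Rdiv_le_0_compat; lra|].
    apply Rmult_le_reg_r with (- p); [lra|]. unfold Rdiv. rewrite Rmult_assoc, Rinv_l; lra.
Qed.

Lemma RInt_near_const_param (f : R -> R) (x p c M : R) :
  ex_RInt f x (x + p) -> (forall s, 0 <= s <= 1 -> Rabs (f (x + s * p) - c) <= M) ->
  Rabs (RInt f x (x + p) - c * p) <= M * Rabs p.
Proof.
intros Hf H. assert (K := RInt_near_const f x (x + p) c M Hf).
replace (x + p - x) with p in K by ring. apply K.
intros t Ht. destruct (between_param _ _ _ Ht) as [s [Hs ->]]. apply H, Hs.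
Qed.

Lemma Cmod_horizontal (s t y : R) : Cmod ((s, y) - (t, y))%C = Rabs (s - t).
Proof.
replace ((s, y) - (t, y))%C with (RtoC (s - t)); [apply Cmod_R|].
apply injective_projections; simpl; ring.
Qed.

Lemma Cmod_vertical (s t x : R) : Cmod ((x, s) - (x, t))%C = Rabs (s - t).
Proof.
replace ((x, s) - (x, t))%C with (Ci * RtoC (s - t))%C.
- rewrite Cmod_mult, Cmod_Ci, Cmod_R. ring.
- apply injective_projections; simpl; ring.
Qed.

Lemma continuous_horizontal (f : C -> C) (t y : R) : ccont f (t, y) ->
  continuous (fun s => Re (f (s, y))) t /\ continuous (fun s => Im (f (s, y))) t.
Proof.
intros H. apply (ccont_curve f (fun s => (s, y))); [|exact H].
intros s. rewrite Cmod_horizontal. lra.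
Qed.

Lemma continuous_vertical (f : C -> C) (x t : R) : ccont f (x, t) ->
  continuous (fun s => Re (f (x, s))) t /\ continuous (fun s => Im (f (x, s))) t.
Proof.
intros H. apply (ccont_curve f (fun s => (x, s))); [|exact H].
intros s. rewrite Cmod_vertical. lra.
Qed.

Lemma ex_RInt_horizontal (f : C -> C) (x y p : R) :
  (forall s, 0 <= s <= 1 -> ccont f (x + s * p, y)) ->
  ex_RInt (fun t => Re (f (t, y))) x (x + p).
Proof.
intros H; apply (ex_RInt_continuous (V := R_CompleteNormedModule)); intros t Ht;
  destruct (between_param _ _ _ Ht) as [s [Hs ->]]; exact (proj1 (continuous_horizontal f _ _ (H s Hs))).
Qed.

Lemma ex_RInt_vertical (f : C -> C) (x y q : R) :
  (forall s, 0 <= s <= 1 -> ccont f (x, y + s * q)) ->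
  ex_RInt (fun t => Im (f (x, t))) y (y + q).
Proof.
intros H; apply (ex_RInt_continuous (V := R_CompleteNormedModule)); intros t Ht;
  destruct (between_param _ _ _ Ht) as [s [Hs ->]]; exact (proj2 (continuous_vertical f _ _ (H s Hs))).
Qed.

(** Real parts of integrals of f dz along the sides of rectangles. On a vertical side dz = i dy, so
    the real part of the integral is minus [vint]. Imaginary parts are recovered later by passing
    from f to - i f. *)
Definition hint (f : C -> C) (x y p : R) : R := RInt (fun t => Re (f (t, y))) x (x + p).
Definition vint (f : C -> C) (x y q : R) : R := RInt (fun t => Im (f (x, t))) y (y + q).

(* Real part of the integral of [f dz] along the boundary of the rectangle with opposite
   corners (x, y) and (x + p, y + q); the signs of p and q are arbitrary. *)
Definition rect_int (f : C -> C) (x y p q : R) : R :=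
  hint f x y p - hint f x (y + q) p + vint f x y q - vint f (x + p) y q.

(* Coquelicot carries two normed-module structures on [C], with the same norm but different balls. *)
Lemma is_cderive_AbsRing (f : C -> C) (z l : C) :
  @is_derive C_AbsRing (AbsRing_NormedModule C_AbsRing) f z l -> is_cderive f z l.
Proof. intros [_ H]. split; [apply is_linear_scal_l|exact H]. Qed.

Lemma is_cderive_AbsRing_inv (f : C -> C) (z l : C) :
  is_cderive f z l -> @is_derive C_AbsRing (AbsRing_NormedModule C_AbsRing) f z l.
Proof. intros [_ H]. split; [apply is_linear_scal_l|exact H]. Qed.

Lemma is_cderive_const (c z : C) : is_cderive (fun _ => c) z (RtoC 0).
Proof. exact (is_derive_const (V := C_NormedModule) c z). Qed.

Lemma is_cderive_id (z : C) : is_cderive (fun w => w) z (RtoC 1).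
Proof. apply is_cderive_AbsRing. exact (is_derive_id (K := C_AbsRing) z). Qed.

Lemma is_cderive_plus (f g : C -> C) (z a b : C) :
  is_cderive f z a -> is_cderive g z b -> is_cderive (fun w => f w + g w)%C z (a + b)%C.
Proof. exact (is_derive_plus (V := C_NormedModule) f g z a b). Qed.

Lemma is_cderive_mult (f g : C -> C) (z a b : C) :
  is_cderive f z a -> is_cderive g z b ->
  is_cderive (fun w => f w * g w)%C z (a * g z + f z * b)%C.
Proof.
intros Hf Hg. apply is_cderive_AbsRing.
apply (is_derive_mult (K := C_AbsRing) f g z a b); [| |exact Cmult_comm];
  apply is_cderive_AbsRing_inv; assumption.
Qed.

Lemma is_cderive_comp (f g : C -> C) (z a b : C) :
  is_cderive f (g z) a -> is_cderive g z b -> is_cderive (fun w => f (g w)) z (b * a)%C.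
Proof.
intros Hf Hg. apply (is_derive_comp (K := C_AbsRing) (V := C_NormedModule) f g z a b Hf).
apply is_cderive_AbsRing_inv, Hg.
Qed.

Lemma is_cderive_scal (f : C -> C) (z c a : C) :
  is_cderive f z a -> is_cderive (fun w => c * f w)%C z (c * a)%C.
Proof.
intros H. replace (c * a)%C with (0 * f z + c * a)%C by ring.
apply is_cderive_mult; [apply is_cderive_const|exact H].
Qed.

Lemma is_cderive_Cinv (z : C) : z <> 0%C -> is_cderive Cinv z (- / (z * z))%C.
Proof.
intros Hz. apply is_cderive_eps. intros e He.
assert (Hm := proj1 (Cmod_gt_0 z) Hz). set (m := Cmod z) in *.
exists (Rmin (m / 2) (e * (m * m * m) / 2)); split.
{ assert (0 < m * m * m) by (repeat apply Rmult_lt_0_compat; lra).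
  apply Rmin_glb_lt; nra. }
intros w Hw.
assert (W1 : Cmod (w - z) < m / 2) by (eapply Rlt_le_trans; [apply Hw|apply Rmin_l]).
assert (W2 : Cmod (w - z) < e * (m * m * m) / 2) by (eapply Rlt_le_trans; [apply Hw|apply Rmin_r]).
assert (Hwm : m / 2 < Cmod w).
{ assert (T := Cmod_triangle w (z - w)). replace (w + (z - w))%C with z in T by ring.
  replace (z - w)%C with (- (w - z))%C in T by ring. rewrite Cmod_opp in T. fold m in T. lra. }
assert (Hw0 : w <> 0%C) by (apply Cmod_gt_0; lra).
replace (/ w - / z - - / (z * z) * (w - z))%C with ((w - z) * ((w - z) / (w * (z * z))))%C
  by (field; auto).
rewrite Cmod_mult, Rmult_comm. apply Rmult_le_compat_r; [apply Cmod_ge_0|].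
rewrite Cmod_div, !Cmod_mult by (repeat apply Cmult_neq_0; auto). fold m.
assert (0 < Cmod w * (m * m)) by (repeat apply Rmult_lt_0_compat; lra).
apply Rmult_le_reg_r with (Cmod w * (m * m)); [assumption|].
unfold Rdiv. rewrite Rmult_assoc, Rinv_l, Rmult_1_r by lra.
apply Rle_trans with (e * (m / 2 * (m * m))); [lra|].
apply Rmult_le_compat_l; [lra|]. apply Rmult_le_compat_r; nra.
Qed.

Lemma ex_cderive_const (c z : C) : ex_cderive (fun _ => c) z.
Proof. exists (RtoC 0). apply is_cderive_const. Qed.

Lemma ex_cderive_id (z : C) : ex_cderive (fun w => w) z.
Proof. exists (RtoC 1). apply is_cderive_id. Qed.

Lemma ex_cderive_plus (f g : C -> C) (z : C) :
  ex_cderive f z -> ex_cderive g z -> ex_cderive (fun w => f w + g w)%C z.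
Proof. intros [a Ha] [b Hb]. exists (a + b)%C. apply is_cderive_plus; assumption. Qed.

Lemma ex_cderive_mult (f g : C -> C) (z : C) :
  ex_cderive f z -> ex_cderive g z -> ex_cderive (fun w => f w * g w)%C z.
Proof.
intros [a Ha] [b Hb]. exists (a * g z + f z * b)%C. apply is_cderive_mult; assumption.
Qed.

Lemma ex_cderive_minus (f g : C -> C) (z : C) :
  ex_cderive f z -> ex_cderive g z -> ex_cderive (fun w => f w - g w)%C z.
Proof.
intros [a Ha] [b Hb]. exists (minus a b).
exact (is_derive_minus (V := C_NormedModule) f g z a b Ha Hb).
Qed.

Lemma ex_cderive_comp (f g : C -> C) (z : C) :
  ex_cderive f (g z) -> ex_cderive g z -> ex_cderive (fun w => f (g w)) z.
Proof. intros [a Ha] [b Hb]. exists (b * a)%C. apply is_cderive_comp; assumption. Qed.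

Lemma ex_cderive_Cinv (f : C -> C) (z : C) :
  f z <> 0%C -> ex_cderive f z -> ex_cderive (fun w => / f w)%C z.
Proof.
intros H Hf. apply (ex_cderive_comp Cinv f); [|exact Hf].
eexists; apply is_cderive_Cinv, H.
Qed.

Lemma ex_cderive_Cpow (f : C -> C) (n : nat) (z : C) :
  ex_cderive f z -> ex_cderive (fun w => f w ^ n)%C z.
Proof.
intros H; induction n as [|n IH]; [apply (ex_cderive_const (RtoC 1))|].
apply (ex_cderive_mult f (fun w => f w ^ n)%C); assumption.
Qed.

(** * Goursat's theorem and primitives *)

Lemma RInt_split (f : R -> R) (a b c : R) : ex_RInt f a b -> ex_RInt f b c ->
  RInt f a b + RInt f b c = RInt f a c.
Proof. exact (RInt_Chasles (V := R_CompleteNormedModule) f a b c). Qed.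

Lemma hint_split (f : C -> C) (x y p q : R) :
  (forall s, 0 <= s <= 1 -> ccont f (x + s * p, y)) ->
  (forall s, 0 <= s <= 1 -> ccont f (x + p + s * q, y)) ->
  hint f x y (p + q) = hint f x y p + hint f (x + p) y q.
Proof.
intros H1 H2. unfold hint. replace (x + (p + q)) with (x + p + q) by ring.
symmetry; apply RInt_split.
- exact (ex_RInt_horizontal f x y p H1).
- exact (ex_RInt_horizontal f (x + p) y q H2).
Qed.

Lemma vint_split (f : C -> C) (x y p q : R) :
  (forall s, 0 <= s <= 1 -> ccont f (x, y + s * p)) ->
  (forall s, 0 <= s <= 1 -> ccont f (x, y + p + s * q)) ->
  vint f x y (p + q) = vint f x y p + vint f x (y + p) q.
Proof.
intros H1 H2. unfold vint. replace (y + (p + q)) with (y + p + q) by ring.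
symmetry; apply RInt_split.
- exact (ex_RInt_vertical f x y p H1).
- exact (ex_RInt_vertical f x (y + p) q H2).
Qed.

(** The inner sides of the four quarters are run through twice in opposite directions and cancel. *)
Lemma rect_int_split (f : C -> C) (x y p q : R) :
  (forall s t, 0 <= s <= 1 -> 0 <= t <= 1 -> ccont f (x + s * p, y + t * q)) ->
  rect_int f x y p q =
    rect_int f x y (p / 2) (q / 2) + rect_int f (x + p / 2) y (p / 2) (q / 2) +
    rect_int f x (y + q / 2) (p / 2) (q / 2) +
    rect_int f (x + p / 2) (y + q / 2) (p / 2) (q / 2).
Proof.
intros H.
assert (Hh : forall t, 0 <= t <= 1 ->
  hint f x (y + t * q) p = hint f x (y + t * q) (p / 2) + hint f (x + p / 2) (y + t * q) (p / 2)).
{ intros t Ht. replace p with (p / 2 + p / 2) at 1 by field. apply hint_split; intros s Hs.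
  - replace (x + s * (p / 2)) with (x + (s / 2) * p) by field. apply H; lra.
  - replace (x + p / 2 + s * (p / 2)) with (x + ((1 + s) / 2) * p) by field. apply H; lra. }
assert (Hv : forall s, 0 <= s <= 1 ->
  vint f (x + s * p) y q = vint f (x + s * p) y (q / 2) + vint f (x + s * p) (y + q / 2) (q / 2)).
{ intros s Hs. replace q with (q / 2 + q / 2) at 1 by field. apply vint_split; intros t Ht.
  - replace (y + t * (q / 2)) with (y + (t / 2) * q) by field. apply H; lra.
  - replace (y + q / 2 + t * (q / 2)) with (y + ((1 + t) / 2) * q) by field. apply H; lra. }
assert (H0 := Hh 0 ltac:(lra)). assert (H1 := Hh 1 ltac:(lra)).
assert (V0 := Hv 0 ltac:(lra)). assert (V1 := Hv 1 ltac:(lra)).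
unfold rect_int.
replace (y + 0 * q) with y in H0 by ring. replace (y + 1 * q) with (y + q) in H1 by ring.
replace (x + 0 * p) with x in V0 by ring. replace (x + 1 * p) with (x + p) in V1 by ring.
replace (y + q / 2 + q / 2) with (y + q) by field.
replace (x + p / 2 + p / 2) with (x + p) by field.
lra.
Qed.

Lemma Cmod_pair_le (a b x y : R) : Rabs a <= Rabs x -> Rabs b <= Rabs y ->
  Cmod (a, b) <= Cmod (x, y).
Proof.
intros H1 H2. unfold Cmod; simpl fst; simpl snd. apply sqrt_le_1_alt.
rewrite <- (pow2_abs a), <- (pow2_abs b), <- (pow2_abs x), <- (pow2_abs y).
generalize (Rabs_pos a) (Rabs_pos b); nra.
Qed.

(** Opposite sides are compared pointwise: up to 2 e (|p| + |q|), f changes by l times the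
    displacement. The horizontal pair then contributes about p q Im l and the vertical pair about -
    p q Im l, so the linear parts cancel and only the error remains. *)
Lemma rect_int_local (f : C -> C) (l z0 : C) (e d x y p q s0 t0 : R) :
  (forall s t, 0 <= s <= 1 -> 0 <= t <= 1 -> ccont f (x + s * p, y + t * q)) ->
  0 <= s0 <= 1 -> 0 <= t0 <= 1 -> z0 = (x + s0 * p, y + t0 * q) ->
  0 <= e ->
  (forall w, Cmod (w - z0) < d -> Cmod (f w - f z0 - l * (w - z0)) <= e * Cmod (w - z0)) ->
  Rabs p + Rabs q < d ->
  Rabs (rect_int f x y p q) <= 2 * e * (Rabs p + Rabs q) * (Rabs p + Rabs q).
Proof.
intros Hc Hs0 Ht0 Hz He Hl Hd.
assert (Hw : forall s t, 0 <= s <= 1 -> 0 <= t <= 1 ->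
  Cmod (f (x + s * p, y + t * q) - f z0 - l * ((x + s * p, y + t * q) - z0)) <=
    e * (Rabs p + Rabs q)).
{ intros s t Hs Ht.
  assert (B : Cmod ((x + s * p, y + t * q) - z0) <= Rabs p + Rabs q).
  { eapply Rle_trans; [apply Cmod_le_abs|]. rewrite Hz; simpl.
    replace (x + s * p + - (x + s0 * p)) with ((s - s0) * p) by ring.
    replace (y + t * q + - (y + t0 * q)) with ((t - t0) * q) by ring.
    rewrite !Rabs_mult.
    assert (Rabs (s - s0) <= 1) by (apply Rabs_le; lra).
    assert (Rabs (t - t0) <= 1) by (apply Rabs_le; lra).
    generalize (Rabs_pos p) (Rabs_pos q); nra. }
  eapply Rle_trans; [apply Hl; lra|]. apply Rmult_le_compat_l; lra. }
set (M := Rabs p + Rabs q) in *.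
assert (E0 : forall w1 w2 : C,
  Cmod (f w1 - f z0 - l * (w1 - z0)) <= e * M -> Cmod (f w2 - f z0 - l * (w2 - z0)) <= e * M ->
  Cmod (f w1 - f w2 - l * (w1 - w2)) <= 2 * e * M).
{ intros w1 w2 H1 H2.
  replace (f w1 - f w2 - l * (w1 - w2))%C with
    ((f w1 - f z0 - l * (w1 - z0)) + - (f w2 - f z0 - l * (w2 - z0)))%C by ring.
  eapply Rle_trans; [apply Cmod_triangle|]. rewrite Cmod_opp. lra. }
assert (EH : forall t, 0 <= t <= 1 -> ex_RInt (fun s => Re (f (s, y + t * q))) x (x + p)).
{ intros t Ht. apply ex_RInt_horizontal. intros s Hs. apply Hc; lra. }
assert (EV : forall s, 0 <= s <= 1 -> ex_RInt (fun t => Im (f (x + s * p, t))) y (y + q)).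
{ intros s Hs. apply ex_RInt_vertical. intros t Ht. apply Hc; lra. }
assert (EH0 := EH 0 ltac:(lra)). assert (EH1 := EH 1 ltac:(lra)).
assert (EV0 := EV 0 ltac:(lra)). assert (EV1 := EV 1 ltac:(lra)).
replace (y + 0 * q) with y in EH0 by ring. replace (y + 1 * q) with (y + q) in EH1 by ring.
replace (x + 0 * p) with x in EV0 by ring. replace (x + 1 * p) with (x + p) in EV1 by ring.
assert (A1 : Rabs (hint f x y p - hint f x (y + q) p - (q * Im l) * p) <= 2 * e * M * Rabs p).
{ unfold hint.
  rewrite <- (RInt_minus (V := R_CompleteNormedModule)) by assumption.
  apply RInt_near_const_param.
  - apply (ex_RInt_minus (V := R_NormedModule)); assumption.
  - intros s Hs.
    eapply Rle_trans; [|apply (E0 (x + s * p, y) (x + s * p, y + q))].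
    + eapply Rle_trans; [|apply re_le_Cmod]. apply Req_le. f_equal. simpl.
      unfold minus, plus, opp, Re, Im; simpl. ring.
    + generalize (Hw s 0 Hs ltac:(lra)). now replace (y + 0 * q) with y by ring.
    + generalize (Hw s 1 Hs ltac:(lra)). now replace (y + 1 * q) with (y + q) by ring. }
assert (A2 : Rabs (vint f x y q - vint f (x + p) y q - (- p * Im l) * q) <= 2 * e * M * Rabs q).
{ unfold vint.
  rewrite <- (RInt_minus (V := R_CompleteNormedModule)) by assumption.
  apply RInt_near_const_param.
  - apply (ex_RInt_minus (V := R_NormedModule)); assumption.
  - intros t Ht.
    eapply Rle_trans; [|apply (E0 (x, y + t * q) (x + p, y + t * q))].
    + eapply Rle_trans; [|apply Im_le_Cmod]. apply Req_le. f_equal. simpl.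
      unfold minus, plus, opp, Re, Im; simpl. ring.
    + generalize (Hw 0 t ltac:(lra) Ht). now replace (x + 0 * p) with x by ring.
    + generalize (Hw 1 t ltac:(lra) Ht). now replace (x + 1 * p) with (x + p) by ring. }
unfold rect_int.
replace (hint f x y p - hint f x (y + q) p + vint f x y q - vint f (x + p) y q) with
  ((hint f x y p - hint f x (y + q) p - q * Im l * p) +
   (vint f x y q - vint f (x + p) y q - - p * Im l * q)) by ring.
eapply Rle_trans; [apply Rabs_triang|]. unfold M in *. lra.
Qed.

Lemma goursat (f : C -> C) (x y p q : R) :
  (forall s t, 0 <= s <= 1 -> 0 <= t <= 1 -> ex_cderive f (x + s * p, y + t * q)) ->
  rect_int f x y p q = 0.
Proof.
intros Hf.
assert (Hc : forall a b s, 0 <= a -> 0 <= b -> 0 < s -> a + s <= 1 -> b + s <= 1 ->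
  forall u v, 0 <= u <= 1 -> 0 <= v <= 1 ->
  ccont f (x + a * p + u * (s * p), y + b * q + v * (s * q))).
{ intros a b s Ha Hb Hs Has Hbs u v Hu Hv. apply ex_cderive_ccont.
  replace (x + a * p + u * (s * p)) with (x + (a + u * s) * p) by ring.
  replace (y + b * q + v * (s * q)) with (y + (b + v * s) * q) by ring.
  apply Hf; nra. }
set (J := fun a b s => rect_int f (x + a * p) (y + b * q) (s * p) (s * q)).
assert (Hsplit : forall a b s, 0 <= a -> 0 <= b -> 0 < s -> a + s <= 1 -> b + s <= 1 ->
  Rabs (J a b s) <= Rabs (J a b (s / 2)) + Rabs (J (a + s / 2) b (s / 2)) +
    Rabs (J a (b + s / 2) (s / 2)) + Rabs (J (a + s / 2) (b + s / 2) (s / 2))).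
{ intros a b s Ha Hb Hs Has Hbs. unfold J. rewrite rect_int_split by (apply Hc; assumption).
  replace (s * p / 2) with (s / 2 * p) by field. replace (s * q / 2) with (s / 2 * q) by field.
  replace (x + a * p + s / 2 * p) with (x + (a + s / 2) * p) by ring.
  replace (y + b * q + s / 2 * q) with (y + (b + s / 2) * q) by ring.
  eapply Rle_trans; [apply Rabs_triang|]. apply Rplus_le_compat_r.
  eapply Rle_trans; [apply Rabs_triang|]. apply Rplus_le_compat_r. apply Rabs_triang. }
(* A bad square carries at least its share by area of the whole integral. By the splitting, one of
   the quarters inherits this. *)
destruct (bisection (fun a b s => Rabs (J 0 0 1) * (s * s) <= Rabs (J a b s))) as [A [B H]].
{ intros a b s Ha Hb Hs Has Hbs H. assert (K := Hsplit a b s Ha Hb Hs Has Hbs).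
  destruct (Rle_dec (Rabs (J 0 0 1) * (s / 2 * (s / 2))) (Rabs (J a b (s / 2)))); [tauto|].
  destruct (Rle_dec (Rabs (J 0 0 1) * (s / 2 * (s / 2))) (Rabs (J (a + s / 2) b (s / 2)))); [tauto|].
  destruct (Rle_dec (Rabs (J 0 0 1) * (s / 2 * (s / 2))) (Rabs (J a (b + s / 2) (s / 2)))); [tauto|].
  right; right; right. lra. }
{ lra. }
assert (J0 : J 0 0 1 = rect_int f x y p q).
{ unfold J. f_equal; ring. }
set (M := Rabs p + Rabs q).
assert (HM : 0 <= M) by (unfold M; generalize (Rabs_pos p) (Rabs_pos q); lra).
assert (HA : 0 <= A <= 1) by (destruct (H 0%nat) as [a [b G]]; simpl in G; lra).
assert (HB : 0 <= B <= 1) by (destruct (H 0%nat) as [a [b G]]; simpl in G; lra).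
destruct (Hf A B HA HB) as [l Hl0]. assert (Hl := proj1 (is_cderive_eps _ _ _) Hl0). clear Hl0.
(* The local bound is also of order s^2, so s^2 cancels and an arbitrary e remains. *)
assert (K : forall e, 0 < e -> Rabs (J 0 0 1) <= 2 * e * M * M).
{ intros e He. destruct (Hl e He) as [d [Hd Hw]].
  destruct (pow_lt_1_zero (/ 2)) with (y := d / (M + 1)) as [n Hn].
  { rewrite Rabs_pos_eq; lra. } { apply Rdiv_lt_0_compat; lra. }
  specialize (Hn n (le_n n)). destruct (H n) as [a [b [Ha [Hb [Has [Hbs [HAa [HBb HJ]]]]]]]].
  assert (Hp : 0 < (/ 2) ^ n) by (apply pow_lt; lra).
  rewrite Rabs_pos_eq in Hn by lra.
  set (s := (/ 2) ^ n) in *.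
  assert (Es : Rabs (s * p) + Rabs (s * q) = s * M).
  { rewrite !Rabs_mult, (Rabs_pos_eq s) by lra. unfold M; ring. }
  assert (Hsm : s * M < d).
  { apply Rmult_lt_compat_r with (r := M + 1) in Hn; [|lra].
    unfold Rdiv in Hn. rewrite Rmult_assoc, Rinv_l in Hn by lra. nra. }
  assert (L : Rabs (J a b s) <= 2 * e * (s * M) * (s * M)).
  { rewrite <- Es. unfold J.
    (* The two parameters locate the limit point of the bisection in coordinates of the small
       rectangle. *)
    apply (rect_int_local f l (x + A * p, y + B * q) e d) with ((A - a) / s) ((B - b) / s).
    - apply Hc; assumption.
    - split; [apply Rdiv_le_0_compat; lra|].
      apply Rmult_le_reg_r with s; [lra|]. unfold Rdiv; rewrite Rmult_assoc, Rinv_l; lra.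
    - split; [apply Rdiv_le_0_compat; lra|].
      apply Rmult_le_reg_r with s; [lra|]. unfold Rdiv; rewrite Rmult_assoc, Rinv_l; lra.
    - f_equal; field; lra.
    - lra.
    - exact Hw.
    - rewrite Es; exact Hsm. }
  assert (0 < s * s) by nra.
  apply Rmult_le_reg_r with (s * s); [assumption|]. lra. }
assert (Z : Rabs (J 0 0 1) <= 0).
{ apply le_epsilon. intros e He. rewrite Rplus_0_l.
  eapply Rle_trans; [apply (K (e / (2 * (M * M) + 1)))|].
  - apply Rdiv_lt_0_compat; nra.
  - apply Rmult_le_reg_r with (2 * (M * M) + 1); [nra|].
    replace (2 * (e / (2 * (M * M) + 1)) * M * M * (2 * (M * M) + 1)) with (e * (2 * (M * M)))
      by (field; nra). nra. }
rewrite <- J0. generalize (Rabs_pos (J 0 0 1)); intros.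
destruct (Req_dec (J 0 0 1) 0) as [E|E]; [exact E|]. apply Rabs_pos_lt in E. lra.
Qed.

(** Real part of the integral of f dz from 0 to z, first horizontally and then vertically. *)
Definition re_primitive (f : C -> C) (z : C) : R := hint f 0 0 (Re z) - vint f (Re z) 0 (Im z).

Lemma re_primitive_diff (f : C -> C) (z : C) :
  (forall z, Cmod z < 1 -> ex_cderive f z) -> Cmod z < 1 ->
  forall e, 0 < e -> exists d, 0 < d /\ forall w, Cmod (w - z) < d ->
  Rabs (re_primitive f w - re_primitive f z - Re (f z * (w - z))) <= e * Cmod (w - z).
Proof.
intros Hf Hz e He.
destruct (ex_cderive_ccont f z (Hf z Hz) (e / 2)) as [d [Hd H]]; [lra|].
exists (Rmin d (1 - Cmod z)); split; [apply Rmin_glb_lt; lra|].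
intros w Hw.
assert (Hw1 : Cmod (w - z) < d) by (eapply Rlt_le_trans; [apply Hw|apply Rmin_l]).
assert (Hw2 : Cmod (w - z) < 1 - Cmod z) by (eapply Rlt_le_trans; [apply Hw|apply Rmin_r]).
assert (Hb : forall v, Cmod (v - z) <= Cmod (w - z) -> Cmod v < 1).
{ intros v Hv. replace v with ((v - z) + z)%C by ring.
  eapply Rle_lt_trans; [apply Cmod_triangle|]. lra. }
destruct z as [x y]; destruct w as [x' y'].
assert (Hseg : forall a b, 
  Rabs (a - x) <= Rabs (x' - x) -> Rabs (b - y) <= Rabs (y' - y) ->
  Cmod ((a, b) - (x, y)) <= Cmod ((x', y') - (x, y))).
{ intros a b Ha Hb'. apply Cmod_pair_le; simpl; assumption. }
assert (Hin : forall s a b, 0 <= s <= 1 -> Cmod (a, b) < 1 -> ccont f (0 + s * a, b)).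
{ intros s a b Hs Hab. apply ex_cderive_ccont, Hf. eapply Rle_lt_trans; [|apply Hab].
  apply Cmod_pair_le; [|lra]. rewrite Rplus_0_l, Rabs_mult, (Rabs_pos_eq s) by lra.
  generalize (Rabs_pos a); nra. }
assert (Hin' : forall s a b, 0 <= s <= 1 -> Cmod (a, b) < 1 -> ccont f (a, 0 + s * b)).
{ intros s a b Hs Hab. apply ex_cderive_ccont, Hf. eapply Rle_lt_trans; [|apply Hab].
  apply Cmod_pair_le; [lra|]. rewrite Rplus_0_l, Rabs_mult, (Rabs_pos_eq s) by lra.
  generalize (Rabs_pos b); nra. }
(* By Goursat the path may also run vertically first. With this form the horizontal leg of the
   increment is a single integral at height y, and with the original form so is the vertical leg. *)
assert (Alt : forall a b, Cmod (a, b) < 1 -> 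
  re_primitive f (a, b) = hint f 0 b a - vint f 0 0 b).
{ intros a b Hab. assert (G := goursat f 0 0 a b). unfold rect_int in G.
  unfold re_primitive; simpl. rewrite !Rplus_0_l in G.
  enough (hint f 0 0 a - hint f 0 b a + vint f 0 0 b - vint f a 0 b = 0) by lra.
  apply G. intros s t Hs Ht. apply Hf. eapply Rle_lt_trans; [|apply Hab].
  apply Cmod_pair_le; rewrite Rplus_0_l, Rabs_mult, Rabs_pos_eq by lra.
  - generalize (Rabs_pos a); nra.
  - generalize (Rabs_pos b); nra. }
assert (Hm : Cmod (x', y) < 1).
{ apply Hb, Hseg; [lra|]. rewrite Rminus_diag, Rabs_R0. apply Rabs_pos. }
assert (Hw' : Cmod (x', y') < 1) by (apply Hb; lra).
assert (P1 : Rabs (re_primitive f (x', y) - re_primitive f (x, y) - Re (f (x, y)) * (x' - x))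
   <= e / 2 * Rabs (x' - x)).
{ rewrite !Alt by assumption.
  assert (S0 : RInt (fun t => Re (f (t, y))) 0 x + RInt (fun t => Re (f (t, y))) x x' =
    RInt (fun t => Re (f (t, y))) 0 x').
  { apply RInt_split.
    - replace x with (0 + x) at 1 by ring. apply ex_RInt_horizontal.
      intros s Hs. apply Hin; assumption.
    - replace x' with (x + (x' - x)) by ring. apply ex_RInt_horizontal.
      intros s Hs. apply ex_cderive_ccont, Hf, Hb, Hseg.
      + replace (x + s * (x' - x) - x) with (s * (x' - x)) by ring.
        rewrite Rabs_mult, Rabs_pos_eq by lra. generalize (Rabs_pos (x' - x)); nra.
      + rewrite Rminus_diag, Rabs_R0. apply Rabs_pos. }
  assert (S1 : hint f 0 y x' - vint f 0 0 y - (hint f 0 y x - vint f 0 0 y) =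
    RInt (fun t => Re (f (t, y))) x x' :> R).
  { unfold hint. rewrite !Rplus_0_l, <- S0. ring. }
  rewrite S1. clear S0 S1.
  assert (Hst : forall s, 0 <= s <= 1 -> 
     Cmod ((x + s * (x' - x), y) - (x, y)) <= Cmod ((x', y') - (x, y))).
  { intros s Hs. apply Hseg.
    + replace (x + s * (x' - x) - x) with (s * (x' - x)) by ring.
          rewrite Rabs_mult, Rabs_pos_eq by lra. generalize (Rabs_pos (x' - x)); nra.
    + rewrite Rminus_diag, Rabs_R0. apply Rabs_pos. }
  replace x' with (x + (x' - x)) at 1 by ring.
  apply RInt_near_const_param.
  - apply ex_RInt_horizontal. intros s Hs. apply ex_cderive_ccont, Hf, Hb, Hst, Hs.
  - intros s Hs.
    left. eapply Rle_lt_trans; [apply (re_le_Cmod (f (x + s * (x' - x), y) - f (x, y)))|].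
    apply H. eapply Rle_lt_trans; [apply Hst, Hs|exact Hw1]. }
assert (P2 : Rabs (re_primitive f (x', y') - re_primitive f (x', y) - - Im (f (x, y)) * (y' - y))
   <= e / 2 * Rabs (y' - y)).
{ unfold re_primitive; simpl.
  assert (Hst : forall s, 0 <= s <= 1 -> 
     Cmod ((x', y + s * (y' - y)) - (x, y)) <= Cmod ((x', y') - (x, y))).
  { intros s Hs. apply Hseg; [lra|].
    replace (y + s * (y' - y) - y) with (s * (y' - y)) by ring.
    rewrite Rabs_mult, Rabs_pos_eq by lra. generalize (Rabs_pos (y' - y)); nra. }
  assert (Ex : ex_RInt (fun t => Im (f (x', t))) y (y + (y' - y))).
  { apply ex_RInt_vertical. intros s Hs. apply ex_cderive_ccont, Hf, Hb, Hst, Hs. }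
  assert (S0 : RInt (fun t => Im (f (x', t))) 0 y + RInt (fun t => Im (f (x', t))) y y' =
    RInt (fun t => Im (f (x', t))) 0 y').
  { apply RInt_split.
    - replace y with (0 + y) at 1 by ring. apply ex_RInt_vertical.
      intros s Hs. apply Hin'; assumption.
    - replace y' with (y + (y' - y)) by ring. exact Ex. }
  assert (S1 : hint f 0 0 x' - vint f x' 0 y' - (hint f 0 0 x' - vint f x' 0 y) =
    - RInt (fun t => Im (f (x', t))) y (y + (y' - y)) :> R).
  { unfold vint. rewrite !Rplus_0_l, <- S0.
    replace (y + (y' - y)) with y' by ring. ring. }
  rewrite S1. clear S0 S1.
  match goal with |- Rabs ?A <= _ => replace A with 
    (- (RInt (fun t => Im (f (x', t))) y (y + (y' - y)) - Im (f (x, y)) * (y' - y))) by ring end.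
  rewrite Rabs_Ropp.
  apply RInt_near_const_param; [exact Ex|].
  intros s Hs.
  left. eapply Rle_lt_trans; [apply (Im_le_Cmod (f (x', y + s * (y' - y)) - f (x, y)))|].
  apply H. eapply Rle_lt_trans; [apply Hst, Hs|exact Hw1]. }
replace (re_primitive f (x', y') - re_primitive f (x, y) - Re (f (x, y) * ((x', y') - (x, y)))) with
  ((re_primitive f (x', y) - re_primitive f (x, y) - Re (f (x, y)) * (x' - x)) +
   (re_primitive f (x', y') - re_primitive f (x', y) - - Im (f (x, y)) * (y' - y)))
  by (unfold Re, Im; simpl; ring).
eapply Rle_trans; [apply Rabs_triang|].
assert (Q1 := re_le_Cmod ((x', y') - (x, y))). assert (Q2 := Im_le_Cmod ((x', y') - (x, y))).
simpl in Q1, Q2. unfold Rminus in P1, P2 |- *. nra.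
Qed.

Lemma ex_primitive (f : C -> C) :
  (forall z, Cmod z < 1 -> ex_cderive f z) ->
  exists F : C -> C, forall z, Cmod z < 1 -> is_cderive F z (f z).
Proof.
intros Hf.
(* The imaginary part of the primitive of f is the real part of the primitive of - i f. *)
assert (Hg : forall z, Cmod z < 1 -> ex_cderive (fun z => - Ci * f z)%C z).
{ intros z Hz. destruct (Hf z Hz) as [l Hl]. exists (- Ci * l)%C.
  apply is_cderive_scal, Hl. }
exists (fun z => (re_primitive f z, re_primitive (fun z => - Ci * f z)%C z)).
intros z Hz. apply is_cderive_eps. intros e He.
destruct (re_primitive_diff f z Hf Hz (e / 2)) as [d1 [Hd1 H1]]; [lra|].
destruct (re_primitive_diff _ z Hg Hz (e / 2)) as [d2 [Hd2 H2]]; [lra|].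
exists (Rmin d1 d2); split; [apply Rmin_glb_lt; assumption|].
intros w Hw.
assert (W1 := H1 w ltac:(eapply Rlt_le_trans; [apply Hw|apply Rmin_l])).
assert (W2 := H2 w ltac:(eapply Rlt_le_trans; [apply Hw|apply Rmin_r])).
eapply Rle_trans; [apply Cmod_le_abs|].
replace (e * Cmod (w - z)) with (e / 2 * Cmod (w - z) + e / 2 * Cmod (w - z)) by field.
apply Rplus_le_compat.
- eapply Rle_trans; [|apply W1]. apply Req_le; f_equal.
- eapply Rle_trans; [|apply W2]. apply Req_le; f_equal.
  unfold Re, Im; simpl. ring.
Qed.

(** * Mean value property and Cauchy's estimate *)

(** Differentiation under the integral sign asks for continuity jointly in radius and angle. *)
Lemma ccont_comp_2d (f : C -> C) (g : R -> R -> C) (x y : R) :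
  continuity_2d_pt (fun s t => Re (g s t)) x y -> continuity_2d_pt (fun s t => Im (g s t)) x y ->
  ccont f (g x y) ->
  continuity_2d_pt (fun s t => Re (f (g s t))) x y /\
  continuity_2d_pt (fun s t => Im (f (g s t))) x y.
Proof.
intros H1 H2 Hf; split; intros e; destruct (Hf e (cond_pos e)) as [d [Hd H]];
  destruct (H1 (mkposreal (d / 2) ltac:(lra))) as [d1 K1];
  destruct (H2 (mkposreal (d / 2) ltac:(lra))) as [d2 K2]; simpl in K1, K2;
  exists (mkposreal _ (Rmin_stable_in_posreal d1 d2)); simpl; intros u v Hu Hv.
- eapply Rle_lt_trans; [apply (re_le_Cmod (f (g u v) - f (g x y)))|].
  apply H. eapply Rle_lt_trans; [apply Cmod_le_abs|].
  assert (G1 := K1 u v (Rlt_le_trans _ _ _ Hu (Rmin_l _ _)) (Rlt_le_trans _ _ _ Hv (Rmin_l _ _))).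
  assert (G2 := K2 u v (Rlt_le_trans _ _ _ Hu (Rmin_r _ _)) (Rlt_le_trans _ _ _ Hv (Rmin_r _ _))).
  unfold Re, Im, Rminus in *; simpl; lra.
- eapply Rle_lt_trans; [apply (Im_le_Cmod (f (g u v) - f (g x y)))|].
  apply H. eapply Rle_lt_trans; [apply Cmod_le_abs|].
  assert (G1 := K1 u v (Rlt_le_trans _ _ _ Hu (Rmin_l _ _)) (Rlt_le_trans _ _ _ Hv (Rmin_l _ _))).
  assert (G2 := K2 u v (Rlt_le_trans _ _ _ Hu (Rmin_r _ _)) (Rlt_le_trans _ _ _ Hv (Rmin_r _ _))).
  unfold Re, Im, Rminus in *; simpl; lra.
Qed.

Lemma continuity_2d_continuous (f : R -> R -> R) (x y : R) :
  continuity_2d_pt f x y -> continuous (f x) y.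
Proof.
intros H. apply continuity_pt_filterlim. intros e He.
destruct (H (mkposreal e He)) as [d Hd]. exists d; split; [apply cond_pos|].
intros t [_ Ht]. apply Hd; [rewrite Rminus_diag, Rabs_R0; apply cond_pos|exact Ht].
Qed.

Definition is_vderive (c : R -> C) (t : R) (v : C) : Prop :=
  is_derive (fun s => Re (c s)) t (Re v) /\ is_derive (fun s => Im (c s)) t (Im v).

Lemma is_derive_eps (f : R -> R) (x l : R) :
  is_derive f x l <->
  forall e, 0 < e -> exists d, 0 < d /\ forall y, Rabs (y - x) < d ->
    Rabs (f y - f x - l * (y - x)) <= e * Rabs (y - x).
Proof.
split.
- intros [_ H] e He.
  destruct (H x (fun P HP => HP) (mkposreal e He)) as [d Hd].
  exists d; split; [apply cond_pos|].
  intros y Hy. specialize (Hd y Hy).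
  replace (f y - f x - l * (y - x)) with (f y - f x - (y - x) * l) by ring.
  exact Hd.
- intros H; split; [apply is_linear_scal_l|].
  intros x' Hx e.
  assert (x' = x) as ->.
  { symmetry. apply (is_filter_lim_locally_unique (V := R_NormedModule)). exact Hx. }
  destruct (H e (cond_pos e)) as [d [Hd H']].
  exists (mkposreal d Hd). intros y Hy. specialize (H' y Hy).
  replace (f y - f x - l * (y - x)) with (f y - f x - (y - x) * l) in H' by ring.
  exact H'.
Qed.

Lemma is_vderive_eps (c : R -> C) (t : R) (v : C) :
  is_vderive c t v <->
  forall e, 0 < e -> exists d, 0 < d /\ forall s, Rabs (s - t) < d ->
    Cmod (c s - c t - v * RtoC (s - t)) <= e * Rabs (s - t).
Proof.
assert (E1 : forall s, Re (c s - c t - v * RtoC (s - t)) = Re (c s) - Re (c t) - Re v * (s - t)).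
{ intros s. unfold Re, Im; simpl; ring. }
assert (E2 : forall s, Im (c s - c t - v * RtoC (s - t)) = Im (c s) - Im (c t) - Im v * (s - t)).
{ intros s. unfold Re, Im; simpl; ring. }
split.
- intros [H1 H2] e He.
  destruct (proj1 (is_derive_eps _ _ _) H1 (e / 2)) as [d1 [Hd1 K1]]; [lra|].
  destruct (proj1 (is_derive_eps _ _ _) H2 (e / 2)) as [d2 [Hd2 K2]]; [lra|].
  exists (Rmin d1 d2); split; [apply Rmin_glb_lt; assumption|].
  intros s Hs. eapply Rle_trans; [apply Cmod_le_abs|]. rewrite E1, E2.
  assert (G1 := K1 s (Rlt_le_trans _ _ _ Hs (Rmin_l _ _))).
  assert (G2 := K2 s (Rlt_le_trans _ _ _ Hs (Rmin_r _ _))). lra.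
- intros H; split; apply is_derive_eps; intros e He; destruct (H e He) as [d [Hd K]];
    exists d; (split; [exact Hd|]); intros s Hs; (eapply Rle_trans; [|apply (K s Hs)]).
  + rewrite <- E1. apply re_le_Cmod.
  + rewrite <- E2. apply Im_le_Cmod.
Qed.

Lemma is_vderive_comp (P : C -> C) (c : R -> C) (t : R) (l v : C) :
  is_cderive P (c t) l -> is_vderive c t v -> is_vderive (fun s => P (c s)) t (l * v)%C.
Proof.
intros HP Hc. apply is_vderive_eps. intros e He.
assert (KP := proj1 (is_cderive_eps _ _ _) HP). assert (Kc := proj1 (is_vderive_eps _ _ _) Hc).
set (a := Cmod l). set (b := Cmod v).
assert (Ha : 0 <= a) by apply Cmod_ge_0. assert (Hb : 0 <= b) by apply Cmod_ge_0.
destruct (KP (e / (2 * (b + 1)))) as [d1 [Hd1 K1]]; [apply Rdiv_lt_0_compat; lra|].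
destruct (Kc 1) as [d2 [Hd2 K2]]; [lra|].
destruct (Kc (e / (2 * (a + 1)))) as [d3 [Hd3 K3]]; [apply Rdiv_lt_0_compat; lra|].
exists (Rmin (d1 / (b + 1)) (Rmin d2 d3)); split.
{ repeat apply Rmin_glb_lt; try assumption. apply Rdiv_lt_0_compat; lra. }
intros s Hs.
assert (S1 := Rlt_le_trans _ _ _ Hs (Rmin_l _ _)).
assert (S23 := Rlt_le_trans _ _ _ Hs (Rmin_r _ _)).
assert (S2 := Rlt_le_trans _ _ _ S23 (Rmin_l _ _)).
assert (S3 := Rlt_le_trans _ _ _ S23 (Rmin_r _ _)).
set (x := Rabs (s - t)) in *. assert (Hx : 0 <= x) by apply Rabs_pos.
assert (D : Cmod (c s - c t) <= (b + 1) * x).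
{ replace (c s - c t)%C with ((c s - c t - v * RtoC (s - t)) + v * RtoC (s - t))%C by ring.
  eapply Rle_trans; [apply Cmod_triangle|]. rewrite Cmod_mult, Cmod_R. fold x b.
  assert (G := K2 s S2). fold x in G. lra. }
replace (P (c s) - P (c t) - l * v * RtoC (s - t))%C with
  ((P (c s) - P (c t) - l * (c s - c t)) + l * (c s - c t - v * RtoC (s - t)))%C by ring.
eapply Rle_trans; [apply Cmod_triangle|]. rewrite (Cmod_mult l). fold a.
assert (D1 : (b + 1) * x < d1).
{ apply Rmult_lt_compat_l with (r := b + 1) in S1; [|lra].
  replace ((b + 1) * (d1 / (b + 1))) with d1 in S1 by (field; lra). exact S1. }
assert (G1 := K1 (c s) (Rle_lt_trans _ _ _ D D1)). assert (G3 := K3 s S3). fold x in G3.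
assert (T1 : Cmod (P (c s) - P (c t) - l * (c s - c t)) <= e / 2 * x).
{ eapply Rle_trans; [apply G1|].
  apply Rle_trans with (e / (2 * (b + 1)) * ((b + 1) * x)).
  - apply Rmult_le_compat_l; [|exact D]. left; apply Rdiv_lt_0_compat; lra.
  - right; field; lra. }
assert (T2 : a * Cmod (c s - c t - v * RtoC (s - t)) <= e / 2 * x).
{ apply Rle_trans with ((a + 1) * (e / (2 * (a + 1)) * x)).
  - apply Rmult_le_compat; try lra. apply Cmod_ge_0.
  - right; field; lra. }
lra.
Qed.

Lemma is_vderive_mult (c d : R -> C) (t : R) (v w : C) :
  is_vderive c t v -> is_vderive d t w ->
  is_vderive (fun s => c s * d s)%C t (v * d t + c t * w)%C.
Proof.
intros [H1 H2] [K1 K2]; split.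
- replace (Re (v * d t + c t * w)) with
    ((Re v * Re (d t) + Re (c t) * Re w) - (Im v * Im (d t) + Im (c t) * Im w))
    by (unfold Re, Im; simpl; ring).
  apply (is_derive_minus (V := R_NormedModule) (fun s => Re (c s) * Re (d s)) (fun s => Im (c s) * Im (d s)));
    apply (is_derive_mult (K := R_AbsRing)); try assumption; intros; apply Rmult_comm.
- replace (Im (v * d t + c t * w)) with
    ((Re v * Im (d t) + Re (c t) * Im w) + (Im v * Re (d t) + Im (c t) * Re w))
    by (unfold Re, Im; simpl; ring).
  apply (is_derive_plus (V := R_NormedModule) (fun s => Re (c s) * Im (d s)) (fun s => Im (c s) * Re (d s)));
    apply (is_derive_mult (K := R_AbsRing)); try assumption; intros; apply Rmult_comm.
Qed.

Lemma Cmod_circ (t : R) : Cmod (circ t) = 1.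
Proof.
unfold Cmod, circ; simpl fst; simpl snd. rewrite <- sqrt_1; f_equal.
generalize (sin2_cos2 (2 * PI * t)); unfold Rsqr; lra.
Qed.

Lemma circ_plus (s t : R) : circ (s + t) = (circ s * circ t)%C.
Proof.
unfold circ. replace (2 * PI * (s + t)) with (2 * PI * s + 2 * PI * t) by ring.
rewrite cos_plus, sin_plus. apply injective_projections; simpl; ring.
Qed.

Lemma circ_0 : circ 0 = RtoC 1.
Proof. unfold circ. rewrite Rmult_0_r, cos_0, sin_0. reflexivity. Qed.

Lemma circ_1 : circ 1 = RtoC 1.
Proof. unfold circ. rewrite Rmult_1_r, cos_2PI, sin_2PI. reflexivity. Qed.

Lemma circ_opp (t : R) : (circ t * circ (- t))%C = RtoC 1.
Proof. rewrite <- circ_plus. replace (t + - t) with 0 by ring. apply circ_0. Qed.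

Lemma is_vderive_circ (a t : R) :
  is_vderive (fun s => circ (a * s)) t (Ci * RtoC (2 * PI * a) * circ (a * t))%C.
Proof. split; unfold circ, Re, Im; simpl; auto_derive; auto; ring. Qed.

Lemma continuity_2d_circ (x y : R) :
  continuity_2d_pt (fun s t => Re (RtoC s * circ t)) x y /\
  continuity_2d_pt (fun s t => Im (RtoC s * circ t)) x y.
Proof.
assert (H : continuity_2d_pt (fun s t => 2 * PI * t) x y).
{ apply continuity_2d_pt_mult; [apply continuity_2d_pt_const|apply continuity_2d_pt_id2]. }
split; unfold Re, Im; simpl.
- apply continuity_2d_pt_ext with (fun s t => s * cos (2 * PI * t)); [intros; ring|].
  apply continuity_2d_pt_mult; [apply continuity_2d_pt_id1|].
  apply (continuity_1d_2d_pt_comp cos); [apply continuity_cos|exact H].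
- apply continuity_2d_pt_ext with (fun s t => s * sin (2 * PI * t)); [intros; ring|].
  apply continuity_2d_pt_mult; [apply continuity_2d_pt_id1|].
  apply (continuity_1d_2d_pt_comp sin); [apply continuity_sin|exact H].
Qed.

Lemma continuous_on_circle (f : C -> C) (s t : R) : ccont f (RtoC s * circ t) ->
  continuous (fun t => Re (f (RtoC s * circ t)%C)) t /\
  continuous (fun t => Im (f (RtoC s * circ t)%C)) t.
Proof.
intros H. destruct (continuity_2d_circ s t) as [H1 H2].
destruct (ccont_comp_2d f _ s t H1 H2 H) as [K1 K2].
split; [exact (continuity_2d_continuous _ _ _ K1)|exact (continuity_2d_continuous _ _ _ K2)].
Qed.

Lemma Cmod_scal_circ (s t : R) : 0 <= s -> Cmod (RtoC s * circ t) = s.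
Proof. intros Hs. rewrite Cmod_mult, Cmod_circ, Cmod_R, Rabs_pos_eq; lra. Qed.

Section MeanValue.

Variables P G : C -> C.
Hypothesis HP : forall z, Cmod z < 1 -> is_cderive P z (G z).
Hypothesis HG : forall z, Cmod z < 1 -> ccont G z.

(** [n] is the circular mean of Re G and [q] that of the real part of P(z) times conj(z) / |z|.
    Differentiating [E] in s gives q' = n, and integrating its t-derivative over a period gives q =
    s n. Hence q / s is constant, that is, [n] is; letting s tend to 0 identifies the constant as Re
    (G 0). Only P is differentiated. *)
Let n (s : R) : R := RInt (fun t => Re (G (RtoC s * circ t))) 0 1.
Let E (s t : R) : C := (P (RtoC s * circ t) * circ (-1 * t))%C.
Let q (s : R) : R := RInt (fun t => Re (E s t)) 0 1.

Lemma E_derive_s (s t : R) : 0 < s < 1 -> is_derive (fun s => Re (E s t)) s (Re (G (RtoC s * circ t))).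
Proof.
intros Hs.
assert (V : is_vderive (fun s => RtoC s * circ t)%C s (circ t)).
{ split; unfold circ, Re, Im; simpl; auto_derive; auto; ring. }
assert (V2 : is_vderive (fun _ => circ (-1 * t)) s (RtoC 0)).
{ split; unfold circ, Re, Im; simpl; auto_derive; auto; ring. }
assert (HD : Cmod (RtoC s * circ t) < 1) by (rewrite Cmod_scal_circ; lra).
assert (W := is_vderive_mult _ _ _ _ _ (is_vderive_comp P _ _ _ _ (HP _ HD) V) V2).
destruct W as [W _].
replace (G (RtoC s * circ t) * circ t * circ (-1 * t) + P (RtoC s * circ t) * RtoC 0)%C
  with (G (RtoC s * circ t) * (circ t * circ (- t)))%C in W
  by (replace (-1 * t) with (- t) by ring; ring).
rewrite circ_opp, Cmult_1_r in W. exact W.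
Qed.

(** The angular derivative brings out a factor 2 pi i, which is why [Im] on the left produces [Re]
    on the right. *)
Lemma E_derive_t (s t : R) : 0 < s < 1 ->
  is_derive (fun t => Im (E s t)) t (2 * PI * (s * Re (G (RtoC s * circ t)) - Re (E s t))).
Proof.
intros Hs.
assert (V : is_vderive (fun t => RtoC s * circ t)%C t (RtoC s * (Ci * RtoC (2 * PI * 1) * circ (1 * t)))).
{ split; unfold circ, Re, Im; simpl; auto_derive; auto; rewrite ?Rmult_1_l; ring. }
assert (V2 := is_vderive_circ (-1) t).
assert (HD : Cmod (RtoC s * circ t) < 1) by (rewrite Cmod_scal_circ; lra).
destruct (is_vderive_mult _ _ _ _ _ (is_vderive_comp P _ _ _ _ (HP _ HD) V) V2) as [_ W].
match type of W with is_derive _ _ (Im ?X) => replace X with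
  (Ci * RtoC (2 * PI) * (RtoC s * G (RtoC s * circ t) * (circ t * circ (- t)) - E s t))%C in W end.
- rewrite circ_opp in W. 
  match type of W with is_derive _ _ ?X => replace X with
    (2 * PI * (s * Re (G (RtoC s * circ t)) - Re (E s t))) in W end; [exact W|].
  unfold Re, Im; simpl. ring.
- unfold E. rewrite Rmult_1_l, Rmult_1_r. replace (-1 * t) with (- t) by ring.
  replace (2 * PI * -1) with (- (2 * PI)) by ring. rewrite RtoC_opp. ring.
Qed.

Lemma G_circle_continuous (s t : R) : 0 < s < 1 -> continuous (fun t => Re (G (RtoC s * circ t)%C)) t.
Proof.
intros Hs. refine (proj1 (continuous_on_circle G s t _)). apply HG. rewrite Cmod_scal_circ; lra.
Qed.

Lemma E_circle_continuous (s t : R) : 0 < s < 1 -> continuous (fun t => Re (E s t)) t.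
Proof.
intros Hs.
assert (HD : Cmod (RtoC s * circ t) < 1) by (rewrite Cmod_scal_circ; lra).
assert (V : is_vderive (fun t => RtoC s * circ t)%C t (RtoC s * (Ci * RtoC (2 * PI * 1) * circ (1 * t)))).
{ split; unfold circ, Re, Im; simpl; auto_derive; auto; rewrite ?Rmult_1_l; ring. }
destruct (is_vderive_mult _ _ _ _ _ (is_vderive_comp P _ _ _ _ (HP _ HD) V) (is_vderive_circ (-1) t)) as [W _].
apply (ex_derive_continuous (V := R_NormedModule)). eexists; exact W.
Qed.

Lemma ex_RInt_G (s : R) : 0 < s < 1 -> ex_RInt (fun t => Re (G (RtoC s * circ t))) 0 1.
Proof.
intros Hs; apply (ex_RInt_continuous (V := R_CompleteNormedModule)); intros t _.
apply G_circle_continuous, Hs.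
Qed.

Lemma ex_RInt_E (s : R) : 0 < s < 1 -> ex_RInt (fun t => Re (E s t)) 0 1.
Proof.
intros Hs; apply (ex_RInt_continuous (V := R_CompleteNormedModule)); intros t _.
apply E_circle_continuous, Hs.
Qed.

(** [Im (E s t)] has period 1 in t, so its derivative has integral 0 over [0, 1]. *)
Lemma q_eq (s : R) : 0 < s < 1 -> q s = s * n s.
Proof.
intros Hs.
assert (I : is_RInt (fun t => 2 * PI * (s * Re (G (RtoC s * circ t)) - Re (E s t))) 0 1
  (minus (Im (E s 1)) (Im (E s 0)))).
{ apply (is_RInt_derive (V := R_CompleteNormedModule) (fun t => Im (E s t))); intros t _.
  - apply E_derive_t, Hs.
  - apply (continuous_mult (K := R_AbsRing)); [apply continuous_const|].
    apply (continuous_minus (V := R_NormedModule)); [|apply E_circle_continuous, Hs].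
    apply (continuous_mult (K := R_AbsRing)); [apply continuous_const|].
    apply G_circle_continuous, Hs. }
replace (minus (Im (E s 1)) (Im (E s 0))) with 0 in I.
2:{ unfold E. rewrite circ_0, circ_1, Rmult_0_r, circ_0.
    replace (circ (-1 * 1)) with (RtoC 1).
    - unfold minus, plus, opp; simpl; ring.
    - rewrite <- (circ_opp 1), circ_1, Cmult_1_l. f_equal; ring. }
assert (I2 : is_RInt (fun t => 2 * PI * (s * Re (G (RtoC s * circ t)) - Re (E s t))) 0 1
  (2 * PI * (s * n s - q s))).
{ apply (is_RInt_scal (V := R_NormedModule)). apply (is_RInt_minus (V := R_NormedModule)).
  - apply (is_RInt_scal (V := R_NormedModule)). apply (RInt_correct (V := R_CompleteNormedModule)).
    apply ex_RInt_G, Hs.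
  - apply (RInt_correct (V := R_CompleteNormedModule)). apply ex_RInt_E, Hs. }
assert (Q := is_RInt_unique _ _ _ _ I). rewrite (is_RInt_unique _ _ _ _ I2) in Q.
generalize PI_RGT_0; intros. 
apply Rmult_integral in Q. destruct Q; lra.
Qed.

Lemma q_derive (s : R) : 0 < s < 1 -> is_derive q s (n s).
Proof.
intros Hs. unfold q, n.
assert (N : forall x, 0 < x < 1 -> locally x (fun y => 0 < y < 1)).
{ intros x Hx. apply (open_and (fun y => 0 < y) (fun y => y < 1)); [apply open_gt|apply open_lt|exact Hx]. }
rewrite (RInt_ext _ (fun t => Derive (fun u => Re (E u t)) s)).
2:{ intros t _. symmetry. apply is_derive_unique, E_derive_s, Hs. }
apply (is_derive_RInt_param (fun s t => Re (E s t))).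
- apply filter_imp with (2 := N s Hs). intros x Hx t _. eexists; apply E_derive_s, Hx.
- intros t _. apply continuity_2d_pt_ext_loc with (fun u v => Re (G (RtoC u * circ v)%C)).
  + destruct (N s Hs) as [d Hd]. exists d. intros u v Hu _. symmetry.
    apply is_derive_unique, E_derive_s, Hd, Hu.
  + destruct (continuity_2d_circ s t) as [H1 H2].
    apply (ccont_comp_2d G _ s t H1 H2). apply HG. rewrite Cmod_scal_circ; lra.
- apply filter_imp with (2 := N s Hs). intros x Hx. apply ex_RInt_E, Hx.
Qed.

Lemma n_const (s1 s2 : R) : 0 < s1 -> s1 < s2 -> s2 < 1 -> n s1 = n s2.
Proof.
intros H1 H12 H2.
assert (F : q s1 / s1 = q s2 / s2).
{ apply (eq_is_derive (V := R_NormedModule) (fun s => q s / s)); [|exact H12]. intros s Hs.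
  evar_last; [apply (is_derive_div q (fun s => s) s (n s) 1)|].
  - apply q_derive; lra.
  - apply (is_derive_id (K := R_AbsRing)).
  - lra.
  - rewrite q_eq by lra. unfold zero; simpl. field. lra. }
rewrite !q_eq in F by lra. 
replace (s1 * n s1 / s1) with (n s1) in F by (field; lra).
replace (s2 * n s2 / s2) with (n s2) in F by (field; lra). exact F.
Qed.

Lemma mean_value_n (s : R) : 0 < s < 1 -> n s = Re (G 0%C).
Proof.
intros Hs. apply Rminus_diag_uniq.
destruct (Req_dec (n s - Re (G 0%C)) 0) as [Z|Z]; [exact Z|exfalso].
apply Rabs_pos_lt in Z. set (e := Rabs (n s - Re (G 0%C))) in *.
destruct (HG 0%C ltac:(rewrite Cmod_0; lra) (e / 2)) as [d [Hd H]]; [lra|].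
set (r := Rmin d s / 2).
assert (Hr : 0 < r < s /\ r < d).
{ unfold r. generalize (Rmin_l d s) (Rmin_r d s) (Rmin_glb_lt d s 0 Hd (proj1 Hs)). lra. }
assert (K : Rabs (n r - Re (G 0%C) * 1) <= e / 2 * Rabs 1).
{ unfold n. replace 1 with (0 + 1) at 1 by ring. apply RInt_near_const_param.
  - rewrite Rplus_0_l. apply ex_RInt_G. lra.
  - intros t _. left. eapply Rle_lt_trans; [apply (re_le_Cmod (G (RtoC r * circ (0 + t * 1)) - G 0%C))|].
    apply H. replace (RtoC r * circ (0 + t * 1) - 0)%C with (RtoC r * circ (0 + t * 1))%C by ring.
    rewrite Cmod_scal_circ; lra. }
rewrite (n_const r s), Rabs_R1 in K by lra. rewrite !Rmult_1_r in K. unfold e in *. lra.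
Qed.

Lemma mean_value_aux (s : R) : 0 < s < 1 ->
  RInt (fun t => Re (G (RtoC s * circ t))) 0 1 = Re (G 0%C) /\
  RInt (fun t => Re (P (RtoC s * circ t) * circ (- t))) 0 1 = s * Re (G 0%C).
Proof.
intros Hs. split; [apply mean_value_n, Hs|].
rewrite <- (mean_value_n s Hs), <- q_eq by exact Hs. unfold q.
apply (RInt_ext (V := R_CompleteNormedModule)). intros t _. unfold E.
now replace (-1 * t) with (- t) by ring.
Qed.

End MeanValue.

Lemma is_cderive_rescale (P : C -> C) (a z l : C) (r : R) :
  is_cderive P (a + RtoC r * z)%C l ->
  is_cderive (fun z => P (a + RtoC r * z)%C) z (RtoC r * l)%C.
Proof.
intros H. apply (is_cderive_comp P (fun z => a + RtoC r * z)%C); [exact H|].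
assert (K : is_cderive (fun z => a + RtoC r * z)%C z (RtoC 0 + RtoC r * RtoC 1)%C)
  by (apply is_cderive_plus; [apply is_cderive_const|apply is_cderive_scal, is_cderive_id]).
replace (RtoC 0 + RtoC r * RtoC 1)%C with (RtoC r) in K by ring. exact K.
Qed.

Lemma ball_rescale (a z : C) (r : R) : 0 < r -> Cmod z < 1 -> Cmod (a + RtoC r * z - a) < r.
Proof.
intros Hr Hz. replace (a + RtoC r * z - a)%C with (RtoC r * z)%C by ring.
rewrite Cmod_mult, Cmod_R, Rabs_pos_eq by lra. nra.
Qed.

Lemma RInt_le_const (f : R -> R) (M : R) :
  (forall t, continuous f t) -> (forall t, f t <= M) -> RInt f 0 1 <= M.
Proof.
intros Hf H. replace M with (RInt (fun _ => M) 0 1).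
- apply RInt_le; [lra| |apply ex_RInt_const|auto].
  apply (ex_RInt_continuous (V := R_CompleteNormedModule)); auto.
- rewrite RInt_const. unfold scal; simpl; unfold mult; simpl; ring.
Qed.

(** Otherwise the mean of Re G over the circle of radius r / 2 about a would lie below Re (G a) by
    at least e (r / 2)^2. *)
Lemma no_strict_local_max (G : C -> C) (a : C) (r e : R) : 0 < r -> 0 < e ->
  (forall z, Cmod (z - a) < r -> ex_cderive G z) ->
  ~ (forall z, Cmod (z - a) < r -> Re (G z) + e * Cmod (z - a) ^ 2 <= Re (G a)).
Proof.
intros Hr He HG H. set (g := fun z => G (a + RtoC r * z)%C).
assert (Hg : forall z, Cmod z < 1 -> ex_cderive g z).
{ intros z Hz. destruct (HG _ (ball_rescale a z r Hr Hz)) as [l Hl].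
  eexists; apply is_cderive_rescale, Hl. }
destruct (ex_primitive g Hg) as [F HF].
destruct (mean_value_aux F g HF (fun z Hz => ex_cderive_ccont g z (Hg z Hz)) (1 / 2)) as [M _]; [lra|].
assert (E0 : g 0%C = G a) by (unfold g; f_equal; ring). rewrite E0 in M.
assert (HC : forall t, Cmod (RtoC (1 / 2) * circ t) < 1) by (intros; rewrite Cmod_scal_circ; lra).
assert (L : RInt (fun t => Re (g (RtoC (1 / 2) * circ t)%C)) 0 1 <= Re (G a) - e * (r / 2) ^ 2).
{ apply RInt_le_const.
  - intros t. exact (proj1 (continuous_on_circle g (1 / 2) t (ex_cderive_ccont g _ (Hg _ (HC t))))).
  - intros t. assert (Q := H _ (ball_rescale a _ r Hr (HC t))). unfold g.
    replace (a + RtoC r * (RtoC (1 / 2) * circ t) - a)%C with (RtoC r * (RtoC (1 / 2) * circ t))%C in Q by ring.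
    rewrite Cmod_mult, Cmod_scal_circ, Cmod_R, Rabs_pos_eq in Q by lra. 
    replace (r * (1 / 2)) with (r / 2) in Q by field. lra. }
rewrite M in L. assert (0 < (r / 2) ^ 2) by (apply pow_lt; lra). nra.
Qed.

(** Turns a statement about a modulus into one about a real part, to which mean values apply. *)
Lemma unimodular_rotation (z : C) : exists c : C, Cmod c = 1 /\ (c * z)%C = RtoC (Cmod z).
Proof.
destruct (Ceq_dec z 0) as [->|Hz].
- exists (RtoC 1). rewrite Cmod_1, Cmod_0. split; [reflexivity|ring].
- assert (Hm := proj1 (Cmod_gt_0 z) Hz).
  assert (RtoC (Cmod z) <> 0%C) by (intros E; apply RtoC_inj in E; lra).
  exists (Cconj z / RtoC (Cmod z))%C. split.
  + rewrite Cmod_div, Cmod_conj, Cmod_R, Rabs_pos_eq by (assumption || lra). field; lra.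
  + replace (Cconj z / RtoC (Cmod z) * z)%C with (z * Cconj z / RtoC (Cmod z))%C by (field; assumption).
    rewrite <- Cmod2_conj. replace (RtoC (Cmod z ^ 2)) with (RtoC (Cmod z) * RtoC (Cmod z))%C
      by (rewrite <- RtoC_mult; f_equal; ring).
    field; assumption.
Qed.

(** The second mean value formula on the circle of radius r / 2, after a rotation making p a real;
    the halved radius accounts for the factor 2. *)
Lemma cauchy_estimate (P p : C -> C) (a : C) (r M : R) : 0 < r ->
  (forall z, Cmod (z - a) < r -> is_cderive P z (p z)) ->
  (forall z, Cmod (z - a) < r -> ccont p z) ->
  (forall z, Cmod (z - a) < r -> Cmod (P z) <= M) ->
  r * Cmod (p a) <= 2 * M.
Proof.
intros Hr HP Hp HM. destruct (unimodular_rotation (p a)) as [c [Hc Hca]].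
set (F := fun z => (c * P (a + RtoC r * z))%C).
set (g := fun z => (c * (RtoC r * p (a + RtoC r * z)))%C).
assert (HF : forall z, Cmod z < 1 -> is_cderive F z (g z)).
{ intros z Hz. apply is_cderive_scal, is_cderive_rescale, HP, ball_rescale; assumption. }
assert (Hg : forall z, Cmod z < 1 -> ccont g z).
{ intros z Hz e He. 
  destruct (Hp _ (ball_rescale a z r Hr Hz) (e / r)) as [d [Hd K]]; [apply Rdiv_lt_0_compat; lra|].
  exists (d / r); split; [apply Rdiv_lt_0_compat; lra|]. intros w Hw. unfold g.
  replace (c * (RtoC r * p (a + RtoC r * w)) - c * (RtoC r * p (a + RtoC r * z)))%C with
    (c * (RtoC r * (p (a + RtoC r * w) - p (a + RtoC r * z))))%C by ring.
  rewrite !Cmod_mult, Hc, Cmod_R, Rabs_pos_eq, Rmult_1_l by lra.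
  replace e with (r * (e / r)) by (field; lra). apply Rmult_lt_compat_l; [lra|]. apply K.
  replace (a + RtoC r * w - (a + RtoC r * z))%C with (RtoC r * (w - z))%C by ring.
  rewrite Cmod_mult, Cmod_R, Rabs_pos_eq by lra.
  apply Rmult_lt_compat_l with (r := r) in Hw; [|lra].
  replace (r * (d / r)) with d in Hw by (field; lra). exact Hw. }
destruct (mean_value_aux F g HF Hg (1 / 2)) as [_ K]; [lra|].
assert (HC : forall t, Cmod (RtoC (1 / 2) * circ t) < 1) by (intros; rewrite Cmod_scal_circ; lra).
assert (L : RInt (fun t => Re (F (RtoC (1 / 2) * circ t)%C * circ (- t))) 0 1 <= M).
{ apply (RInt_le_const (fun t => Re (F (RtoC (1 / 2) * circ t)%C * circ (- t))%C)).
  - intros t. assert (CC := continuous_on_circle F (1 / 2)%R t). destruct CC as [C1 C2].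
    { eapply is_cderive_ccont, HF, HC. }
    unfold Re in *; simpl. apply (continuous_minus (V := R_NormedModule));
      apply (continuous_mult (K := R_AbsRing)); try assumption; unfold circ; simpl;
      apply (ex_derive_continuous (V := R_NormedModule)); auto_derive; auto.
  - intros t. eapply Rle_trans; [apply Rle_abs|]. eapply Rle_trans; [apply re_le_Cmod|].
    rewrite Cmod_mult, Cmod_circ, Rmult_1_r. unfold F. rewrite Cmod_mult, Hc, Rmult_1_l.
    apply HM, ball_rescale; auto. }
rewrite K in L. unfold g in L.
replace (a + RtoC r * 0)%C with a in L by ring.
replace (c * (RtoC r * p a))%C with (RtoC r * (c * p a))%C in L by ring.
rewrite Hca in L. unfold Re in L; simpl in L. lra.
Qed.

(** * Maximum principle *)

Definition disc_continuous (r : R) (V : C -> R) : Prop :=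
  forall z, Cmod z <= r -> forall e, 0 < e ->
    exists d, 0 < d /\ forall w, Cmod w <= r -> Cmod (w - z) < d -> Rabs (V w - V z) < e.

Lemma disc_max (V : C -> R) (r : R) : 0 < r -> disc_continuous r V ->
  exists z0, Cmod z0 <= r /\ forall z, Cmod z <= r -> V z <= V z0.
Proof.
intros Hr HV.
set (pt := fun a b => (- r + 2 * r * a, - r + 2 * r * b) : C).
set (inside := fun (z : C) a b s => exists a' b', a <= a' <= a + s /\ b <= b' <= b + s /\ z = pt a' b').
(* A square is kept when V has the same supremum on its part of the disc as on the whole disc.
   Quantifying over levels c says this without knowing that V is bounded. *)
destruct (bisection (fun a b s => forall c, (exists z, Cmod z <= r /\ c < V z) ->
  exists z, Cmod z <= r /\ inside z a b s /\ c < V z)) as [A [B H]].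
{ intros a b s Ha Hb Hs Has Hbs H. apply NNPP. intros N.
  assert (N' : forall a' b', 
    ~ (forall c, (exists z, Cmod z <= r /\ c < V z) ->
       exists z, Cmod z <= r /\ inside z a' b' (s / 2) /\ c < V z) ->
    exists c, (exists z, Cmod z <= r /\ c < V z) /\
      forall z, Cmod z <= r -> inside z a' b' (s / 2) -> V z <= c).
  { intros a' b' K. apply not_all_ex_not in K. destruct K as [c K]. exists c.
    apply imply_to_and in K. destruct K as [K1 K2]. split; [exact K1|].
    intros z Hz Hi. apply Rnot_lt_le. intros L. apply K2. exists z; auto. }
  destruct (N' a b) as [c1 [E1 K1]]; [tauto|].
  destruct (N' (a + s / 2) b) as [c2 [E2 K2]]; [tauto|].
  destruct (N' a (b + s / 2)) as [c3 [E3 K3]]; [tauto|].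
  destruct (N' (a + s / 2) (b + s / 2)) as [c4 [E4 K4]]; [tauto|].
  assert (Em : forall x y, (exists z, Cmod z <= r /\ x < V z) -> (exists z, Cmod z <= r /\ y < V z) ->
    exists z, Cmod z <= r /\ Rmax x y < V z).
  { intros x y Hx Hy. apply Rmax_case; assumption. }
  destruct (H (Rmax (Rmax c1 c2) (Rmax c3 c4))) as [z [Hz [[a' [b' [Ha' [Hb' ->]]]] L]]];
    [auto|].
  assert (M1 := Rmax_l (Rmax c1 c2) (Rmax c3 c4)). assert (M2 := Rmax_r (Rmax c1 c2) (Rmax c3 c4)).
  assert (M3 := Rmax_l c1 c2). assert (M4 := Rmax_r c1 c2).
  assert (M5 := Rmax_l c3 c4). assert (M6 := Rmax_r c3 c4).
  destruct (Rle_dec a' (a + s / 2)); destruct (Rle_dec b' (b + s / 2)).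
  - enough (V (pt a' b') <= c1) by lra. apply K1; [exact Hz|]. exists a', b'; repeat split; lra.
  - enough (V (pt a' b') <= c3) by lra. apply K3; [exact Hz|]. exists a', b'; repeat split; lra.
  - enough (V (pt a' b') <= c2) by lra. apply K2; [exact Hz|]. exists a', b'; repeat split; lra.
  - enough (V (pt a' b') <= c4) by lra. apply K4; [exact Hz|]. exists a', b'; repeat split; lra. }
{ intros c [z [Hz L]]. exists z; split; [exact Hz|]; split; [|exact L].
  assert (H1 := re_le_Cmod z). assert (H2 := Im_le_Cmod z).
  apply Rabs_le_between in H1. apply Rabs_le_between in H2.
  exists ((Re z + r) / (2 * r)), ((Im z + r) / (2 * r)).
  assert (Q : forall x, - r <= x <= r -> 0 <= (x + r) / (2 * r) <= 0 + 1).
  { intros x Hx; split; [apply Rdiv_le_0_compat; lra|].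
    apply Rmult_le_reg_r with (2 * r); [lra|]. unfold Rdiv.
    rewrite Rmult_assoc, Rinv_l; lra. }
  split; [apply Q; lra|]. split; [apply Q; lra|].
  destruct z as [x y]; unfold pt; simpl. f_equal; field; lra. }
set (z0 := pt A B).
assert (Near : forall d, 0 < d -> exists n : nat, forall z a b, a <= A <= a + (/ 2) ^ n ->
  b <= B <= b + (/ 2) ^ n -> inside z a b ((/ 2) ^ n) -> Cmod (z - z0) < d).
{ intros d Hd. destruct (pow_lt_1_zero (/ 2)) with (y := d / (4 * r + 1)) as [n Hn].
  { rewrite Rabs_pos_eq; lra. } { apply Rdiv_lt_0_compat; lra. }
  exists n. specialize (Hn n (le_n n)).
  assert (Hp : 0 < (/ 2) ^ n) by (apply pow_lt; lra).
  rewrite Rabs_pos_eq in Hn by lra. set (s := (/ 2) ^ n) in *.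
  intros z a b HA HB [a' [b' [Ha' [Hb' ->]]]].
  eapply Rle_lt_trans; [apply Cmod_le_abs|]. unfold z0, pt, Re, Im; simpl.
  replace (- r + 2 * r * a' + - (- r + 2 * r * A)) with (2 * r * (a' - A)) by ring.
  replace (- r + 2 * r * b' + - (- r + 2 * r * B)) with (2 * r * (b' - B)) by ring.
  rewrite !Rabs_mult, (Rabs_pos_eq 2), (Rabs_pos_eq r) by lra.
  assert (Rabs (a' - A) <= s) by (apply Rabs_le; lra).
  assert (Rabs (b' - B) <= s) by (apply Rabs_le; lra).
  apply Rmult_lt_compat_r with (r := 4 * r + 1) in Hn; [|lra].
  unfold Rdiv in Hn. rewrite Rmult_assoc, Rinv_l in Hn by lra. nra. }
assert (Z0 : Cmod z0 <= r).
{ apply le_epsilon. intros e He. destruct (Near e He) as [n Hn].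
  destruct (H n) as [a [b [_ [_ [_ [_ [HA [HB K]]]]]]]].
  destruct (K (V 0%C - 1)) as [z [Hz [Hi _]]].
  { exists 0%C. rewrite Cmod_0. lra. }
  specialize (Hn z a b HA HB Hi).
  replace z0 with (z + - (z - z0))%C by ring. eapply Rle_trans; [apply Cmod_triangle|].
  rewrite Cmod_opp. lra. }
exists z0; split; [exact Z0|]. intros z1 Hz1. apply Rnot_lt_le. intros L.
destruct (HV z0 Z0 ((V z1 - V z0) / 2)) as [d [Hd Hcont]]; [lra|].
destruct (Near d Hd) as [n Hn]. destruct (H n) as [a [b [_ [_ [_ [_ [HA [HB K]]]]]]]].
destruct (K ((V z1 + V z0) / 2)) as [z [Hz [Hi Lz]]]; [exists z1; split; [exact Hz1|lra]|].
assert (Q := Hcont z Hz (Hn z a b HA HB Hi)). apply Rabs_def2 in Q. lra.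
Qed.

(** |z|^2 and |z - a|^2 differ by the real part of an affine function, which can be absorbed into a
    holomorphic support function. *)
Lemma Cmod_minus_sqr (z a : C) :
  Cmod z ^ 2 - Cmod a ^ 2 = Cmod (z - a) ^ 2 + 2 * Re (Cconj a * (z - a)).
Proof. rewrite !Cmod2_alt. unfold Re, Im; simpl. ring. Qed.

(* Maximum principle for functions supported from below, at every interior point,
   by the real part of a holomorphic function; subharmonicity enters only in this form. *)
Definition holo_supported (r : R) (W : C -> R) : Prop :=
  forall z, Cmod z < r -> exists (d : R) (G : C -> C), 0 < d /\
    (forall w, Cmod (w - z) < d -> ex_cderive G w) /\
    (forall w, Cmod (w - z) < d -> Cmod w < r -> Re (G w) <= W w) /\ Re (G z) = W z.

Lemma maximum_principle (W : C -> R) (r M : R) : 0 < r ->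
  disc_continuous r W -> holo_supported r W ->
  (forall z, Cmod z = r -> W z <= M) -> forall z, Cmod z <= r -> W z <= M.
Proof.
intros Hr HW HS HM z1 Hz1. apply Rnot_lt_le. intros L.
(* The perturbation e |z|^2 is then at most half the gap between M and W z1, so the perturbed
   maximum cannot lie on the circle. *)
set (e := (W z1 - M) / (2 * r ^ 2)).
assert (Hr2 : 0 < r ^ 2) by (apply pow_lt; lra).
assert (He : 0 < e) by (apply Rdiv_lt_0_compat; lra).
assert (Her : e * r ^ 2 = (W z1 - M) / 2) by (unfold e; field; lra).
set (V := fun z => W z + e * Cmod z ^ 2).
destruct (disc_max V r Hr) as [z0 [Hz0 Hmax]].
{ intros z Hz x Hx. destruct (HW z Hz (x / 2)) as [d [Hd K]]; [lra|].
  exists (Rmin d (x / (4 * e * r))); split.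
  { apply Rmin_glb_lt; [exact Hd|]. apply Rdiv_lt_0_compat; [lra|]. nra. }
  intros w Hw Hwz.
  assert (W1 := K w Hw (Rlt_le_trans _ _ _ Hwz (Rmin_l _ _))).
  assert (W2 := Rlt_le_trans _ _ _ Hwz (Rmin_r _ _)).
  assert (T1 := Cmod_triangle z (w - z)). replace (z + (w - z))%C with w in T1 by ring.
  assert (T2 := Cmod_triangle w (- (w - z))). replace (w + - (w - z))%C with z in T2 by ring.
  rewrite Cmod_opp in T2.
  apply Rmult_lt_compat_l with (r := 4 * e * r) in W2; [|nra].
  replace (4 * e * r * (x / (4 * e * r))) with x in W2 by (field; lra).
  assert (Hd0 := Cmod_ge_0 w). assert (Hd1 := Cmod_ge_0 z). assert (Hd2 := Cmod_ge_0 (w - z)).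
  assert (Q : Rabs (e * Cmod w ^ 2 - e * Cmod z ^ 2) <= x / 2).
  { replace (e * Cmod w ^ 2 - e * Cmod z ^ 2) with (e * (Cmod w + Cmod z) * (Cmod w - Cmod z)) by ring.
    rewrite Rabs_mult, (Rabs_pos_eq (e * _)) by nra.
    assert (Rabs (Cmod w - Cmod z) <= Cmod (w - z)) by (apply Rabs_le; lra).
    apply Rle_trans with (e * (2 * r) * Cmod (w - z)); [|lra].
    apply Rmult_le_compat; try apply Rabs_pos; nra. }
  unfold V. replace (W w + e * Cmod w ^ 2 - (W z + e * Cmod z ^ 2)) with
    ((W w - W z) + (e * Cmod w ^ 2 - e * Cmod z ^ 2)) by ring.
  eapply Rle_lt_trans; [apply Rabs_triang|]. lra. }
assert (Hz0r : Cmod z0 < r).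
{ destruct (Rle_lt_or_eq_dec _ _ Hz0) as [h|h]; [exact h|exfalso].
  assert (K := Hmax z1 Hz1). unfold V in K. rewrite h in K.
  assert (K2 := HM z0 h). generalize (pow2_ge_0 (Cmod z1)); nra. }
destruct (HS z0 Hz0r) as [d [G [Hd [HG [HGW HGz]]]]].
(* The added affine term trades e |w|^2 - e |z0|^2 for e |w - z0|^2, which gives exactly the
   situation excluded by [no_strict_local_max]. *)
set (G2 := fun w => (G w + RtoC (2 * e) * Cconj z0 * (w - z0))%C).
apply (no_strict_local_max G2 z0 (Rmin d (r - Cmod z0)) e).
- apply Rmin_glb_lt; lra.
- exact He.
- intros w Hw. unfold G2. apply ex_cderive_plus; [apply HG; eapply Rlt_le_trans; [apply Hw|apply Rmin_l]|].
  apply ex_cderive_mult; [apply ex_cderive_const|].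
  apply ex_cderive_minus; [apply ex_cderive_id|apply ex_cderive_const].
- intros w Hw.
  assert (W1 := Rlt_le_trans _ _ _ Hw (Rmin_l _ _)).
  assert (W2 := Rlt_le_trans _ _ _ Hw (Rmin_r _ _)).
  assert (Hwr : Cmod w < r).
  { replace w with (z0 + (w - z0))%C by ring. eapply Rle_lt_trans; [apply Cmod_triangle|]. lra. }
  assert (K := Hmax w (Rlt_le _ _ Hwr)). unfold V in K.
  assert (K1 := HGW w W1 Hwr). assert (K2 := Cmod_minus_sqr w z0).
  assert (E1 : Re (G2 w) = Re (G w) + e * (2 * Re (Cconj z0 * (w - z0)))).
  { unfold G2, Re, Im; simpl. ring. }
  assert (E2 : Re (G2 z0) = W z0).
  { rewrite <- HGz. unfold G2, Re, Im; simpl. ring. }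
  rewrite E1, E2. 
  replace (e * (2 * Re (Cconj z0 * (w - z0)))) with (e * (Cmod w ^ 2 - Cmod z0 ^ 2 - Cmod (w - z0) ^ 2))
    by (rewrite K2; ring). lra.
Qed.

Lemma Cmod_diff_le (z w : C) : Rabs (Cmod z - Cmod w) <= Cmod (z - w).
Proof.
assert (T1 := Cmod_triangle w (z - w)). replace (w + (z - w))%C with z in T1 by ring.
assert (T2 := Cmod_triangle z (- (z - w))). replace (z + - (z - w))%C with w in T2 by ring.
rewrite Cmod_opp in T2. apply Rabs_le; lra.
Qed.

Lemma maximum_modulus (F : C -> C) (r M : R) : 0 < r ->
  (forall z, Cmod z <= r -> forall e, 0 < e ->
     exists d, 0 < d /\ forall w, Cmod w <= r -> Cmod (w - z) < d -> Cmod (F w - F z) < e) ->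
  (forall z, Cmod z < r -> ex_cderive F z) ->
  (forall z, Cmod z = r -> Cmod (F z) <= M) -> forall z, Cmod z <= r -> Cmod (F z) <= M.
Proof.
intros Hr HF HD HM. apply (maximum_principle (fun z => Cmod (F z)) r M Hr); [| |exact HM].
- intros z Hz e He. destruct (HF z Hz e He) as [d [Hd K]]. exists d; split; [exact Hd|].
  intros w Hw Hwz. eapply Rle_lt_trans; [apply Cmod_diff_le|]. apply K; assumption.
(* Re (c F) lies below |F| everywhere and touches it at z, so c F supports |F| there. *)
- intros z Hz. destruct (unimodular_rotation (F z)) as [c [Hc Hcz]].
  exists (r - Cmod z), (fun w => c * F w)%C. split; [lra|]. split; [|split].
  + intros w Hw. apply ex_cderive_mult; [apply ex_cderive_const|]. apply HD.
    replace w with (z + (w - z))%C by ring. eapply Rle_lt_trans; [apply Cmod_triangle|]. lra.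
  + intros w _ _. eapply Rle_trans; [apply Rle_abs|]. eapply Rle_trans; [apply re_le_Cmod|].
    rewrite Cmod_mult, Hc. lra.
  + rewrite Hcz. reflexivity.
Qed.

(** * Radial limits at points where the primitive is differentiable *)

Definition disc_lipschitz (L : R) (Q : C -> C) : Prop :=
  forall z w, Cmod z <= 1 -> Cmod w <= 1 -> Cmod (Q z - Q w) <= L * Cmod (z - w).

(** A complex mean value inequality: after rotating the increment onto the positive axis, the real
    mean value theorem applies along the segment. *)
Lemma lipschitz_of_derivative_bound (P p : C -> C) (L : R) :
  (forall z, Cmod z < 1 -> is_cderive P z (p z)) -> (forall z, Cmod z < 1 -> Cmod (p z) <= L) ->
  forall z w, Cmod z < 1 -> Cmod w < 1 -> Cmod (P z - P w) <= L * Cmod (z - w).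
Proof.
intros HP Hp z w Hz Hw. destruct (unimodular_rotation (P z - P w)) as [c [Hc Hcz]].
set (g := fun s : R => (c * P (w + RtoC s * (z - w))%C)%C).
assert (Hin : forall s, 0 <= s <= 1 -> Cmod (w + RtoC s * (z - w)) < 1).
{ intros s Hs. replace (w + RtoC s * (z - w))%C with (RtoC (1 - s) * w + RtoC s * z)%C
    by (rewrite RtoC_minus; ring).
  eapply Rle_lt_trans; [apply Cmod_triangle|]. rewrite !Cmod_mult, !Cmod_R, !Rabs_pos_eq by lra.
  destruct (Req_dec s 0) as [->|h]; [lra|].
  assert (0 < s * (1 - Cmod z)) by (apply Rmult_lt_0_compat; lra).
  assert (0 <= (1 - s) * (1 - Cmod w)) by (apply Rmult_le_pos; lra). lra. }
assert (Hg : forall s, 0 <= s <= 1 -> is_derive (fun s => Re (g s)) s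
  (Re (c * (p (w + RtoC s * (z - w))%C * (z - w))))).
{ intros s Hs.
  assert (V : is_vderive (fun s => w + RtoC s * (z - w))%C s (z - w)).
  { split; unfold Re, Im; simpl; auto_derive; auto; ring. }
  assert (W := is_vderive_comp (fun z => c * P z)%C _ s _ _ (is_cderive_scal _ _ c _ (HP _ (Hin s Hs))) V).
  destruct W as [W _]. replace (c * (p (w + RtoC s * (z - w))%C * (z - w)))%C with
    (c * p (w + RtoC s * (z - w))%C * (z - w))%C by ring. exact W. }
destruct (MVT_gen (fun s => Re (g s)) 0 1 (fun s => Re (c * (p (w + RtoC s * (z - w))%C * (z - w)))))
  as [s [Hs E]].
{ rewrite Rmin_left, Rmax_right by lra. intros x Hx. apply Hg; lra. }
{ rewrite Rmin_left, Rmax_right by lra. intros x Hx. apply continuity_pt_filterlim.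
  apply (ex_derive_continuous (V := R_NormedModule)). eexists; apply Hg, Hx. }
rewrite Rmin_left, Rmax_right in Hs by lra.
assert (E2 : Re (g 1) - Re (g 0) = Cmod (P z - P w)).
{ unfold g. replace (w + RtoC 1 * (z - w))%C with z by ring.
  replace (w + RtoC 0 * (z - w))%C with w by ring.
  replace (Cmod (P z - P w)) with (Re (c * (P z - P w))) by (rewrite Hcz; reflexivity).
  unfold Re, Im; simpl; ring. }
rewrite <- E2, E, Rminus_0_r, Rmult_1_r.
eapply Rle_trans; [apply Rle_abs|]. eapply Rle_trans; [apply re_le_Cmod|].
rewrite !Cmod_mult, Hc, Rmult_1_l. apply Rmult_le_compat_r; [apply Cmod_ge_0|].
apply Hp, Hin, Hs.
Qed.

(** The intervals [g s - (1 - s), g s + (1 - s)] meet pairwise, so the supremum of their left ends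
    lies in all of them. *)
Lemma lipschitz_endpoint (g : R -> R) :
  (forall r s, 0 <= r < 1 -> 0 <= s < 1 -> Rabs (g r - g s) <= Rabs (r - s)) ->
  exists q, forall r, 0 <= r < 1 -> Rabs (q - g r) <= 1 - r.
Proof.
intros Hg.
assert (K : forall r s, 0 <= r < 1 -> 0 <= s < 1 -> g s - (1 - s) <= g r + (1 - r)).
{ intros r s Hr Hs. assert (H := Hg s r Hs Hr). apply Rabs_le_between in H.
  assert (Rabs (s - r) <= (1 - s) + (1 - r)) by (apply Rabs_le; lra). lra. }
destruct (completeness (fun y => exists s, 0 <= s < 1 /\ y = g s - (1 - s))) as [q [H1 H2]].
- exists (g 0 + (1 - 0)). intros y [s [Hs ->]]. apply K; lra.
- exists (g 0 - (1 - 0)), 0. split; lra.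
- exists q. intros r Hr. apply Rabs_le. split.
  + enough (g r - (1 - r) <= q) by lra. apply H1. exists r; auto.
  + enough (q <= g r + (1 - r)) by lra. apply H2. intros y [s [Hs ->]]. apply K; auto.
Qed.

(** Every point of the closed disc, interior ones included, receives the limit of P along its radius
    as value. The Lipschitz bound thus passes to the limit uniformly, without separating interior
    from boundary. *)
Lemma lipschitz_extension (P : C -> C) :
  (forall z w, Cmod z < 1 -> Cmod w < 1 -> Cmod (P z - P w) <= 1 * Cmod (z - w)) ->
  exists Q : C -> C, disc_lipschitz 1 Q /\ forall z, Cmod z < 1 -> Q z = P z.
Proof.
intros HP.
assert (Hin : forall z r, Cmod z <= 1 -> 0 <= r < 1 -> Cmod (RtoC r * z) < 1).
{ intros z r Hz Hr. rewrite Cmod_mult, Cmod_R, Rabs_pos_eq by lra. generalize (Cmod_ge_0 z); nra. }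
assert (Hray : forall z, Cmod z <= 1 -> forall r s, 0 <= r < 1 -> 0 <= s < 1 ->
  Cmod (P (RtoC r * z)%C - P (RtoC s * z)%C) <= Rabs (r - s)).
{ intros z Hz r s Hr Hs. eapply Rle_trans; [apply HP; apply Hin; assumption|].
  replace (RtoC r * z - RtoC s * z)%C with (RtoC (r - s) * z)%C by (rewrite RtoC_minus; ring).
  rewrite Cmod_mult, Cmod_R. generalize (Rabs_pos (r - s)) (Cmod_ge_0 z); nra. }
assert (Ex : forall z, Cmod z <= 1 -> exists q : C, forall r, 0 <= r < 1 ->
  Cmod (q - P (RtoC r * z)%C) <= 2 * (1 - r)).
{ intros z Hz.
  destruct (lipschitz_endpoint (fun r => Re (P (RtoC r * z)%C))) as [q1 H1].
  { intros r s Hr Hs. eapply Rle_trans; [apply (re_le_Cmod (P (RtoC r * z)%C - P (RtoC s * z)%C))|].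
    apply Hray; assumption. }
  destruct (lipschitz_endpoint (fun r => Im (P (RtoC r * z)%C))) as [q2 H2].
  { intros r s Hr Hs. eapply Rle_trans; [apply (Im_le_Cmod (P (RtoC r * z)%C - P (RtoC s * z)%C))|].
    apply Hray; assumption. }
  exists (q1, q2). intros r Hr. eapply Rle_trans; [apply Cmod_le_abs|].
  assert (K1 := H1 r Hr). assert (K2 := H2 r Hr). unfold Re, Im, Rminus in *; simpl in *. lra. }
set (Q := fun z => ClassicalEpsilon.epsilon (inhabits (RtoC 0)) (fun q : C => forall r, 0 <= r < 1 ->
  Cmod (q - P (RtoC r * z)%C) <= 2 * (1 - r))).
assert (HQ : forall z, Cmod z <= 1 -> forall r, 0 <= r < 1 ->
  Cmod (Q z - P (RtoC r * z)%C) <= 2 * (1 - r)).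
{ intros z Hz. apply ClassicalEpsilon.epsilon_spec, Ex, Hz. }
exists Q; split.
- intros z w Hz Hw. rewrite Rmult_1_l. apply le_epsilon. intros e He.
  set (r := Rmax 0 (1 - e / 4)).
  assert (Hr : 0 <= r < 1) by (unfold r; split; [apply Rmax_l|apply Rmax_lub_lt; lra]).
  assert (Hre : 1 - r <= e / 4) by (unfold r; generalize (Rmax_r 0 (1 - e / 4)); lra).
  replace (Q z - Q w)%C with ((Q z - P (RtoC r * z)) + ((P (RtoC r * z) - P (RtoC r * w)) +
    - (Q w - P (RtoC r * w))))%C by ring.
  eapply Rle_trans; [apply Cmod_triangle|].
  assert (T := Cmod_triangle (P (RtoC r * z)%C - P (RtoC r * w)%C) (- (Q w - P (RtoC r * w)%C))).
  rewrite Cmod_opp in T. assert (K1 := HQ z Hz r Hr). assert (K2 := HQ w Hw r Hr).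
  assert (K3 := HP _ _ (Hin z r Hz Hr) (Hin w r Hw Hr)).
  replace (RtoC r * z - RtoC r * w)%C with (RtoC r * (z - w))%C in K3 by ring.
  rewrite Cmod_mult, Cmod_R, Rabs_pos_eq in K3 by lra.
  generalize (Cmod_ge_0 (z - w)); nra.
- intros z Hz.
  assert (Z : Cmod (Q z - P z) <= 0).
  { apply le_epsilon. intros e He. rewrite Rplus_0_l.
    set (r := Rmax 0 (1 - e / 4)).
    assert (Hr : 0 <= r < 1) by (unfold r; split; [apply Rmax_l|apply Rmax_lub_lt; lra]).
    assert (Hre : 1 - r <= e / 4) by (unfold r; generalize (Rmax_r 0 (1 - e / 4)); lra).
    replace (Q z - P z)%C with ((Q z - P (RtoC r * z)) + (P (RtoC r * z) - P z))%C by ring.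
    eapply Rle_trans; [apply Cmod_triangle|]. assert (K1 := HQ z (Rlt_le _ _ Hz) r Hr).
    assert (K3 := HP _ _ (Hin z r (Rlt_le _ _ Hz) Hr) Hz).
    replace (RtoC r * z - z)%C with (- (RtoC (1 - r) * z))%C in K3 by (rewrite RtoC_minus; ring).
    rewrite Cmod_opp, Cmod_mult, Cmod_R, Rabs_pos_eq in K3 by lra.
    generalize (Cmod_ge_0 z); nra. }
  assert (Z2 : (Q z - P z)%C = 0%C) by (apply Cmod_eq_0; generalize (Cmod_ge_0 (Q z - P z)); lra).
  replace (Q z) with ((Q z - P z) + P z)%C by ring. rewrite Z2. ring.
Qed.

(** The parallelogram law for 1 and z: on the circle the modulus of (1 + z) / 2 reaches 1 only at z
    = 1, with a quantitative drop elsewhere. *)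
Lemma Cmod_peak (z : C) : Cmod z = 1 -> Cmod ((1 + z) / 2) ^ 2 = 1 - Cmod (z - 1) ^ 2 / 4.
Proof.
intros Hz. assert (H : Re z ^ 2 + Im z ^ 2 = 1) by (rewrite <- Cmod2_alt, Hz; ring).
rewrite Cmod_div by (intros E; apply RtoC_inj in E; lra).
rewrite Cmod_R, Rabs_pos_eq by lra.
unfold Rdiv. rewrite Rpow_mult_distr, !Cmod2_alt. unfold Re, Im in *; simpl in *. nra.
Qed.

Lemma Cmod_minus_sym (z w : C) : Cmod (z - w) = Cmod (w - z).
Proof. rewrite <- Cmod_opp. f_equal. ring. Qed.

(* A peaking factor ((1 + z) / 2)^N crushes [P] away from 1, so the maximum principle turns
   the bound o(|z - 1|) on the circle into one on the disc; Cauchy's estimate does the rest. *)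
Lemma fatou_criterion (P p : C -> C) (L : R) : 0 <= L -> disc_lipschitz L P ->
  (forall z, Cmod z < 1 -> is_cderive P z (p z)) -> (forall z, Cmod z < 1 -> ccont p z) ->
  (forall eta, 0 < eta -> exists d, 0 < d /\
     forall z, Cmod z = 1 -> Cmod (z - 1) < d -> Cmod (P z) <= eta * Cmod (z - 1)) ->
  forall e, 0 < e -> exists d, 0 < d /\ forall r, 1 - d < r < 1 -> Cmod (p (RtoC r)) <= e.
Proof.
intros HL0 HL HP Hp Hsmall e He.
(* The 8 collects three factors 2: Cauchy's estimate, the distance 2 (1 - r) from 1 to points of the
   ball about r, and the lower bound 1/2 for the peaking factor. *)
set (eta := e / 8). assert (Heta : 0 < eta) by (unfold eta; lra).
set (B := Cmod (P 0%C) + L).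
assert (HB : forall z, Cmod z <= 1 -> Cmod (P z) <= B).
{ intros z Hz. replace (P z) with (P 0%C + (P z - P 0%C))%C by ring.
  eapply Rle_trans; [apply Cmod_triangle|]. unfold B. apply Rplus_le_compat_l.
  assert (K := HL z 0%C Hz ltac:(rewrite Cmod_0; lra)). replace (z - 0)%C with z in K by ring. nra. }
assert (HB0 : 0 <= B) by (unfold B; generalize (Cmod_ge_0 (P 0%C)); lra).
destruct (Hsmall eta Heta) as [d0 [Hd0 H0]].
set (d := Rmin d0 1).
assert (Hd : 0 < d <= 1) by (unfold d; split; [apply Rmin_glb_lt; lra|apply Rmin_r]).
assert (Hdd0 : d <= d0) by apply Rmin_l.
set (q := 1 - d ^ 2 / 4). assert (Hq : 0 <= q < 1) by (unfold q; nra).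
(* q bounds the squared peaking factor at distance at least d from 1. This N makes B q^N at most eta
   d, hence at most eta |z - 1| there. *)
destruct (pow_lt_1_zero q) with (y := eta * d / (B + 1)) as [N HN].
{ rewrite Rabs_pos_eq; lra. } { apply Rdiv_lt_0_compat; nra. }
specialize (HN N (le_n N)). rewrite Rabs_pos_eq in HN by (apply pow_le; lra).
set (E := fun z : C => (((1 + z) / 2) ^ (2 * N))%C).
assert (HEex : forall z, ex_cderive E z).
{ intros z. apply (ex_cderive_Cpow (fun z => (1 + z) / 2)%C).
  apply (ex_cderive_mult (fun z => 1 + z)%C (fun _ => / 2)%C); [|apply ex_cderive_const].
  apply ex_cderive_plus; [apply ex_cderive_const|apply ex_cderive_id]. }
assert (HEmod : forall z, Cmod (E z) = (Cmod ((1 + z) / 2) ^ 2) ^ N).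
{ intros z. unfold E. rewrite Cmod_pow, pow_mult. reflexivity. }
assert (Hbd : forall z, Cmod z = 1 -> Cmod (P z) * Cmod (E z) <= eta * Cmod (z - 1)).
{ intros z Hz. rewrite HEmod, Cmod_peak by exact Hz.
  assert (G := Cmod_ge_0 (z - 1)).
  assert (R1 : 0 <= 1 - Cmod (z - 1) ^ 2 / 4) by (rewrite <- Cmod_peak by exact Hz; apply pow2_ge_0).
  destruct (Rlt_dec (Cmod (z - 1)) d) as [h|h].
  - assert ((1 - Cmod (z - 1) ^ 2 / 4) ^ N <= 1).
    { eapply Rle_trans; [apply pow_incr with (y := 1)|rewrite pow1; lra]. split; [exact R1|]. generalize (pow2_ge_0 (Cmod (z - 1))); lra. }
    assert (0 <= (1 - Cmod (z - 1) ^ 2 / 4) ^ N) by (apply pow_le; lra).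
    assert (K := H0 z Hz ltac:(lra)).
    apply Rle_trans with (Cmod (P z) * 1); [apply Rmult_le_compat_l; [apply Cmod_ge_0|assumption]|lra].
  - assert (A1 : (1 - Cmod (z - 1) ^ 2 / 4) ^ N <= q ^ N).
    { apply pow_incr. split; [exact R1|]. unfold q.
      assert (d ^ 2 <= Cmod (z - 1) ^ 2) by (apply pow_incr; lra). lra. }
    assert (A2 : Cmod (P z) <= B) by (apply HB; lra).
    apply Rle_trans with (B * (eta * d / (B + 1))).
    + apply Rmult_le_compat; [apply Cmod_ge_0|apply pow_le; lra|exact A2|lra].
    + apply Rle_trans with (eta * d); [|nra].
      apply Rmult_le_reg_r with (B + 1); [lra|].
      replace (B * (eta * d / (B + 1)) * (B + 1)) with (B * (eta * d)) by (field; lra). nra. }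
assert (Hre1 : forall z, Cmod z <= 1 -> Re z <= 1).
{ intros z Hz. eapply Rle_trans; [apply Rle_abs|]. eapply Rle_trans; [apply re_le_Cmod|exact Hz]. }
assert (Hk : forall z k, Cmod z <= 1 -> 0 < k -> Cmod (z - 1) <= Cmod (1 + RtoC k - z) /\
   k <= Cmod (1 + RtoC k - z)).
{ intros z k Hz Hk. assert (R1 := Hre1 z Hz). split.
  - rewrite Cmod_minus_sym. unfold Cmod, Re in *; simpl in *. apply sqrt_le_1_alt. nra.
  - eapply Rle_trans; [|apply re_le_Cmod]. unfold Re in *; simpl. rewrite Rabs_pos_eq; lra. }
assert (Hin : forall z, Cmod z < 1 -> Cmod (P z) * Cmod (E z) <= eta * Cmod (z - 1)).
(* Dividing by 1 - z would put a pole on the circle, so the pole is moved to 1 + k. This costs eta k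
   = x in the final bound. *)
{ intros z Hz. apply le_epsilon. intros x Hx. set (k := x / eta).
  assert (Hk0 : 0 < k) by (apply Rdiv_lt_0_compat; lra).
  set (H := fun w : C => (E w * / (1 + RtoC k - w))%C).
  assert (Hne : forall w, Cmod w <= 1 -> (1 + RtoC k - w)%C <> 0%C).
  { intros w Hw. apply Cmod_gt_0. destruct (Hk w k Hw Hk0). lra. }
  assert (HH : forall w, Cmod w <= 1 -> ex_cderive H w).
  { intros w Hw. apply ex_cderive_mult; [apply HEex|].
    apply (ex_cderive_Cinv (fun w => 1 + RtoC k - w)%C); [apply Hne, Hw|].
    apply (ex_cderive_minus (fun _ => 1 + RtoC k)%C (fun w => w));
      [apply ex_cderive_const|apply ex_cderive_id]. }
  assert (MM : Cmod (P z * H z) <= eta).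
  { apply (maximum_modulus (fun w => P w * H w)%C 1 eta); [lra| | | |lra].
    - intros w Hw y Hy.
      destruct (ex_cderive_ccont H w (HH w Hw) (y / (2 * (B + 1)))) as [d1 [Hd1 K1]].
      { apply Rdiv_lt_0_compat; lra. }
      set (h := Cmod (H w)). assert (Hh : 0 <= h) by apply Cmod_ge_0.
      exists (Rmin d1 (y / (2 * (h * L + 1)))). split.
      { apply Rmin_glb_lt; [exact Hd1|]. apply Rdiv_lt_0_compat; nra. }
      intros v Hv Hvw.
      assert (V1 := K1 v (Rlt_le_trans _ _ _ Hvw (Rmin_l _ _))).
      assert (V2 := Rlt_le_trans _ _ _ Hvw (Rmin_r _ _)).
      replace (P v * H v - P w * H w)%C with (P v * (H v - H w) + H w * (P v - P w))%C by ring.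
      eapply Rle_lt_trans; [apply Cmod_triangle|]. rewrite !Cmod_mult. fold h.
      assert (B1 := HB v Hv). assert (B2 := HL v w Hv Hw).
      assert (T1 : Cmod (P v) * Cmod (H v - H w) <= y / 2).
      { apply Rle_trans with ((B + 1) * (y / (2 * (B + 1)))).
        - apply Rmult_le_compat; try apply Cmod_ge_0; lra.
        - right; field; lra. }
      assert (T2 : h * Cmod (P v - P w) < y / 2).
      { apply Rle_lt_trans with (h * L * Cmod (v - w)); [rewrite Rmult_assoc; apply Rmult_le_compat_l; lra|].
        apply Rmult_lt_compat_l with (r := h * L + 1) in V2; [|nra].
        replace ((h * L + 1) * (y / (2 * (h * L + 1)))) with (y / 2) in V2 by (field; nra).
        generalize (Cmod_ge_0 (v - w)); nra. }
      lra.
    - intros w Hw. apply ex_cderive_mult; [eexists; apply HP, Hw|apply HH; lra].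
    - intros w Hw. unfold H. destruct (Hk w k ltac:(lra) Hk0) as [K1 K2].
      rewrite !Cmod_mult, Cmod_inv by (apply Hne; lra).
      rewrite <- Rmult_assoc. apply Rmult_le_reg_r with (Cmod (1 + RtoC k - w)); [lra|].
      rewrite Rmult_assoc, Rinv_l, Rmult_1_r by lra.
      eapply Rle_trans; [apply Hbd, Hw|]. apply Rmult_le_compat_l; lra. }
  unfold H in MM. destruct (Hk z k ltac:(lra) Hk0) as [K1 K2].
  rewrite !Cmod_mult, Cmod_inv in MM by (apply Hne; lra).
  rewrite <- Rmult_assoc in MM. apply Rmult_le_compat_r with (r := Cmod (1 + RtoC k - z)) in MM; [|lra].
  rewrite Rmult_assoc, Rinv_l, Rmult_1_r in MM by lra.
  eapply Rle_trans; [apply MM|].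
  assert (T : Cmod (1 + RtoC k - z) <= Cmod (z - 1) + k).
  { replace (1 + RtoC k - z)%C with (- (z - 1) + RtoC k)%C by ring.
    eapply Rle_trans; [apply Cmod_triangle|]. rewrite Cmod_opp, Cmod_R, Rabs_pos_eq; lra. }
  apply Rle_trans with (eta * (Cmod (z - 1) + k)); [apply Rmult_le_compat_l; lra|].
  rewrite Rmult_plus_distr_l. apply Rplus_le_compat_l. right. unfold k; field; lra. }
assert (E1 : E (RtoC 1) = RtoC 1).
{ unfold E. replace ((1 + 1) / 2)%C with (RtoC 1).
  - clear. induction (2 * N)%nat as [|n IH]; simpl; [reflexivity|rewrite IH; ring].
  - field. }
destruct (ex_cderive_ccont E (RtoC 1) (HEex (RtoC 1)) (1 / 2)) as [t [Ht KE]]; [lra|].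
exists (Rmin 1 (t / 2)). split; [apply Rmin_glb_lt; lra|]. intros r Hr.
assert (Hr1 : 0 < r) by (generalize (Rmin_l 1 (t / 2)); lra).
assert (Hr2 : 2 * (1 - r) < t) by (generalize (Rmin_r 1 (t / 2)); lra).
assert (Hball : forall z, Cmod (z - RtoC r) < 1 - r -> Cmod z < 1 /\ Cmod (z - 1) < 2 * (1 - r)).
{ intros z Hz. split.
  - replace z with (RtoC r + (z - RtoC r))%C by ring. eapply Rle_lt_trans; [apply Cmod_triangle|].
    rewrite Cmod_R, Rabs_pos_eq; lra.
  - replace (z - 1)%C with ((z - RtoC r) + - RtoC (1 - r))%C by (rewrite RtoC_minus; ring).
    eapply Rle_lt_trans; [apply Cmod_triangle|]. rewrite Cmod_opp, Cmod_R, Rabs_pos_eq; lra. }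
assert (K : (1 - r) * Cmod (p (RtoC r)) <= 2 * (4 * eta * (1 - r))).
{ apply (cauchy_estimate P p (RtoC r) (1 - r)); [lra| | |].
  - intros z Hz. apply HP, Hball, Hz.
  - intros z Hz. apply Hp, Hball, Hz.
  - intros z Hz. destruct (Hball z Hz) as [B1 B2].
    assert (Q := Hin z B1). assert (Q2 := KE z ltac:(lra)). rewrite E1 in Q2.
    assert (Q3 : / 2 <= Cmod (E z)).
    { assert (D := Cmod_diff_le (E z) 1). rewrite Cmod_1 in D. apply Rabs_le_between in D. lra. }
    generalize (Cmod_ge_0 (P z)); nra. }
apply Rmult_le_reg_l with (1 - r); [lra|]. unfold eta in K. lra.
Qed.

(** At distance less than 1 from 1 the real part exceeds 1/2, so the angle is at most twice its
    sine; division by 2 pi more than makes up for the 2. *)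
Lemma circ_near_one (z : C) : Cmod z = 1 -> Cmod (z - 1) < 1 ->
  exists u, circ u = z /\ Rabs u <= Cmod (z - 1).
Proof.
destruct z as [c s]. intros H1 H2.
assert (E1 : c ^ 2 + s ^ 2 = 1) by (generalize (Cmod2_alt (c, s)); rewrite H1; simpl; lra).
assert (E2 : Cmod ((c, s) - 1) ^ 2 = (c - 1) ^ 2 + s ^ 2).
{ rewrite Cmod2_alt. unfold Re, Im; simpl; ring. }
assert (Hc : 1 / 2 < c).
{ assert (Cmod ((c, s) - 1) ^ 2 < 1) by (generalize (Cmod_ge_0 ((c, s) - 1)); nra). nra. }
assert (Hs : -1 <= s <= 1) by nra.
set (th := asin s).
assert (Hsin : sin th = s) by (apply sin_asin; lra).
assert (Hcos : cos th = c).
{ unfold th. rewrite cos_asin by lra. unfold Rsqr.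
  replace (1 - s * s) with (c * c) by nra. apply sqrt_square; lra. }
assert (Hth : - (PI / 2) <= th <= PI / 2) by apply asin_bound.
assert (Hle : Rabs th <= 2 * Rabs s).
{ destruct (MVT_gen sin 0 th cos) as [x [Hx Ex]].
  - intros x _. apply is_derive_Reals, derivable_pt_lim_sin.
  - intros x _. apply continuity_sin.
  - rewrite sin_0, Hsin, !Rminus_0_r in Ex.
    assert (Hcx : 1 / 2 < cos x).
    { rewrite <- Hcos in Hc. eapply Rlt_le_trans; [apply Hc|].
      destruct (Rle_dec 0 th).
      - rewrite Rmin_left, Rmax_right in Hx by lra. apply cos_decr_1; lra.
      - rewrite Rmin_right, Rmax_left in Hx by lra. rewrite <- (cos_neg th), <- (cos_neg x).
        apply cos_decr_1; lra. }
    rewrite Ex, Rabs_mult, (Rabs_pos_eq (cos x)) by lra. generalize (Rabs_pos th); nra. }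
exists (th / (2 * PI)). assert (HPI := PI_RGT_0). assert (HPI2 := PI2_1). split.
- unfold circ. replace (2 * PI * (th / (2 * PI))) with th by (field; lra).
  rewrite Hsin, Hcos. reflexivity.
- assert (Rabs s <= Cmod ((c, s) - 1)).
  { eapply Rle_trans; [|apply Im_le_Cmod]. unfold Im; simpl. right; f_equal; ring. }
  unfold Rdiv. rewrite Rabs_mult, (Rabs_pos_eq (/ (2 * PI))).
  + apply Rmult_le_reg_r with (2 * PI); [lra|]. rewrite Rmult_assoc, Rinv_l, Rmult_1_r by lra.
    generalize (Rabs_pos s); nra.
  + left; apply Rinv_0_lt_compat; lra.
Qed.

Definition is_radial_lim (phi : C -> C) (zeta l : C) : Prop :=
  forall e, 0 < e -> exists d, 0 < d /\ forall r, 1 - d < r < 1 -> Cmod (phi (RtoC r * zeta)%C - l) < e.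

(** If Q had a complex derivative l at [circ t], the chain rule would give b = 2 pi i l [circ t];
    this dictates [B] and [l]. Subtracting the tangent from the rotated Q leaves a function that is
    o(|z - 1|) on the circle, and [fatou_criterion] sends its derivative to 0 along the radius. *)
Lemma is_radial_lim_of_vderive (phi Q : C -> C) (t : R) (b : C) :
  (forall z, Cmod z < 1 -> ex_cderive phi z) -> disc_lipschitz 1 Q ->
  (forall z, Cmod z < 1 -> is_cderive Q z (phi z)) ->
  is_vderive (fun s => Q (circ s)) t b -> exists l, is_radial_lim phi (circ t) l.
Proof.
intros Hphi HQ HD Hb.
assert (Hz : circ t <> 0%C) by (apply Cmod_gt_0; rewrite Cmod_circ; lra).
assert (HPI := PI_RGT_0).
assert (H2pi : (Ci * RtoC (2 * PI))%C <> 0%C).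
{ apply Cmod_gt_0. rewrite Cmod_mult, Cmod_Ci, Cmod_R, Rabs_pos_eq; lra. }
set (B := (b / (Ci * RtoC (2 * PI)))%C).
set (l := (B / circ t)%C).
exists l. intros e He.
set (P := fun z => (Q (circ t * z) - Q (circ t) - B * (z - 1))%C).
set (p := fun z => (circ t * phi (circ t * z) - B)%C).
assert (Hrot : forall z, Cmod (circ t * z) = Cmod z) by (intros; rewrite Cmod_mult, Cmod_circ; ring).
destruct (fatou_criterion P p (1 + Cmod B)) with (e := e / 2) as [d [Hd K]].
- generalize (Cmod_ge_0 B); lra.
- intros z w Hz1 Hw1. unfold P.
  replace (Q (circ t * z) - Q (circ t) - B * (z - 1) - (Q (circ t * w) - Q (circ t) - B * (w - 1)))%C
    with ((Q (circ t * z) - Q (circ t * w)) + - (B * (z - w)))%C by ring.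
  eapply Rle_trans; [apply Cmod_triangle|]. rewrite Cmod_opp, Cmod_mult.
  assert (T := HQ (circ t * z)%C (circ t * w)%C ltac:(rewrite Hrot; exact Hz1) ltac:(rewrite Hrot; exact Hw1)).
  replace (circ t * z - circ t * w)%C with (circ t * (z - w))%C in T by ring. rewrite Hrot in T. lra.
- intros z Hz1. unfold P, p.
  assert (D1 : is_cderive (fun z => Q (circ t * z)%C) z (circ t * phi (circ t * z))%C).
  { replace (circ t * phi (circ t * z))%C with (circ t * RtoC 1 * phi (circ t * z))%C by ring.
    apply (is_cderive_comp Q (fun z => circ t * z)%C); [apply HD; rewrite Hrot; exact Hz1|].
    apply is_cderive_scal, is_cderive_id. }
  assert (D2 : is_cderive (fun z => B * z)%C z (B * RtoC 1)%C) by (apply is_cderive_scal, is_cderive_id).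
  assert (D := is_cderive_plus _ _ z _ _ D1 (is_cderive_plus _ _ z _ _ (is_cderive_scal _ z (- RtoC 1)%C _ D2)
    (is_cderive_const (B - Q (circ t))%C z))).
  match type of D with is_derive _ _ ?X => replace X with (circ t * phi (circ t * z) - B)%C in D end.
  + eapply is_derive_ext; [|exact D]. intros w. simpl. ring.
  + ring.
- intros z Hz1. unfold p. apply ex_cderive_ccont. apply ex_cderive_minus; [|apply ex_cderive_const].
  apply ex_cderive_mult; [apply ex_cderive_const|].
  apply (ex_cderive_comp phi (fun z => circ t * z)%C).
  + apply Hphi. rewrite Hrot. exact Hz1.
  + apply ex_cderive_mult; [apply ex_cderive_const|apply ex_cderive_id].
- intros eta Heta.
  assert (Hk : is_vderive (fun u => Q (circ (t + u)) - B * circ u)%C 0 (RtoC 0)).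
  { destruct Hb as [Hb1 Hb2].
    assert (Eb : (B * (Ci * RtoC (2 * PI)))%C = b) by (unfold B, Cdiv; rewrite <- Cmult_assoc, Cinv_l by exact H2pi; ring).
    assert (Eb1 := f_equal Re Eb). assert (Eb2 := f_equal Im Eb). unfold Re, Im in Eb1, Eb2; simpl in Eb1, Eb2.
    assert (A1 : forall g (l : R), is_derive g t l -> is_derive (fun u => g (t + u)) 0 l).
    { intros g m Hg. evar_last; [apply (is_derive_comp (V := R_NormedModule) g (fun u => t + u))|].
      - rewrite Rplus_0_r; exact Hg.
      - auto_derive; [exact I|reflexivity].
      - unfold scal; simpl; unfold mult; simpl; ring. }
    assert (M1 := A1 _ _ Hb1). assert (M2 := A1 _ _ Hb2). 
    split.
    - replace (Re (RtoC 0)) with (Re b - (fst B * 0 - snd B * (2 * PI))) by (unfold Re; simpl; lra).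
      apply (is_derive_minus (V := R_NormedModule) (fun u => Re (Q (circ (t + u))))
        (fun u => Re (B * circ u)) 0 (Re b)); [exact M1|].
      unfold circ, Re; simpl; auto_derive; auto. replace (2 * PI * 0) with 0 by ring; rewrite ?sin_0, ?cos_0; ring.
    - replace (Im (RtoC 0)) with (Im b - (fst B * (2 * PI) + snd B * 0)) by (unfold Im; simpl; lra).
      apply (is_derive_minus (V := R_NormedModule) (fun u => Im (Q (circ (t + u))))
        (fun u => Im (B * circ u)) 0 (Im b)); [exact M2|].
      unfold circ, Im; simpl; auto_derive; auto. replace (2 * PI * 0) with 0 by ring; rewrite ?sin_0, ?cos_0; ring. }
  destruct (proj1 (is_vderive_eps _ _ _) Hk eta Heta) as [d [Hd K]].
  exists (Rmin d 1). split; [apply Rmin_glb_lt; lra|]. intros z Hz1 Hz2.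
  destruct (circ_near_one z Hz1) as [u [Eu Hu]]; [eapply Rlt_le_trans; [apply Hz2|apply Rmin_r]|].
  assert (Hud : Rabs (u - 0) < d).
  { rewrite Rminus_0_r. eapply Rle_lt_trans; [apply Hu|].
    eapply Rlt_le_trans; [apply Hz2|apply Rmin_l]. }
  specialize (K u Hud). rewrite Rminus_0_r, Rplus_0_r, circ_0, circ_plus, Eu in K.
  apply Rle_trans with (eta * Rabs u); [|apply Rmult_le_compat_l; lra].
  eapply Rle_trans; [|apply K]. unfold P. right. f_equal. ring.
- lra.
- exists d; split; [exact Hd|]. intros r Hr. specialize (K r Hr). unfold p in K.
  replace (phi (RtoC r * circ t) - l)%C with ((circ t * phi (circ t * RtoC r) - B) / circ t)%C.
  + rewrite Cmod_div, Cmod_circ by exact Hz. lra.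
  + unfold l. rewrite (Cmult_comm (RtoC r)). field. exact Hz.
Qed.

(** * The subharmonic test function *)

Lemma circ_surj (z : C) : Cmod z = 1 -> exists t, circ t = z.
Proof.
destruct z as [c s]. intros H1.
assert (E1 : c ^ 2 + s ^ 2 = 1) by (generalize (Cmod2_alt (c, s)); rewrite H1; simpl; lra).
assert (Hc : -1 <= c <= 1) by nra. assert (HPI := PI_RGT_0).
assert (Hs : sqrt (1 - Rsqr c) = Rabs s).
{ rewrite <- sqrt_Rsqr_abs. f_equal. unfold Rsqr. nra. }
destruct (Rle_dec 0 s).
- exists (acos c / (2 * PI)). unfold circ.
  replace (2 * PI * (acos c / (2 * PI))) with (acos c) by (field; lra).
  rewrite cos_acos, sin_acos, Hs, Rabs_pos_eq by lra. reflexivity.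
- exists (- acos c / (2 * PI)). unfold circ.
  replace (2 * PI * (- acos c / (2 * PI))) with (- acos c) by (field; lra).
  rewrite cos_neg, sin_neg, cos_acos, sin_acos, Hs, Rabs_left by lra. f_equal; ring.
Qed.

Section TestFunction.

Variables eps h : R.
Hypothesis Heps : 0 < eps <= 1 / 2.
Hypothesis Hh : 0 < h.

(* Mapping |w| = h to the imaginary axis, the first term is positive exactly inside the disc
   |w| < h; the second one dominates the indicator function of |w| < eps h on the half-plane. *)
Definition testC (w : C) : C :=
  (RtoC (16 * eps) * ((RtoC h - w) / (RtoC h + w)) -
   RtoC 2 * (RtoC (eps * h) / (RtoC (eps * h) + w)))%C.

(* Subharmonic on the half-plane: the two branches agree near |w| = h / 2, where Re testC > 0. *)
Definition test (w : C) : R :=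
  if Rle_dec (Cmod w) (h / 2) then Re (testC w) else Rmax 0 (Re (testC w)).

(** The squared modulus of a + w for w = (x, y), the denominator of both real parts. *)
Let D (a x y : R) : R := (a + x) ^ 2 + y ^ 2.

Lemma D_pos (a x y : R) : 0 < a -> 0 <= x -> 0 < D a x y.
Proof. intros; unfold D; nra. Qed.

Lemma eps_h_pos : 0 < eps * h.
Proof. apply Rmult_lt_0_compat; lra. Qed.

Lemma Re_testC (x y : R) : 0 <= x ->
  Re (testC (x, y)) = 16 * eps * ((h ^ 2 - (x ^ 2 + y ^ 2)) / D h x y) -
    2 * (eps * h * (eps * h + x) / D (eps * h) x y).
Proof.
intros Hx. assert (H1 := D_pos h x y Hh Hx). assert (H2 := D_pos _ x y eps_h_pos Hx).
unfold D in *. unfold testC, Re, Im; simpl. field. split; nra.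
Qed.

Lemma Re_testC_upper (w : C) : 0 <= Re w -> Re (testC w) <= 16 * eps.
Proof.
destruct w as [x y]; intros Hx; unfold Re in Hx; simpl in Hx. rewrite Re_testC by exact Hx.
assert (H1 := D_pos h x y Hh Hx). assert (H2 := D_pos _ x y eps_h_pos Hx). assert (H3 := eps_h_pos).
assert (A1 : (h ^ 2 - (x ^ 2 + y ^ 2)) / D h x y <= 1).
{ apply Rmult_le_reg_r with (D h x y); [exact H1|].
  unfold Rdiv; rewrite Rmult_assoc, Rinv_l by lra. unfold D; nra. }
assert (A2 : 0 <= eps * h * (eps * h + x) / D (eps * h) x y) by (apply Rdiv_le_0_compat; nra).
nra.
Qed.

Lemma Re_testC_lower (w : C) : 0 <= Re w -> - (16 * eps) - 2 <= Re (testC w).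
Proof.
destruct w as [x y]; intros Hx; unfold Re in Hx; simpl in Hx. rewrite Re_testC by exact Hx.
assert (H1 := D_pos h x y Hh Hx). assert (H2 := D_pos _ x y eps_h_pos Hx). assert (H3 := eps_h_pos).
assert (A1 : -1 <= (h ^ 2 - (x ^ 2 + y ^ 2)) / D h x y).
{ apply Rmult_le_reg_r with (D h x y); [exact H1|].
  unfold Rdiv; rewrite Rmult_assoc, Rinv_l by lra. unfold D; nra. }
assert (A2 : eps * h * (eps * h + x) / D (eps * h) x y <= 1).
{ apply Rmult_le_reg_r with (D (eps * h) x y); [exact H2|].
  unfold Rdiv; rewrite Rmult_assoc, Rinv_l by lra. unfold D; nra. }
nra.
Qed.

(** For a > 0 and |w| <= a in the half-plane, Re (a / (a + w)) >= 1/2; the factor 2 in [testC] turns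
    this into the indicator value 1. *)
Lemma Re_testC_near0 (w : C) : 0 <= Re w -> Cmod w < eps * h -> Re (testC w) <= 16 * eps - 1.
Proof.
intros Hx Hw. assert (H3 := eps_h_pos).
assert (Hm : Cmod w ^ 2 < (eps * h) ^ 2) by (generalize (Cmod_ge_0 w); nra).
rewrite Cmod2_alt in Hm. destruct w as [x y]; unfold Re, Im in Hx, Hm; simpl fst in *; simpl snd in *.
rewrite Re_testC by exact Hx.
assert (H1 := D_pos h x y Hh Hx). assert (H2 := D_pos _ x y H3 Hx).
assert (A1 : (h ^ 2 - (x ^ 2 + y ^ 2)) / D h x y <= 1).
{ apply Rmult_le_reg_r with (D h x y); [exact H1|].
  unfold Rdiv; rewrite Rmult_assoc, Rinv_l by lra. unfold D; nra. }
assert (A2 : 1 / 2 <= eps * h * (eps * h + x) / D (eps * h) x y).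
{ apply Rmult_le_reg_r with (D (eps * h) x y); [exact H2|].
  unfold Rdiv; rewrite Rmult_assoc, (Rmult_assoc (_ * _)), Rinv_l by lra. unfold D; nra. }
nra.
Qed.

Lemma Re_testC_far (w : C) : 0 <= Re w -> h <= Cmod w -> Re (testC w) <= 0.
Proof.
intros Hx Hw. assert (H3 := eps_h_pos).
assert (Hm : h ^ 2 <= Cmod w ^ 2) by (apply pow_incr; lra).
rewrite Cmod2_alt in Hm. destruct w as [x y]; unfold Re, Im in Hx, Hm; simpl fst in *; simpl snd in *.
rewrite Re_testC by exact Hx.
assert (H1 := D_pos h x y Hh Hx). assert (H2 := D_pos _ x y H3 Hx).
assert (A1 : (h ^ 2 - (x ^ 2 + y ^ 2)) / D h x y <= 0).
{ apply Rmult_le_reg_r with (D h x y); [exact H1|].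
  unfold Rdiv; rewrite Rmult_assoc, Rinv_l by lra. lra. }
assert (A2 : 0 <= eps * h * (eps * h + x) / D (eps * h) x y) by (apply Rdiv_le_0_compat; nra).
nra.
Qed.

(** On this arc the first quotient is at least 1/3, its value at w = h / 2, and the second at most 2
    eps, which leaves 16 eps / 3 - 4 eps > 0. *)
Lemma Re_testC_middle (w : C) : 0 <= Re w -> Cmod w = h / 2 -> 0 < Re (testC w).
Proof.
intros Hx Hw. assert (H3 := eps_h_pos).
assert (Hxh : Re w <= h / 2).
{ rewrite <- Hw. eapply Rle_trans; [apply Rle_abs|apply re_le_Cmod]. }
assert (Hm : Cmod w ^ 2 = h ^ 2 / 4) by (rewrite Hw; field).
rewrite Cmod2_alt in Hm. destruct w as [x y]; unfold Re, Im in Hx, Hm, Hxh; simpl fst in *; simpl snd in *.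
rewrite Re_testC by exact Hx.
assert (H1 := D_pos h x y Hh Hx). assert (H2 := D_pos _ x y H3 Hx).
assert (A1 : 1 / 3 <= (h ^ 2 - (x ^ 2 + y ^ 2)) / D h x y).
{ apply Rmult_le_reg_r with (D h x y); [exact H1|].
  unfold Rdiv; rewrite Rmult_assoc, (Rmult_assoc (h ^ 2 - _)), Rinv_l by lra. unfold D; nra. }
assert (A2 : eps * h * (eps * h + x) / D (eps * h) x y <= 2 * eps).
{ apply Rmult_le_reg_r with (D (eps * h) x y); [exact H2|].
  unfold Rdiv; rewrite Rmult_assoc, Rinv_l, Rmult_1_r by lra.
  replace (D (eps * h) x y) with (eps ^ 2 * h ^ 2 + 2 * eps * h * x + h ^ 2 / 4)
    by (unfold D; rewrite <- Hm; ring).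
  replace (eps * h * (eps * h + x)) with (eps * (h * (eps * h + x))) by ring.
  replace (2 * eps * (eps ^ 2 * h ^ 2 + 2 * eps * h * x + h ^ 2 / 4)) with
    (eps * (2 * eps ^ 2 * h ^ 2 + 4 * eps * h * x + h ^ 2 / 2)) by field.
  apply Rmult_le_compat_l; [lra|].
  assert (T : 0 <= (2 * eps ^ 2 - eps + 1 / 2) * h ^ 2).
  { apply Rmult_le_pos; nra. }
  assert (T2 : 0 <= (h / 2 - x) * h) by (apply Rmult_le_pos; lra).
  assert (T3 : 0 <= x * (eps * h)) by (apply Rmult_le_pos; lra).
  destruct (Rle_dec x (h / 4)).
  - nra.
  - nra. }
nra.
Qed.

Lemma test_far (w : C) : 0 <= Re w -> h <= Cmod w -> test w = 0.
Proof.
intros Hx Hw. unfold test. destruct (Rle_dec _ _); [lra|].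
apply Rmax_left, Re_testC_far; assumption.
Qed.

Lemma test_upper (w : C) : 0 <= Re w -> test w <= 16 * eps.
Proof.
intros Hx. unfold test. destruct (Rle_dec _ _); [apply Re_testC_upper, Hx|].
apply Rmax_lub; [lra|apply Re_testC_upper, Hx].
Qed.

(** Since eps <= 1/2, such w fall into the branch without a maximum, where negative values
    survive. *)
Lemma test_near0 (w : C) : 0 <= Re w -> Cmod w < eps * h -> test w <= 16 * eps - 1.
Proof.
intros Hx Hw. unfold test. destruct (Rle_dec _ _) as [_|n]; [apply Re_testC_near0; assumption|].
exfalso. apply n. nra.
Qed.

Lemma test_ge_Re (w : C) : Re (testC w) <= test w.
Proof. unfold test. destruct (Rle_dec _ _); [lra|apply Rmax_r]. Qed.

Lemma test_bounded (w : C) : 0 <= Re w -> Rabs (test w) <= 16 * eps + 2.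
Proof.
intros Hx. apply Rabs_le. assert (H1 := test_upper w Hx). assert (H2 := test_ge_Re w).
assert (H3 := Re_testC_lower w Hx). lra.
Qed.

Lemma testC_holo (w : C) : 0 <= Re w -> ex_cderive testC w.
Proof.
intros Hx.
assert (Hne : forall a, 0 < a -> (RtoC a + w)%C <> 0%C).
{ intros a Ha E. apply (f_equal Re) in E. unfold Re in *; simpl in *. lra. }
apply (ex_cderive_minus (fun w => RtoC (16 * eps) * ((RtoC h - w) * / (RtoC h + w)))%C
  (fun w => RtoC 2 * (RtoC (eps * h) * / (RtoC (eps * h) + w)))%C).
- apply (ex_cderive_mult (fun _ => RtoC (16 * eps)) (fun w => (RtoC h - w) * / (RtoC h + w))%C);
    [apply ex_cderive_const|].
  apply (ex_cderive_mult (fun w => RtoC h - w)%C (fun w => / (RtoC h + w))%C).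
  + apply (ex_cderive_minus (fun _ => RtoC h) (fun w => w)); [apply ex_cderive_const|apply ex_cderive_id].
  + apply (ex_cderive_Cinv (fun w => RtoC h + w)%C); [apply Hne, Hh|].
    apply (ex_cderive_plus (fun _ => RtoC h) (fun w => w)); [apply ex_cderive_const|apply ex_cderive_id].
- apply (ex_cderive_mult (fun _ => RtoC 2) (fun w => RtoC (eps * h) * / (RtoC (eps * h) + w))%C);
    [apply ex_cderive_const|].
  apply (ex_cderive_mult (fun _ => RtoC (eps * h)) (fun w => / (RtoC (eps * h) + w))%C);
    [apply ex_cderive_const|].
  apply (ex_cderive_Cinv (fun w => RtoC (eps * h) + w)%C); [apply Hne, eps_h_pos|].
  apply (ex_cderive_plus (fun _ => RtoC (eps * h)) (fun w => w)); [apply ex_cderive_const|apply ex_cderive_id].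
Qed.

Lemma test_continuous (w : C) : 0 <= Re w -> forall e, 0 < e ->
  exists d, 0 < d /\ forall w', Cmod (w' - w) < d -> Rabs (test w' - test w) < e.
Proof.
intros Hx e He.
assert (HC := ex_cderive_ccont _ _ (testC_holo w Hx)).
assert (HR : forall w', Rabs (Re (testC w') - Re (testC w)) <= Cmod (testC w' - testC w)).
{ intros w'. apply (re_le_Cmod (testC w' - testC w)). }
assert (HM : forall a b, Rabs (Rmax 0 a - Rmax 0 b) <= Rabs (a - b)).
{ intros a b. unfold Rmax. destruct (Rle_dec 0 a); destruct (Rle_dec 0 b);
  try lra; unfold Rabs; repeat destruct (Rcase_abs _); lra. }
destruct (HC e He) as [d1 [Hd1 K1]].
destruct (Rtotal_order (Cmod w) (h / 2)) as [L|[L|L]].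
- exists (Rmin d1 (h / 2 - Cmod w)). split; [apply Rmin_glb_lt; lra|]. intros w' Hw'.
  assert (W1 := K1 w' (Rlt_le_trans _ _ _ Hw' (Rmin_l _ _))).
  assert (W2 := Rlt_le_trans _ _ _ Hw' (Rmin_r _ _)).
  assert (W3 := Cmod_diff_le w' w). apply Rabs_le_between in W3.
  unfold test. destruct (Rle_dec (Cmod w') _); [|lra]. destruct (Rle_dec (Cmod w) _); [|lra].
  eapply Rle_lt_trans; [apply HR|exact W1].
(* On the gluing arc Re testC is positive, hence positive nearby, and there both branches equal
   it. *)
- assert (HP := Re_testC_middle w Hx L).
  destruct (HC _ HP) as [d2 [Hd2 K2]].
  exists (Rmin d1 d2). split; [apply Rmin_glb_lt; lra|]. intros w' Hw'.
  assert (W1 := K1 w' (Rlt_le_trans _ _ _ Hw' (Rmin_l _ _))).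
  assert (W2 := K2 w' (Rlt_le_trans _ _ _ Hw' (Rmin_r _ _))).
  assert (W3 := Rle_lt_trans _ _ _ (HR w') W2). apply Rabs_lt_between in W3.
  assert (E : forall v, 0 < Re (testC v) -> test v = Re (testC v)).
  { intros v Hv. unfold test. destruct (Rle_dec _ _); [reflexivity|]. apply Rmax_right; lra. }
  rewrite !E by lra. eapply Rle_lt_trans; [apply HR|exact W1].
- exists (Rmin d1 (Cmod w - h / 2)). split; [apply Rmin_glb_lt; lra|]. intros w' Hw'.
  assert (W1 := K1 w' (Rlt_le_trans _ _ _ Hw' (Rmin_l _ _))).
  assert (W2 := Rlt_le_trans _ _ _ Hw' (Rmin_r _ _)).
  assert (W3 := Cmod_diff_le w' w). apply Rabs_le_between in W3.
  unfold test. destruct (Rle_dec (Cmod w') _); [lra|]. destruct (Rle_dec (Cmod w) _); [lra|].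
  eapply Rle_lt_trans; [apply HM|]. eapply Rle_lt_trans; [apply HR|exact W1].
Qed.

Variable v : C -> C.
Hypothesis v_holo : forall z, Cmod z < 1 -> ex_cderive v z.
Hypothesis v_Re : forall z, Cmod z < 1 -> 0 <= Re (v z).

Lemma test_v_continuous (z : C) : Cmod z < 1 -> forall e, 0 < e ->
  exists d, 0 < d /\ forall w, Cmod (w - z) < d -> Rabs (test (v w) - test (v z)) < e.
Proof.
intros Hz e He. destruct (test_continuous (v z) (v_Re z Hz) e He) as [d1 [Hd1 K1]].
destruct (ex_cderive_ccont v z (v_holo z Hz) d1 Hd1) as [d [Hd K]].
exists d; split; [exact Hd|]. intros w Hw. apply K1, K, Hw.
Qed.

Lemma test_v_supported (r : R) : r < 1 -> holo_supported r (fun z => test (v z)).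
Proof.
intros Hr z Hz.
assert (Hball : forall w, Cmod (w - z) < r - Cmod z -> Cmod w < 1).
{ intros w Hw. replace w with (z + (w - z))%C by ring. eapply Rle_lt_trans; [apply Cmod_triangle|]. lra. }
(* Where the two agree, testC composed with v is the support. Otherwise the maximum is attained by 0
   in the outer branch; that branch persists near z, so the constant 0 supports. *)
destruct (Req_dec (test (v z)) (Re (testC (v z)))) as [E|E].
- exists (r - Cmod z), (fun w => testC (v w)). split; [lra|]. split; [|split].
  + intros w Hw. apply ex_cderive_comp; [apply testC_holo, v_Re, Hball, Hw|apply v_holo, Hball, Hw].
  + intros w _ _. apply test_ge_Re.
  + symmetry; exact E.
- assert (F : h / 2 < Cmod (v z) /\ test (v z) = 0).
  { unfold test in E |- *. destruct (Rle_dec _ _); [lra|]. split; [lra|].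
    unfold Rmax in *. destruct (Rle_dec _ _); lra. }
  destruct F as [F1 F2].
  destruct (ex_cderive_ccont v z (v_holo z ltac:(lra)) (Cmod (v z) - h / 2)) as [d [Hd K]]; [lra|].
  exists d, (fun _ => RtoC 0). split; [exact Hd|]. split; [|split].
  + intros w _. apply ex_cderive_const.
  + intros w Hw _. specialize (K w Hw). assert (W3 := Cmod_diff_le (v w) (v z)).
    apply Rabs_le_between in W3. unfold test. destruct (Rle_dec _ _); [lra|].
    unfold Re at 1; simpl. apply Rmax_l.
  + rewrite F2. reflexivity.
Qed.

End TestFunction.

(** * Sums and rotations of supported functions *)

Lemma holo_supported_plus (r : R) (W1 W2 : C -> R) :
  holo_supported r W1 -> holo_supported r W2 -> holo_supported r (fun z => W1 z + W2 z).
Proof.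
intros H1 H2 z Hz.
destruct (H1 z Hz) as [d1 [G1 [Hd1 [A1 [B1 C1]]]]].
destruct (H2 z Hz) as [d2 [G2 [Hd2 [A2 [B2 C2]]]]].
exists (Rmin d1 d2), (fun w => G1 w + G2 w)%C.
split; [apply Rmin_glb_lt; assumption|]. split; [|split].
- intros w Hw. apply ex_cderive_plus; [apply A1|apply A2]; eapply Rlt_le_trans; try apply Hw;
  [apply Rmin_l|apply Rmin_r].
- intros w Hw Hwr. 
  assert (K1 := B1 w (Rlt_le_trans _ _ _ Hw (Rmin_l _ _)) Hwr).
  assert (K2 := B2 w (Rlt_le_trans _ _ _ Hw (Rmin_r _ _)) Hwr).
  unfold Re in *; simpl; lra.
- unfold Re in *; simpl; lra.
Qed.

Lemma holo_supported_rotate (r : R) (W : C -> R) (c : C) : Cmod c = 1 ->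
  holo_supported r W -> holo_supported r (fun z => W (c * z)%C).
Proof.
intros Hc H z Hz.
assert (Hrot : forall z, Cmod (c * z) = Cmod z) by (intros; rewrite Cmod_mult, Hc; ring).
destruct (H (c * z)%C) as [d [G [Hd [A1 [B1 C1]]]]]; [rewrite Hrot; exact Hz|].
assert (Hball : forall w, Cmod (w - z) < d -> Cmod (c * w - c * z) < d).
{ intros w Hw. replace (c * w - c * z)%C with (c * (w - z))%C by ring. rewrite Hrot; exact Hw. }
exists d, (fun w => G (c * w)%C). split; [exact Hd|]. split; [|split].
- intros w Hw. apply (ex_cderive_comp G (fun w => c * w)%C); [apply A1, Hball, Hw|].
  apply ex_cderive_mult; [apply ex_cderive_const|apply ex_cderive_id].
- intros w Hw Hwr. apply B1; [apply Hball, Hw|rewrite Hrot; exact Hwr].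
- exact C1.
Qed.

Lemma disc_continuous_plus (r : R) (W1 W2 : C -> R) :
  disc_continuous r W1 -> disc_continuous r W2 -> disc_continuous r (fun z => W1 z + W2 z).
Proof.
intros H1 H2 z Hz e He.
destruct (H1 z Hz (e / 2)) as [d1 [Hd1 K1]]; [lra|].
destruct (H2 z Hz (e / 2)) as [d2 [Hd2 K2]]; [lra|].
exists (Rmin d1 d2). split; [apply Rmin_glb_lt; assumption|]. intros w Hw Hwz.
assert (L1 := K1 w Hw (Rlt_le_trans _ _ _ Hwz (Rmin_l _ _))).
assert (L2 := K2 w Hw (Rlt_le_trans _ _ _ Hwz (Rmin_r _ _))).
apply Rabs_lt_between in L1. apply Rabs_lt_between in L2. apply Rabs_lt_between. lra.
Qed.

Lemma disc_continuous_rotate (r : R) (W : C -> R) (c : C) : Cmod c = 1 ->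
  disc_continuous r W -> disc_continuous r (fun z => W (c * z)%C).
Proof.
intros Hc H z Hz e He.
assert (Hrot : forall z, Cmod (c * z) = Cmod z) by (intros; rewrite Cmod_mult, Hc; ring).
destruct (H (c * z)%C) with (e := e) as [d [Hd K]]; [rewrite Hrot; exact Hz|exact He|].
exists d; split; [exact Hd|]. intros w Hw Hwz. apply K; [rewrite Hrot; exact Hw|].
replace (c * w - c * z)%C with (c * (w - z))%C by ring. rewrite Hrot; exact Hwz.
Qed.

(** * The sub-mean value inequality on a circle *)

Section SubMeanValue.

Variables (W : C -> R) (r : R).
Hypothesis Hr : 0 < r.
Hypothesis W_cont : disc_continuous r W.
Hypothesis W_supp : holo_supported r W.

(** The angular step 1 / (n + 1) stays fixed while the last index m varies, so that induction on m
    is possible. *)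
Let rot_sum (n m : nat) (z : C) : R := sum_f_R0 (fun k => W (circ (INR k / INR (S n)) * z)%C) m.

(** Rotations fix 0, so each of the n + 1 terms contributes W 0 there, and the sum is again
    continuous and supported. *)
Lemma rot_sum_max (n : nat) (M : R) :
  (forall z, Cmod z = r -> rot_sum n n z <= M) -> INR (S n) * W 0%C <= M.
Proof.
intros HM.
assert (E : forall m, rot_sum n m 0%C = INR (S m) * W 0%C).
{ induction m as [|m IH].
  - change (rot_sum n 0 0%C) with (W (circ (INR 0 / INR (S n)) * 0)%C).
    rewrite Cmult_0_r. simpl; ring.
  - change (rot_sum n (S m) 0%C) with (rot_sum n m 0%C + W (circ (INR (S m) / INR (S n)) * 0)%C).
    rewrite IH, Cmult_0_r, (S_INR (S m)). ring. }
rewrite <- E.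
assert (H : forall m, disc_continuous r (rot_sum n m) /\ holo_supported r (rot_sum n m)).
{ induction m as [|m [IH1 IH2]].
  - split; [apply (disc_continuous_rotate r W)|apply (holo_supported_rotate r W)];
      auto using Cmod_circ.
  - split.
    + apply (disc_continuous_plus r (rot_sum n m)); [exact IH1|].
      apply (disc_continuous_rotate r W); auto using Cmod_circ.
    + apply (holo_supported_plus r (rot_sum n m)); [exact IH2|].
      apply (holo_supported_rotate r W); auto using Cmod_circ. }
apply (maximum_principle (rot_sum n n) r M Hr); [apply H|apply H|exact HM|].
rewrite Cmod_0; lra.
Qed.

Let f (t : R) : R := W (RtoC r * circ t)%C.

Lemma circle_continuous (t : R) : continuous f t.
Proof.
apply continuity_pt_filterlim. intros e He.
destruct (W_cont (RtoC r * circ t)%C) with (e := e) as [d [Hd K]];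
  [rewrite Cmod_scal_circ; lra|exact He|].
assert (Hc : ccont (fun z => z) (RtoC r * circ t)%C).
{ apply ex_cderive_ccont, ex_cderive_id. }
destruct (continuous_on_circle (fun z => z) r t Hc) as [C1 C2].
apply continuity_pt_filterlim in C1. apply continuity_pt_filterlim in C2.
destruct (C1 (d / 2)) as [d1 [Hd1 K1]]; [lra|]. destruct (C2 (d / 2)) as [d2 [Hd2 K2]]; [lra|].
exists (Rmin d1 d2). split; [apply Rmin_glb_lt; assumption|]. intros s [Hs1 Hs2].
assert (L1 := K1 s (conj Hs1 (Rlt_le_trans _ _ _ Hs2 (Rmin_l _ _)))).
assert (L2 := K2 s (conj Hs1 (Rlt_le_trans _ _ _ Hs2 (Rmin_r _ _)))).
apply K; [rewrite Cmod_scal_circ; lra|].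
eapply Rle_lt_trans; [apply Cmod_le_abs|].
replace d with (d / 2 + d / 2) by field. apply Rplus_lt_compat; [exact L1|exact L2].
Qed.

Lemma ex_RInt_circle (a b : R) : ex_RInt f a b.
Proof. apply (ex_RInt_continuous (V := R_CompleteNormedModule)). intros; apply circle_continuous. Qed.

Lemma circle_periodic (t : R) : f (t + 1) = f t.
Proof. unfold f. rewrite circ_plus, circ_1, Cmult_1_r. reflexivity. Qed.

Lemma RInt_circle_shift (a : R) : RInt f a (a + 1) = RInt f 0 1.
Proof.
assert (E1 := RInt_split f a 0 1 (ex_RInt_circle _ _) (ex_RInt_circle _ _)).
assert (E2 := RInt_split f a 1 (a + 1) (ex_RInt_circle _ _) (ex_RInt_circle _ _)).
assert (E3 : RInt f 1 (a + 1) = RInt f 0 a).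
{ assert (L := RInt_comp_lin (V := R_CompleteNormedModule) f 1 1 0 a).
  replace (1 * 0 + 1) with 1 in L by ring. replace (1 * a + 1) with (a + 1) in L by ring.
  rewrite <- L by apply ex_RInt_circle. apply RInt_ext. intros t _.
  change (1 * f (1 * t + 1) = f t). rewrite !Rmult_1_l. apply circle_periodic. }
assert (E4 := RInt_split f a 0 a (ex_RInt_circle _ _) (ex_RInt_circle _ _)).
rewrite RInt_point in E4. unfold zero in E4; simpl in E4. lra.
Qed.

(** Each sample differs by at most e from the mean of f over the following interval of length 1 / (n
    + 1). *)
Lemma RInt_Riemann_sum (n : nat) (a e : R) :
  (forall s t, Rabs (s - t) <= / INR (S n) -> Rabs (f s - f t) <= e) ->
  forall m, sum_f_R0 (fun k => f (a + INR k / INR (S n))) m <=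
    INR (S n) * RInt f a (a + INR (S m) / INR (S n)) + INR (S m) * e.
Proof.
intros He.
set (N := INR (S n)). assert (HN : 0 < N) by (apply lt_0_INR, PeanoNat.Nat.lt_0_succ).
assert (Step : forall x, f x <= N * RInt f x (x + / N) + e).
{ intros x. assert (HiN : 0 < / N) by (apply Rinv_0_lt_compat, HN).
  assert (K : Rabs (RInt f x (x + / N) - f x * / N) <= e * Rabs (/ N)).
  { apply RInt_near_const_param; [apply ex_RInt_circle|]. intros s Hs. apply He.
    replace (x + s * / N - x) with (s * / N) by ring. rewrite Rabs_pos_eq by nra. fold N. nra. }
  rewrite (Rabs_pos_eq (/ N)) in K by lra. apply Rabs_le_between in K.
  destruct K as [K _]. apply Rmult_le_compat_l with (r := N) in K; [|lra].
  replace (N * - (e * / N)) with (- e) in K by (field; lra).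
  replace (N * (RInt f x (x + / N) - f x * / N)) with (N * RInt f x (x + / N) - f x) in K
    by (field; lra). lra. }
induction m as [|m IH].
- assert (K := Step a). simpl. replace (a + 0 / N) with a by (field; lra).
  replace (a + 1 / N) with (a + / N) by (field; lra). lra.
- rewrite tech5. assert (K := Step (a + INR (S m) / N)).
  assert (E := RInt_split f a (a + INR (S m) / N) (a + INR (S m) / N + / N)
    (ex_RInt_circle _ _) (ex_RInt_circle _ _)).
  replace (a + INR (S m) / N + / N) with (a + INR (S (S m)) / N) in E, K
    by (rewrite (S_INR (S m)); field; lra).
  rewrite <- E. replace (INR (S (S m)) * e) with (INR (S m) * e + e) by (rewrite (S_INR (S m)); ring).
  rewrite Rmult_plus_distr_l. lra.
Qed.

(* The rotation averages of [W] obey the maximum principle and, on the circle, are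
   Riemann sums of the circular mean. *)
Lemma sub_mean_value : W 0%C <= RInt f 0 1.
Proof.
apply le_epsilon. intros e He.
(* An integer translation brings t into [0, 1], and a point at distance less than 1 from it then
   lies in [-1, 2]. Periodicity makes uniform continuity there global. *)
destruct (unifcont_1d f (-1) 2) with (eps := mkposreal e He) as [d Hd].
{ intros x _. apply circle_continuous. }
assert (Unif : forall s t, Rabs (s - t) < Rmin d 1 -> Rabs (f s - f t) <= e).
{ intros s t Hst.
  assert (Per : forall k x, f (x + INR k) = f x).
  { induction k as [|k IH]; intros x; [simpl; now rewrite Rplus_0_r|].
    rewrite S_INR, <- Rplus_assoc, circle_periodic. apply IH. }
  assert (PerZ : forall k x, f (x + IZR k) = f x).
  { intros k x. destruct (Z_le_gt_dec 0 k) as [h|h].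
    - rewrite <- (Z2Nat.id k h), <- INR_IZR_INZ. apply Per.
    - rewrite <- (Per (Z.to_nat (- k)) (x + IZR k)), INR_IZR_INZ, Z2Nat.id by lia.
      rewrite opp_IZR. f_equal; ring. }
  set (k := Int_part t). destruct (base_Int_part t) as [B1 B2]. fold k in B1, B2.
  rewrite <- (PerZ (- k)%Z s), <- (PerZ (- k)%Z t), opp_IZR.
  assert (S1 := Rlt_le_trans _ _ _ Hst (Rmin_l _ _)).
  assert (S2 := Rlt_le_trans _ _ _ Hst (Rmin_r _ _)). apply Rabs_lt_between in S2.
  left. apply NNPP. apply (Hd (t + - IZR k) (s + - IZR k)); [lra|lra|].
  change (Rabs (s + - IZR k - (t + - IZR k)) < d).
  replace (s + - IZR k - (t + - IZR k)) with (s - t) by ring. exact S1. }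
assert (Hdm : 0 < Rmin d 1) by (apply Rmin_glb_lt; [apply cond_pos|lra]).
destruct (archimed_cor1 (Rmin d 1) Hdm) as [n [Hn Hn0]].
destruct n as [|n]; [lia|].
assert (HN : 0 < INR (S n)) by (apply lt_0_INR; lia).
apply Rmult_le_reg_l with (INR (S n)); [exact HN|].
apply rot_sum_max. intros z Hz.
destruct (circ_surj (z / RtoC r)) as [t Ht].
{ rewrite Cmod_div, Cmod_R, Rabs_pos_eq, Hz by (try (intros E; apply RtoC_inj in E); lra). field; lra. }
assert (Ez : z = (RtoC r * circ t)%C).
{ rewrite Ht. field. intros E; apply RtoC_inj in E; lra. }
assert (K := RInt_Riemann_sum n t e (fun s t H => Unif s t (Rle_lt_trans _ _ _ H Hn)) n).
replace (t + INR (S n) / INR (S n)) with (t + 1) in K by (field; lra).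
rewrite RInt_circle_shift in K.
replace (INR (S n) * (RInt f 0 1 + e)) with (INR (S n) * RInt f 0 1 + INR (S n) * e) by ring.
eapply Rle_trans; [|apply K]. right. unfold rot_sum. apply sum_eq. intros i _.
unfold f. rewrite Ez. f_equal. rewrite circ_plus. ring.
Qed.

End SubMeanValue.

(** * Circular means of the test function *)

Lemma cos_lipschitz (a b : R) : Rabs (cos a - cos b) <= Rabs (a - b).
Proof.
destruct (MVT_gen cos b a (fun x => - sin x)) as [x [_ E]].
- intros x _. apply is_derive_Reals, derivable_pt_lim_cos.
- intros x _. apply continuity_cos.
- rewrite E, Rabs_mult, Rabs_Ropp. generalize (Rabs_pos (a - b)).
  assert (Rabs (sin x) <= 1) by (apply Rabs_le, SIN_bound). nra.
Qed.

Lemma sin_lipschitz (a b : R) : Rabs (sin a - sin b) <= Rabs (a - b).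
Proof.
destruct (MVT_gen sin b a cos) as [x [_ E]].
- intros x _. apply is_derive_Reals, derivable_pt_lim_sin.
- intros x _. apply continuity_sin.
- rewrite E, Rabs_mult. generalize (Rabs_pos (a - b)).
  assert (Rabs (cos x) <= 1) by (apply Rabs_le, COS_bound). nra.
Qed.

Lemma circ_lipschitz (s t : R) : Cmod (circ s - circ t) <= 4 * PI * Rabs (s - t).
Proof.
assert (HPI := PI_RGT_0).
assert (E : Rabs (2 * PI * s - 2 * PI * t) = 2 * PI * Rabs (s - t)).
{ replace (2 * PI * s - 2 * PI * t) with (2 * PI * (s - t)) by ring.
  rewrite Rabs_mult, (Rabs_pos_eq (2 * PI)) by lra. reflexivity. }
assert (H1 := cos_lipschitz (2 * PI * s) (2 * PI * t)).
assert (H2 := sin_lipschitz (2 * PI * s) (2 * PI * t)).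
eapply Rle_trans; [apply Cmod_le_abs|].
change (Rabs (cos (2 * PI * s) - cos (2 * PI * t)) + Rabs (sin (2 * PI * s) - sin (2 * PI * t))
  <= 4 * PI * Rabs (s - t)). lra.
Qed.

(** Isolates the measure-theoretic input of Fatou's theorem: only differentiability of two real
    Lipschitz functions, the coordinates of the boundary primitive, remains to be supplied almost
    everywhere. *)
Lemma ex_radial_lim_of_derivable (phi : C -> C) : analytic_self_map phi ->
  exists g1 g2 : R -> R,
    (forall s t, Rabs (g1 s - g1 t) <= 4 * PI * Rabs (s - t)) /\
    (forall s t, Rabs (g2 s - g2 t) <= 4 * PI * Rabs (s - t)) /\
    forall t, ex_derive g1 t -> ex_derive g2 t -> exists l, is_radial_lim phi (circ t) l.
Proof.
intros [H1 H2].
destruct (ex_primitive phi H1) as [P HP].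
destruct (lipschitz_extension P) as [Q [HQ HQP]].
{ apply (lipschitz_of_derivative_bound P phi 1 HP). intros z Hz. left. apply H2, Hz. }
assert (HD : forall z, Cmod z < 1 -> is_cderive Q z (phi z)).
{ intros z Hz. apply is_cderive_eps. intros e He.
  destruct (proj1 (is_cderive_eps _ _ _) (HP z Hz) e He) as [d [Hd K]].
  exists (Rmin d (1 - Cmod z)). split; [apply Rmin_glb_lt; lra|]. intros w Hw.
  rewrite !HQP; [apply K; eapply Rlt_le_trans; [apply Hw|apply Rmin_l]|exact Hz|].
  replace w with (z + (w - z))%C by ring. eapply Rle_lt_trans; [apply Cmod_triangle|].
  assert (W := Rlt_le_trans _ _ _ Hw (Rmin_r _ _)). lra. }
assert (HL : forall s t, Cmod (Q (circ s) - Q (circ t)) <= 4 * PI * Rabs (s - t)).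
{ intros s t. eapply Rle_trans; [apply HQ; rewrite Cmod_circ; lra|].
  rewrite Rmult_1_l. apply circ_lipschitz. }
exists (fun t => Re (Q (circ t))), (fun t => Im (Q (circ t))). split; [|split].
- intros s t. eapply Rle_trans; [|apply HL]. apply (re_le_Cmod (Q (circ s) - Q (circ t))).
- intros s t. eapply Rle_trans; [|apply HL]. apply (Im_le_Cmod (Q (circ s) - Q (circ t))).
- intros t [b1 B1] [b2 B2].
  apply (is_radial_lim_of_vderive phi Q t (b1, b2) H1 HQ HD). split; assumption.
Qed.

Lemma radial_lim_Cmod (phi : C -> C) (t : R) (l : C) : analytic_self_map phi -> is_radial_lim phi (circ t) l -> Cmod l <= 1.
Proof.
intros Hphi H. apply le_epsilon. intros e He.
destruct (H e He) as [d [Hd K]].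
set (r := 1 - Rmin d 1 / 2).
assert (D1 := Rmin_l d 1). assert (D2 := Rmin_r d 1). assert (D3 := Rmin_glb_lt d 1 0 Hd Rlt_0_1).
assert (Kr := K r ltac:(unfold r; lra)).
assert (B : Cmod (phi (RtoC r * circ t)%C) < 1).
{ apply (proj2 Hphi). unfold unit_disc. rewrite Cmod_scal_circ; unfold r; lra. }
assert (T := Cmod_diff_le (phi (RtoC r * circ t)%C) l). apply Rabs_le_between in T. lra.
Qed.

(** * The test function along circles of radius r, and its radial limits *)

Section HalfPlane.

Variables (phi : C -> C) (xi : C) (h eps : R).
Hypothesis Hphi : analytic_self_map phi.
Hypothesis Hxi : Cmod xi = 1.

Definition to_half_plane (z : C) : C := (1 - Cconj xi * z)%C.

Lemma Cmod_to_half_plane (z : C) : Cmod (to_half_plane z) = Cmod (z - xi).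
Proof.
unfold to_half_plane.
assert (E : (Cconj xi * xi)%C = RtoC 1).
{ rewrite Cmult_comm, <- Cmod2_conj, Hxi. f_equal; ring. }
rewrite <- E. replace (Cconj xi * xi - Cconj xi * z)%C with (- (Cconj xi * (z - xi)))%C by ring.
rewrite Cmod_opp, Cmod_mult, Cmod_conj, Hxi. ring.
Qed.

Lemma Re_to_half_plane (z : C) : Cmod z <= 1 -> 0 <= Re (to_half_plane z).
Proof.
intros Hz. unfold to_half_plane.
assert (H : Re (Cconj xi * z) <= 1).
{ eapply Rle_trans; [apply Rle_abs|]. eapply Rle_trans; [apply re_le_Cmod|].
  rewrite Cmod_mult, Cmod_conj, Hxi. lra. }
unfold Re in *; simpl in *; lra.
Qed.

Hypothesis Hh : 0 < h < 1 - Cmod (phi 0%C).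
Hypothesis Heps : 0 < eps <= 1 / 2.

Definition circle_test (r t : R) : R := test eps h (to_half_plane (phi (RtoC r * circ t)%C)).

Definition circle_dist (r t : R) : R := Cmod (phi (RtoC r * circ t) - xi).

Let v (z : C) : C := to_half_plane (phi z).

Lemma v_holo (z : C) : Cmod z < 1 -> ex_cderive v z.
Proof.
intros Hz. apply (ex_cderive_minus (fun _ => RtoC 1) (fun z => Cconj xi * phi z)%C).
- apply ex_cderive_const.
- apply ex_cderive_mult; [apply ex_cderive_const|apply Hphi, Hz].
Qed.

Lemma v_Re (z : C) : Cmod z < 1 -> 0 <= Re (v z).
Proof. intros Hz. apply Re_to_half_plane. left. apply Hphi, Hz. Qed.

Lemma test_disc_continuous (r : R) : r < 1 -> disc_continuous r (fun z => test eps h (v z)).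
Proof.
intros Hr z Hz e He.
destruct (test_v_continuous eps h Heps (proj1 Hh) v v_holo v_Re z ltac:(lra) e He) as [d [Hd K]].
exists d; split; [exact Hd|]. intros w _ Hw. apply K, Hw.
Qed.

Lemma circle_test_continuous (r t : R) : 0 < r < 1 -> continuity_pt (circle_test r) t.
Proof.
intros Hr. apply continuity_pt_filterlim.
apply (circle_continuous (fun z => test eps h (v z)) r (proj1 Hr)).
apply test_disc_continuous; lra.
Qed.

(** The hypothesis h < 1 - |phi(0)| enters here: the distance from phi(0) to xi is at least 1 -
    |phi(0)|, so the test function vanishes at the centre. *)
Lemma circle_test_mean (r : R) : 0 < r < 1 -> 0 <= RInt (circle_test r) 0 1.
Proof.
intros Hr.
assert (E : test eps h (v 0%C) = 0).
{ apply test_far; [exact Heps|apply Hh|apply v_Re; rewrite Cmod_0; lra|].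
  unfold v. rewrite Cmod_to_half_plane.
  assert (T := Cmod_diff_le xi (phi 0%C)). rewrite Hxi, Cmod_minus_sym in T.
  apply Rabs_le_between in T. lra. }
apply Rle_trans with (test eps h (v 0%C)); [right; symmetry; exact E|].
apply (sub_mean_value (fun z => test eps h (v z)) r (proj1 Hr)).
- apply test_disc_continuous; lra.
- apply (test_v_supported eps h Heps (proj1 Hh) v v_holo v_Re); lra.
Qed.

Lemma circle_test_bounded (r t : R) : 0 < r < 1 -> Rabs (circle_test r t) <= 16 * eps + 2.
Proof.
intros Hr. apply test_bounded; [exact Heps|apply Hh|]. apply v_Re. rewrite Cmod_scal_circ; lra.
Qed.

Lemma circle_dist_continuous (r t : R) : 0 < r < 1 -> continuity_pt (circle_dist r) t.
Proof.
intros Hr. apply continuity_pt_filterlim.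
apply (circle_continuous (fun z => Cmod (phi z - xi)) r (proj1 Hr)).
intros z Hz e He.
destruct (ex_cderive_ccont phi z (proj1 Hphi z ltac:(unfold unit_disc; lra)) e He) as [d [Hd K]].
exists d; split; [exact Hd|]. intros w _ Hw.
eapply Rle_lt_trans; [apply Cmod_diff_le|].
replace (phi w - xi - (phi z - xi))%C with (phi w - phi z)%C by ring. apply K, Hw.
Qed.

Lemma circle_dist_limit (t : R) (l : C) : is_radial_lim phi (circ t) l -> forall e, 0 < e ->
  exists d, 0 < d /\ forall r, 1 - d < r < 1 -> Rabs (circle_dist r t - Cmod (l - xi)) < e.
Proof.
intros H e He. destruct (H e He) as [d [Hd K]].
exists d; split; [exact Hd|]. intros r Hr. unfold circle_dist.
eapply Rle_lt_trans; [apply Cmod_diff_le|].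
replace (phi (RtoC r * circ t) - xi - (l - xi))%C with (phi (RtoC r * circ t) - l)%C by ring.
apply K, Hr.
Qed.

Lemma circle_test_limit (t : R) (l : C) : is_radial_lim phi (circ t) l -> forall e, 0 < e ->
  exists d, 0 < d /\ forall r, 1 - d < r < 1 ->
    Rabs (circle_test r t - test eps h (to_half_plane l)) < e.
Proof.
intros H e He.
destruct (test_continuous eps h Heps (proj1 Hh) (to_half_plane l)) with (e := e) as [d1 [Hd1 K1]].
{ apply Re_to_half_plane, (radial_lim_Cmod phi t l Hphi), H. } { exact He. }
destruct (H d1 Hd1) as [d [Hd K]].
exists d; split; [exact Hd|]. intros r Hr. apply K1.
unfold to_half_plane.
replace (1 - Cconj xi * phi (RtoC r * circ t) - (1 - Cconj xi * l))%C with
  (- (Cconj xi * (phi (RtoC r * circ t) - l)))%C by ring.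
rewrite Cmod_opp, Cmod_mult, Cmod_conj, Hxi, Rmult_1_l. apply K, Hr.
Qed.

Lemma test_limit_upper (t : R) (l : C) : is_radial_lim phi (circ t) l ->
  test eps h (to_half_plane l) <= 16 * eps.
Proof.
intros H. apply test_upper; [exact Heps|apply Hh|].
apply Re_to_half_plane, (radial_lim_Cmod phi t l Hphi), H.
Qed.

Lemma test_limit_near (t : R) (l : C) : is_radial_lim phi (circ t) l -> Cmod (l - xi) < eps * h ->
  test eps h (to_half_plane l) <= 16 * eps - 1.
Proof.
intros H Hl. apply test_near0; [exact Heps|apply Hh| |].
- apply Re_to_half_plane, (radial_lim_Cmod phi t l Hphi), H.
- rewrite Cmod_to_half_plane; exact Hl.
Qed.

Lemma test_limit_far (t : R) (l : C) : is_radial_lim phi (circ t) l -> h <= Cmod (l - xi) ->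
  test eps h (to_half_plane l) = 0.
Proof.
intros H Hl. apply test_far; [exact Heps|apply Hh| |].
- apply Re_to_half_plane, (radial_lim_Cmod phi t l Hphi), H.
- rewrite Cmod_to_half_plane; exact Hl.
Qed.

End HalfPlane.

(** Balls of [locally] are taken coordinatewise, whence the e / 2 in one direction. *)
Lemma locally_Cmod (l : C) (P : C -> Prop) :
  locally l P <-> exists e, 0 < e /\ forall z, Cmod (z - l) < e -> P z.
Proof.
split.
- intros [d Hd]. exists d; split; [apply cond_pos|]. intros z Hz. apply Hd.
  split; [apply (Rle_lt_trans _ _ _ (re_le_Cmod (z - l)) Hz)|apply (Rle_lt_trans _ _ _ (Im_le_Cmod (z - l)) Hz)].
- intros [e [He H]]. exists (mkposreal (e / 2) ltac:(lra)). intros z [H1 H2]. apply H.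
  assert (K1 : Rabs (Re (z - l)) < e / 2) by exact H1.
  assert (K2 : Rabs (Im (z - l)) < e / 2) by exact H2.
  eapply Rle_lt_trans; [apply Cmod_le_abs|]. lra.
Qed.

(** A sequence of radii is needed for dominated convergence; the shift by two keeps the first radius
    positive. *)
Definition to_one (n : nat) : R := 1 - / INR (S (S n)).

Lemma to_one_range (n : nat) : 0 < to_one n < 1.
Proof.
unfold to_one. rewrite !S_INR. assert (H := pos_INR n).
assert (0 < / (INR n + 1 + 1) < 1); [|lra].
split; [apply Rinv_0_lt_compat; lra|]. rewrite <- Rinv_1. apply Rinv_lt_contravar; lra.
Qed.

Lemma to_one_limit (d : R) : 0 < d -> exists N : nat, forall n, (N <= n)%nat -> 1 - d < to_one n < 1.
Proof.
intros Hd. destruct (archimed_cor1 d Hd) as [N [HN HN0]]. exists N. intros n Hn.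
assert (H := to_one_range n). split; [|lra]. unfold to_one.
assert (INR N <= INR (S (S n))) by (apply le_INR; lia).
assert (0 < INR N) by (apply lt_0_INR; lia).
assert (/ INR (S (S n)) <= / INR N) by (apply Rinv_le_contravar; lra). lra.
Qed.

Lemma is_derive_RInt_0 (f : R -> R) (x : R) : (forall t, continuity_pt f t) ->
  is_derive (fun x => RInt f 0 x) x (f x).
Proof.
intros Hf.
assert (Hc : forall t, continuous f t) by (intros t; apply continuity_pt_filterlim, Hf).
apply (is_derive_RInt (V := R_NormedModule) f (fun x => RInt f 0 x) 0 x); [|apply Hc].
exists (mkposreal 1 Rlt_0_1). intros y _. apply (RInt_correct (V := R_CompleteNormedModule)).
apply (ex_RInt_continuous (V := R_CompleteNormedModule)). intros; apply Hc.
Qed.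

Lemma half_le1 : 1 / 2 <= 1.
Proof. lra. Qed.

Lemma Rmult_le_of_le1 (a x : R) : 0 <= x -> a <= 1 -> a * x <= x.
Proof. nra. Qed.

Lemma sixteen_eps_ge1 (eps : R) : 1 / 2 < eps -> 1 <= 16 * eps.
Proof. lra. Qed.

From HB Require Import structures.
From mathcomp Require Import all_boot all_order all_algebra.
From mathcomp Require Import all_classical all_reals all_analysis.
From mathcomp Require Import measurable_realfun lebesgue_integrable.
From mathcomp Require Import Rstruct Rstruct_topology.
From mathcomp Require Import ring lra.

Import Order.TTheory GRing.Theory Num.Theory.
Import numFieldNormedType.Exports.

(** * Lipschitz functions are differentiable almost everywhere *)

Section LipschitzDerivable.
Local Open Scope classical_set_scope.
Local Open Scope ring_scope.
Context (R : realType) (g : R -> R) (L a b : R).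
Hypothesis ab : a < b.
Hypothesis gL : forall s t, `|g s - g t| <= L * `|s - t|.

(** Positive and at least L, whatever the sign of L. *)
Let K : R := `|L| + 1.
Let clamp (t : R) : R := Order.max a (Order.min b t).
Let G (t : R) : R := g t + 2 * K * t.
Let D : R := G b - G a.
(** The slopes of g + 2 K t lie between K and 3 K, so this function is increasing. Clamping to
    [a, b] and normalizing make it the distribution function of a probability measure, and the
    derivative of g is sought as the density of that measure. *)
Definition lip_cumul (t : R) : R := (G (clamp t) - G a) / D.

Let K_gt0 : 0 < K. Proof. by rewrite /K ltr_wpDl. Qed.

Let GB (s t : R) : s <= t -> K * (t - s) <= G t - G s <= 3 * K * (t - s).
Proof.
move=> st; have := gL t s; rewrite (ger0_norm (x := t - s)) ?subr_ge0//.
have LK : L <= K by rewrite /K (le_trans (ler_norm L))// lerDl.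
have h : L * (t - s) <= K * (t - s) by rewrite ler_wpM2r// subr_ge0.
rewrite ler_norml /G => /andP[h1 h2]; apply/andP; split; nra.
Qed.

Let clamp_le (s t : R) : s <= t -> clamp s <= clamp t.
Proof.
move=> st; rewrite /clamp !maxEle !minEle.
by repeat case: ifPn => //; rewrite -?ltNge => *; lra.
Qed.

Let clampB (s t : R) : s <= t -> clamp t - clamp s <= t - s.
Proof.
move=> st; rewrite /clamp !maxEle !minEle.
by repeat case: ifPn => //; rewrite -?ltNge => *; lra.
Qed.

Let D_gt0 : 0 < D.
Proof. have /andP[+ _] := GB _ _ (ltW ab); apply: lt_le_trans; rewrite mulr_gt0// subr_gt0. by []. Qed.

Let lip_cumul_nd : {homo lip_cumul : x y / x <= y}.
Proof.
move=> s t st; rewrite /lip_cumul ler_pM2r ?invr_gt0// lerB//.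
have /andP[+ _] := GB _ _ (clamp_le _ _ st).
rewrite -(subr_ge0 (G (clamp s))); apply: le_trans.
by rewrite mulr_ge0 ?(ltW K_gt0)// subr_ge0 clamp_le.
Qed.

Let C : R := 3 * K / D.

Let lip_cumulB (s t : R) : s <= t -> lip_cumul t - lip_cumul s <= C * (t - s).
Proof.
move=> st; rewrite /lip_cumul -mulrBl /C mulrAC ler_pM2r ?invr_gt0//.
have /andP[_] := GB _ _ (clamp_le _ _ st); rewrite opprB addrA subrK.
move=> /le_trans; apply; rewrite ler_pM2l ?clampB//.
by rewrite mulr_gt0.
Qed.

Let C_gt0 : 0 < C. Proof. by rewrite /C divr_gt0// mulr_gt0. Qed.

Let lip_cumul_cont : continuous lip_cumul.
Proof.
move=> x; apply/cvgrPdist_lt => e e0; near=> y.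
have H : `|lip_cumul x - lip_cumul y| <= C * `|x - y|.
  have [xy|/ltW yx] := leP x y.
  - rewrite distrC (distrC x) !ger0_norm ?subr_ge0 ?lip_cumul_nd// lip_cumulB//.
  - by rewrite !ger0_norm ?subr_ge0 ?lip_cumul_nd// lip_cumulB.
apply: (le_lt_trans H); rewrite mulrC -ltr_pdivlMr//.
near: y; apply: (nbhsx_ballx x (e / C)); exact: divr_gt0.
Unshelve. all: by end_near. Qed.

HB.instance Definition _ := @isCumulative.Build R _ R lip_cumul lip_cumul_nd
  (right_continuousW lip_cumul_cont).

Let lip_cumulNy : lip_cumul @ -oo --> (0 : R).
Proof.
apply: cvg_near_cst; near=> x; rewrite /lip_cumul.
suff -> : clamp x = a by rewrite subrr mul0r.
have xa : x <= a by near: x; apply: nbhs_ninfty_le; rewrite num_real.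
by rewrite /clamp (min_r (le_trans xa (ltW ab))) max_l.
Unshelve. all: by end_near. Qed.

Let lip_cumuly : lip_cumul @ +oo --> (1 : R).
Proof.
apply: cvg_near_cst; near=> x; rewrite /lip_cumul.
suff -> : clamp x = b by rewrite divff// gt_eqF.
have bx : b <= x by near: x; apply: nbhs_pinfty_ge; rewrite num_real.
by rewrite /clamp (min_l bx) max_r// ltW.
Unshelve. all: by end_near. Qed.

HB.instance Definition _ := @isCumulativeBounded.Build R 0 1 lip_cumul lip_cumulNy lip_cumuly.

Let nu := lebesgue_stieltjes_measure lip_cumul.
Let mu := @lebesgue_measure R.

Let wlength_lip (A : set R) : ocitv A ->
  (wlength lip_cumul A <= C%:E * wlength idfun A)%E.
Proof.
case=> -[x y] _ <- /=; have [xy|yx] := leP x y.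
- rewrite !wlength_itv_bnd// -EFinM lee_fin; exact: lip_cumulB.
- by rewrite set_itv_ge ?bnd_simp -?leNgt ?(ltW yx)// !wlength0 mule0.
Qed.

(** Both measures are infima over the same covers by half-open intervals, and [wlength_lip] compares
    the covers term by term. *)
Let nu_mu : nu `<< mu.
Proof.
apply/null_content_dominatesP => A mA A0.
apply/eqP; rewrite eq_le measure_ge0 andbT; apply/lee_addgt0Pr => e e0; rewrite add0e.
have : (ereal_inf [set (\sum_(0 <= k <oo) wlength idfun (B k))%E | B in measurable_cover (A : set (ocitv_type R))] < (e / C)%:E)%E.
  rewrite -[X in (X < _)%E]/(mu A) (A0 : mu A = 0%E) lte_fin; exact: divr_gt0.
move=> /ereal_inf_lt[_ [B [mB AB] <-]] BC.
apply: (@le_trans _ _ (\sum_(0 <= k <oo) wlength lip_cumul (B k))%E).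
  by apply: ereal_inf_lbound; exists B.
apply: (@le_trans _ _ (\sum_(0 <= k <oo) (C%:E * wlength idfun (B k)))%E).
  apply: lee_nneseries => k _ //; exact: wlength_lip (mB k).
rewrite nneseriesZl//.
apply: (@le_trans _ _ (C%:E * (e / C)%:E)%E).
  by rewrite lee_pmul2l ?lte_fin//; exact: ltW.
by rewrite -EFinM mulrC divfK// gt_eqF.
Qed.

Lemma lipschitz_ae_derivable_itv :
  {ae mu, forall x, a < x < b -> derivable g x 1}.
Proof.
pose f := Radon_Nikodym_SigmaFinite.f nu mu.
have fint : mu.-integrable setT f by exact: Radon_Nikodym_SigmaFinite.f_integrable.
pose h := fine \o f.
have hf : EFin \o h = f.
  by apply/funext => x; rewrite /h /= fineK// Radon_Nikodym_SigmaFinite.f_fin_num.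
have hint : mu.-integrable setT (EFin \o h) by rewrite hf.
have hitv y : mu.-integrable [set` Interval (BRight a) (BRight y)] (EFin \o h).
  exact: integrableS hint.
(* The mass of ]a, y] is the increment of the distribution function, and by absolute continuity the
   integral of the density. *)
have FE y : a < y ->
    (\int[mu]_(t in [set` Interval (BRight a) (BRight y)]) (h t))%R = lip_cumul y.
  move=> ay; rewrite /Rintegral.
  have -> : (\int[mu]_(t in [set` Interval (BRight a) (BRight y)]) (h t)%:E)%E = nu `]a, y].
    transitivity (\int[mu]_(t in `]a, y]%classic) f t)%E.
      by apply: eq_integral => t _; rewrite -[LHS]/((EFin \o h) t) hf.
    by symmetry; exact: (Radon_Nikodym_SigmaFinite.f_integral nu_mu).
  rewrite /nu /lebesgue_stieltjes_measure /measure_extension measurable_mu_extE/=; last exact: is_ocitv.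
  rewrite wlength_itv_bnd ?(ltW ay)//= {2}/lip_cumul.
  have -> : clamp a = a by rewrite /clamp min_r ?max_l// ltW.
  by rewrite subrr mul0r subr0.
have := @FTC1 R h (BRight a) hitv (open_integrable_locally openT hint).
apply: filterS; first exact: (ae_filter_ringOfSetsType mu).
move=> x H /andP[ax xb].
have [dF _] := H ax.
(* On ]a, b[ this expression is g itself: it undoes the normalization and removes the added linear
   term. *)
have G' : derivable (fun y => D * (\int[mu]_(t in [set` Interval (BRight a) (BRight y)]) (h t))%R
   + (G a - (2 * K) * y)) x 1.
  apply: derivableD; first exact: derivableM.
  by apply: derivableB => //; exact: derivableM.
apply: near_eq_derivable G'; near=> y.
have ay : a < y by near: y; apply: lt_nbhsr.
have yb : y < b by near: y; apply: lt_nbhsl.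
rewrite FE// /lip_cumul.
have -> : clamp y = y by rewrite /clamp (min_r (ltW yb)) max_r// ltW.
by rewrite mulrCA divff ?mulr1 ?gt_eqF// /G; ring.
Unshelve. all: by end_near. Qed.

End LipschitzDerivable.

(** * Epsilon-delta forms of derivatives and limits *)

Section EpsilonBridge.
Local Open Scope classical_set_scope.
Local Open Scope ring_scope.
Context (R : realType).
Implicit Types (g : R -> R) (t l : R).

(** The common ground on which the two notions of derivative in use are compared. *)
Definition eps_derivative g t l := forall e : R, 0 < e ->
  exists d : R, 0 < d /\ forall y, `|y - t| < d -> `|g y - g t - l * (y - t)| <= e * `|y - t|.

Lemma derivable_eps g t : derivable g t 1 -> exists l, eps_derivative g t l.
Proof.
move=> /cvg_ex[l /= /cvgrPdist_le H]; exists l => e e0.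
have /nbhs_ballP[d /= d0 Hd] := H e e0.
exists d; split => // y yd.
have [->|yt] := eqVneq y t; first by rewrite !subrr mulr0 subr0 normr0 mulr0.
have yt0 : y - t != 0 by rewrite subr_eq0.
have := Hd (y - t); rewrite /ball/= sub0r normrN => /(_ yd yt0).
rewrite [_%:A]mulr1 subrK => /(ler_wpM2r (normr_ge0 (y - t))).
rewrite -normrM mulrBl distrC [_ *: _]mulrC mulrVK ?unitfE//.
Qed.

Lemma eps_derivative_cvg g t l : eps_derivative g t l ->
  h^-1 *: (g (h + t) - g t) @[h --> 0^'] --> l.
Proof.
move=> H; apply/cvgrPdist_le => e e0; have [d [d0 Hd]] := H e e0.
apply/nbhs_ballP; exists d => //= h; rewrite /ball/= sub0r normrN => hd h0.
have := Hd (h + t); rewrite addrK => /(_ hd) K.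
rewrite -(ler_pM2r (x := `|h|)) ?normr_gt0//; apply: le_trans K.
by rewrite -normrM mulrBl distrC [_ *: _]mulrC mulrVK ?unitfE.
Qed.

Lemma integral_eps_derivative (f F : R -> R) : continuous f ->
  (forall x, eps_derivative F x (f x)) ->
  (\int[lebesgue_measure]_(t in `[0%R, 1%R]) (f t)%:E = (F 1 - F 0)%:E)%E.
Proof.
move=> cf dF.
have F' x := eps_derivative_cvg _ _ _ (dF x).
have DF x : derivable F x 1.
  apply/cvg_ex; exists (f x) => /=.
  by under eq_fun do rewrite [_%:A]mulr1; exact: F'.
have cF : continuous F by move=> x; apply/differentiable_continuous/derivable1_diffP.
rewrite (@continuous_FTC2 _ f F 0 1)// ?EFinB//.
- exact: continuous_subspaceT.
- by split => [x _||]; [exact: DF|apply: cvg_at_right_filter; exact: cF|apply: cvg_at_left_filter; exact: cF].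
- by move=> x _; apply/cvg_lim => //; exact: F'.
Qed.

Lemma cvg_seq_eps (u : nat -> R) l :
  (forall e : R, 0 < e -> exists N : nat, forall n, (N <= n)%N -> `|u n - l| < e) ->
  u n @[n --> \oo] --> l.
Proof.
move=> H; apply/cvgrPdist_lt => e /H[N HN]; exists N => // n /= Nn.
by rewrite distrC; exact: HN.
Qed.

End EpsilonBridge.

(** * Passage to the limit *)

Section LimitComparison.
Local Open Scope classical_set_scope.
Local Open Scope ring_scope.
Context (R : realType) (f g : nat -> R -> R) (F G : R -> R) (N : set R) (M c h d : R).
Let mu := @lebesgue_measure R.
Hypothesis f_cont : forall n, continuous (f n).
Hypothesis g_cont : forall n, continuous (g n).
Hypothesis N0 : mu.-negligible N.
Hypothesis c0 : 0 <= c.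
Hypothesis f_cvg : forall t : R, 0 <= t < 1 -> ~ N t -> f ^~ t @ \oo --> F t.
Hypothesis g_cvg : forall t : R, 0 <= t < 1 -> ~ N t -> g ^~ t @ \oo --> G t.
Hypothesis fM : forall n t, `|f n t| <= M.
Hypothesis f_int : forall n, (0 <= \int[mu]_(t in `[0%R, 1%R]) (f n t)%:E)%E.
Hypothesis F_le : forall t : R, 0 <= t < 1 -> ~ N t -> F t <= c.
Hypothesis F_near : forall t : R, 0 <= t < 1 -> ~ N t -> G t < d -> F t <= c - 1.
Hypothesis F_far : forall t : R, 0 <= t < 1 -> ~ N t -> h <= G t -> F t <= 0.
Hypothesis dh : d <= h.

(** Off the null set, F + 1_{G < d} <= c 1_{G < h}; integrating and using that the integral of F is
    nonnegative gives the bound. A and B need not be measurable: they enter only through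
    monotonicity of outer measure. *)
Lemma limit_comparison (A B : set R) :
  (forall t, B t -> ~ N t -> 0 <= t < 1 /\ G t < d) ->
  (forall t : R, 0 <= t < 1 -> ~ N t -> G t < h -> A t) ->
  (mu B <= c%:E * mu A)%E.
Proof.
move=> BG GA; case: N0 => N' [mN' N'0 NN'].
pose E := [set` Interval (BLeft 0) (BLeft 1)] `\` N' : set R.
have mE : measurable E by apply: measurableD => //; exact: measurable_itv.
have Et t : E t -> (0 <= t < 1) /\ ~ N t.
  by move=> [/=]; rewrite in_itv/= => t01 nt; split=> //; move/NN'.
have muI : mu [set` Interval (BLeft 0%R) (BLeft 1%R)] = 1%E by rewrite /mu lebesgue_measure_itv/= lte_fin ltr01 sube0.
have muIlt : (mu [set` Interval (BLeft 0%R) (BLeft 1%R)] < +oo)%E by rewrite muI ltry.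
have muE : (mu E < +oo)%E.
  apply: (@le_lt_trans _ _ (mu [set` Interval (BLeft 0%R) (BLeft 1%R)])); last by rewrite muI ltry.
  by apply: le_measure; rewrite ?inE//; exact: subDsetl.
have mf n D : measurable_fun D (f n).
  by apply: measurable_funTS; exact: continuous_measurable_fun.
have mg n D : measurable_fun D (g n).
  by apply: measurable_funTS; exact: continuous_measurable_fun.
have mF : measurable_fun E F.
  by apply: (measurable_fun_cvg (h := f)) => [n|x /Et[]]; [exact: mf|exact: f_cvg].
have mG : measurable_fun E G.
  by apply: (measurable_fun_cvg (h := g)) => [n|x /Et[]]; [exact: mg|exact: g_cvg].
(* Measurable replacements for A and B, since on E the function G is a limit of continuous
   functions. *)
pose A0 := E `&` G @^-1` [set` Interval -oo%O (BLeft h)].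
pose B0 := E `&` G @^-1` [set` Interval -oo%O (BLeft d)].
have mA0 : measurable A0 by exact: mG.
have mB0 : measurable B0 by exact: mG.
have FM t : E t -> `|F t| <= M.
  move=> /Et[t01 nt].
  have /cvg_norm h1 := f_cvg _ t01 nt.
  rewrite -(cvg_lim _ h1)//; apply: limr_le; last exact: nearW.
  by apply/cvg_ex; eexists; exact: h1.
have bnd (u : R -> R) (K : R) : (forall t, E t -> `|u t| <= K) -> [bounded u x | x in E].
  move=> uK; exists K; split; first exact: num_real.
  by move=> x Kx t /= Et'; rewrite (le_trans (uK _ Et'))// ltW.
have intF : mu.-integrable E (EFin \o F).
  by apply: measurable_bounded_integrable => //; exact: (bnd _ M).
have intM : mu.-integrable E (EFin \o cst M).
  by apply: measurable_bounded_integrable => //; apply: (bnd _ `|M|) => t _.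
(* Dominated convergence with the constant bound M, once the integrals of f n have been moved from
   [0, 1] to E. *)
have I0 : (0 <= \int[mu]_(t in E) (F t)%:E)%E.
  have := @dominated_cvg _ _ _ mu E mE (fun n t => (f n t)%:E) (EFin \o F) (EFin \o cst M).
  move=> /(_ _ _ _ intM) H.
  have {}H : ((\int[mu]_(x in E) (f n x)%:E)%E @[n --> \oo] --> (\int[mu]_(x in E) (F x)%:E)%E).
    apply: H => //.
    - by move=> n; apply/measurable_EFinP; exact: mf.
    - by move=> x /Et[x01 nx]; apply: cvg_EFin; [exact: nearW|exact: f_cvg].
    - by move=> n x _; rewrite /= lee_fin.
  rewrite -(cvg_lim _ H)//; apply: lime_ge; first by apply/cvg_ex; eexists; exact: H.
  apply: nearW => n; have := f_int n.
  rewrite -(integral_itv_bndo_bndc (a := BLeft 0)); last by apply/measurable_EFinP; exact: mf.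
  rewrite (@negligible_integral _ _ _ mu _ N')//.
  suff : mu.-integrable [set` Interval (BLeft 0%R) (BLeft 1%R)] (EFin \o f n) by [].
  apply: measurable_bounded_integrable => //.
  - exact: mf.
  - exists M; split; first exact: num_real.
    by move=> x Mx t _; rewrite /= (le_trans (fM _ _))// ltW.
have intB : mu.-integrable E (EFin \o \1_B0).
  apply: measurable_bounded_integrable => //.
  by apply: (bnd _ 1) => t _; rewrite indicE; case: (_ \in _); rewrite ?normr1 ?normr0.
have intA : mu.-integrable E (EFin \o \1_A0).
  apply: measurable_bounded_integrable => //.
  by apply: (bnd _ 1) => t _; rewrite indicE; case: (_ \in _); rewrite ?normr1 ?normr0.
have muA : (\int[mu]_(t in E) (\1_A0 t)%:E = mu A0)%E.
  by rewrite integral_indic//; congr (mu _); apply/setIidPl => t [].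
have muB : (\int[mu]_(t in E) (\1_B0 t)%:E = mu B0)%E.
  by rewrite integral_indic//; congr (mu _); apply/setIidPl => t [].
have key : (mu B0 <= c%:E * mu A0)%E.
  apply: (@le_trans _ _ (\int[mu]_(t in E) ((F t)%:E + (\1_B0 t)%:E))%E).
    by rewrite integralD// muB leeDr.
  rewrite -muA -integralZl//; apply: le_integral => //.
  - exact: integrableD.
  - exact: integrableZl.
  - move=> t; rewrite inE => Et'; have [t01 nt] := Et _ Et'.
    rewrite -EFinD -EFinM lee_fin !indicE.
    have [tB|tB] := boolP (t \in B0).
      have : t \in A0.
        by move: tB; rewrite !inE /A0 /B0 /= !in_itv/= => -[? ?]; split=> //; exact: lt_le_trans dh.
      move=> ->; rewrite mulr1 -lerBrDr; apply: F_near => //.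
      by move: tB; rewrite inE /B0 /= in_itv/= => -[].
    rewrite addr0; have [tA|tA] := boolP (t \in A0); first by rewrite mulr1; exact: F_le.
    rewrite mulr0; apply: F_far => //; rewrite leNgt; apply: contra tA => Gh.
    by rewrite inE /A0 /= in_itv.
(* B is covered by B0 and the null set N', while A0 lies inside A. *)
apply: (@le_trans _ _ (mu (B0 `|` N'))).
  apply: le_outer_measure => t Bt.
  have [|nt'] := pselect (N' t); first by right.
  left; have nt : ~ N t by move/NN'.
  have [t01 Gt] := BG _ Bt nt; split; last by rewrite /= in_itv.
  by split; [rewrite /= in_itv|exact: nt'].
apply: (@le_trans _ _ (mu B0 + mu N')%E); first exact: measureU2.
rewrite N'0 adde0; apply: (le_trans key); rewrite lee_wpmul2l//.
apply: le_outer_measure => t [/Et[t01 nt]] /=; rewrite in_itv/= => Gh.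
exact: GA.
Qed.

End LimitComparison.

(** * The Carleson box estimate *)

Section StdlibBridge.
Local Open Scope classical_set_scope.
Local Open Scope ring_scope.

Lemma radial_limitP (phi : C -> C) (zeta l : C) :
  radial_limit phi zeta l <-> is_radial_lim phi zeta l.
Proof.
split.
- move=> H e e0.
  have /H : Hierarchy.locally l (fun z : C => Rlt (Cmod (Cminus z l)) e).
    by apply/locally_Cmod; exists e.
  move=> /nbhs_ballP[d /= d0 Hd]; exists d; split; first exact/RltP.
  move=> r [/RltP r1 /RltP r2]; apply: Hd => //.
  by rewrite /ball/= ger0_norm ?subr_ge0 ?ltW// ltrBlDr addrC -ltrBlDr.
- move=> H P /locally_Cmod[e [e0 HP]].
  have [d [/RltP d0 Hd]] := H e e0.
  apply/nbhs_ballP; exists d => //= r; rewrite /ball/= => rd r1.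
  apply: HP; apply: Hd; split; apply/RltP => //.
  rewrite ltrBlDr addrC -ltrBlDr; exact: le_lt_trans (ler_norm _) rd.
Qed.

Lemma eps_derivativeP (g : R -> R) (t l : R) : @eps_derivative (R : realType) g t l <->
  Derive.is_derive (K := R_AbsRing) (V := R_NormedModule) g t l.
Proof.
split.
- move=> H; apply/is_derive_eps => e /RltP e0; have [d [/RltP d0 Hd]] := H e e0.
  by exists d; split=> // y; rewrite !RabsE => /RltP /Hd /RleP.
- move=> /is_derive_eps H e /RltP e0; have [d [/RltP d0 Hd]] := H e e0.
  by exists d; split=> // y; rewrite -!RabsE => /RltP /Hd /RleP.
Qed.

(** Lebesgue and Riemann integral both equal F 1 - F 0 for the primitive F x = [RInt f 0 x]. *)
Lemma integral_RInt (f : R -> R) : (forall t, continuity_pt f t) ->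
  (\int[@lebesgue_measure R]_(t in `[0%R, 1%R]) (f t)%:E = (RInt.RInt (V := R_CompleteNormedModule) f 0 1)%:E)%E.
Proof.
move=> cf; pose F := fun x : R => RInt.RInt (V := R_CompleteNormedModule) f 0 x.
have -> := @integral_eps_derivative (R : realType) f F.
- by rewrite /F RInt_point subr0.
- by move=> x; exact/continuity_ptE.
- by move=> x; exact/eps_derivativeP/is_derive_RInt_0.
Qed.

Lemma to_one_eps (u : R -> R) (l : R) :
  (forall e, Rlt 0 e -> exists d, Rlt 0 d /\ forall r, Rlt (Rminus 1 d) r /\ Rlt r 1 ->
    Rlt (Rabs (Rminus (u r) l)) e) ->
  forall e : R, 0 < e -> exists N : nat, forall n, (N <= n)%N -> `|u (to_one n) - l| < e.
Proof.
move=> H e /RltP e0; have [d [d0 Hd]] := H e e0.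
have [N HN] := to_one_limit d d0; exists N => n /ssrnat.leP Nn.
by rewrite -RabsE; apply/RltP; apply: Hd; exact: HN.
Qed.

Lemma radial_bvP (phi : C -> C) (zeta : C) : (exists l, radial_limit phi zeta l) ->
  radial_limit phi zeta (radial_bv phi zeta).
Proof.
move=> H; rewrite /radial_bv; case: excluded_middle_informative => // K.
by case: (ClassicalEpsilon.constructive_indefinite_description _ K).
Qed.

Lemma ae_radial_limit (phi : C -> C) : analytic_self_map phi ->
  {ae lebesgue_measure, forall t : R, 0 <= t < 1 -> is_radial_lim phi (circ t) (radial_bv phi (circ t))}.
Proof.
move=> /ex_radial_lim_of_derivable[g1 [g2 [L1 [L2 H]]]].
(* Differentiability is obtained inside an open interval; ]-1, 2[ has all of [0, 1[, including 0, in
   its interior. *)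
have lip (g : R -> R) : (forall s t, Rle (Rabs (Rminus (g s) (g t))) (Rmult (Rmult 4 PI) (Rabs (Rminus s t)))) ->
    {ae lebesgue_measure, forall x : R, -1 < x < 2 -> @derivable (R : realType) (R : realType) (R : realType) g x 1}.
  move=> Lg; apply: (@lipschitz_ae_derivable_itv R g (Rmult 4 PI)); first by lra.
  by move=> s t; rewrite -!RabsE; apply/RleP; exact: Lg.
move: (lip g1 L1) (lip g2 L2); apply: (@filterS2 _ _ (ae_filter_ringOfSetsType _)) => t d1 d2 /andP[t0 t1].
have t12 : -1 < t < 2 by apply/andP; split; lra.
have [l1 /eps_derivativeP e1] := derivable_eps _ _ _ (d1 t12).
have [l2 /eps_derivativeP e2] := derivable_eps _ _ _ (d2 t12).
have [l /radial_limitP Hl] := H t (ex_intro _ l1 e1) (ex_intro _ l2 e2).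
by apply/radial_limitP/radial_bvP; exists l.
Qed.

Lemma carleson_box_half (phi : C -> C) (xi : C) (h eps : R) :
  analytic_self_map phi -> Cmod xi = 1%coqR -> (Rlt 0 h /\ Rlt h (Rminus 1 (Cmod (phi (RtoC 0))))) ->
  (Rlt 0 eps /\ Rle eps (Rdiv 1 2)) ->
  (mu_phi phi (S_box xi (Rmult eps h)) <= (Rmult 16 eps)%:E * mu_phi phi (S_box xi h))%E.
Proof.
move=> Hphi Hxi Hh Heps.
have r01 := to_one_range.
have Hae := ae_radial_limit phi Hphi.
(* The complement of [P] is the exceptional null set; on it [radial_bv] may be the default value. *)
pose P := [set t : R | 0 <= t < 1 -> is_radial_lim phi (circ t) (radial_bv phi (circ t))].
have NP t : ~ (~` P) t -> P t by move=> nt; apply: contrapT.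
apply: (@limit_comparison (R : realType)
  (fun n => circle_test phi xi h eps (to_one n)) (fun n => circle_dist phi xi (to_one n))
  (fun t => test eps h (to_half_plane xi (radial_bv phi (circ t))))
  (fun t => Cmod (Cminus (radial_bv phi (circ t)) xi))
  (~` P) (Rplus (Rmult 16 eps) 2) (Rmult 16 eps) h (Rmult eps h)).
- by move=> n t; apply/continuity_ptE; exact: circle_test_continuous.
- by move=> n t; apply/continuity_ptE; exact: circle_dist_continuous.
- exact: Hae.
- apply/RleP; case: Heps => e0 _; have h16 : Rlt 0 16 by exact: IZR_lt.
  exact: Rlt_le (Rmult_lt_0_compat _ _ h16 e0).
- move=> t t01 /NP /(_ t01) Ht.
  apply: (@cvg_seq_eps (R : realType) (fun n => circle_test phi xi h eps (to_one n) t)).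
  apply: (to_one_eps (fun r => circle_test phi xi h eps r t)); exact: circle_test_limit.
- move=> t t01 /NP /(_ t01) Ht.
  apply: (@cvg_seq_eps (R : realType) (fun n => circle_dist phi xi (to_one n) t)).
  apply: (to_one_eps (fun r => circle_dist phi xi r t)); exact: circle_dist_limit.
- by move=> n t; rewrite -RabsE; apply/RleP; exact: circle_test_bounded.
- move=> n; rewrite integral_RInt; last by move=> t; exact: circle_test_continuous.
  by rewrite lee_fin; apply/RleP; exact: circle_test_mean.
- by move=> t t01 /NP /(_ t01) Ht; apply/RleP; exact: test_limit_upper Ht.
- by move=> t t01 /NP /(_ t01) Ht /RltP Hd; apply/RleP; exact: test_limit_near Ht Hd.
- by move=> t t01 /NP /(_ t01) Ht /RleP Hd; apply/RleP; rewrite (test_limit_far _ _ _ _ Hphi Hxi Hh Heps _ _ Ht Hd); exact: Rle_refl.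
- by apply/RleP; apply: Rmult_le_of_le1; move: Hh Heps => [h0 _] [e0 e2]; [exact: Rlt_le|exact: Rle_trans e2 half_le1].
- by move=> t [[/RleP t0 /RltP t1] [_ /RltP Hd]] _; split => //; apply/andP.
(* The box also asks for modulus at most 1, which a radial limit of a self-map of the disc
   satisfies. *)
- move=> t /andP[/RleP t0 /RltP t1] /NP Ht /RltP Hd; split; first by split.
  split=> //; apply: (radial_lim_Cmod phi t _ Hphi); apply: Ht.
  by apply/andP; split; [exact/RleP|exact/RltP].
Qed.

End StdlibBridge.

Open Scope R_scope.

Theorem mainTheorem14 :
  exists k1 : R, 0 < k1 /\
  forall (phi : C -> C), analytic_self_map phi ->
  forall (xi : C), Cmod xi = 1 ->
  forall (h : R), 0 < h < 1 - Cmod (phi 0%C) ->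
  forall (eps : R), 0 < eps < 1 ->
  (mu_phi phi (S_box xi (eps * h)) <= (k1 * eps)%:E * mu_phi phi (S_box xi h))%E.
Proof.
exists 16; split; first by apply: IZR_lt.
move=> phi Hphi xi Hxi h Hh eps [e0 e1].
(* For eps > 1/2 the smaller box is contained in the larger one and 16 eps >= 1. *)
case: (Rle_lt_dec eps (1 / 2)) => he; first exact: carleson_box_half.
apply: (@Order.POrderTheory.le_trans _ _ (mu_phi phi (S_box xi h))).
  apply: le_outer_measure => t [t01 [H1 H2]]; split=> //; split=> //.
  apply: Rlt_le_trans H2 _; apply: Rmult_le_of_le1; apply: Rlt_le => //; by case: Hh.
rewrite -[X in (X <= _)%E]mul1e; apply: lee_wpmul2r; first exact: measure_ge0.
by rewrite lee_fin; apply/RleP; exact: sixteen_eps_ge1.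
Qed.
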